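(* Let $\mathcal S_2$ be an operator system and let $\mathcal S_1\subseteq \mathcal S_2$ be an operator subsystem (a unital $*$-closed subspace with the induced matrix order). The following are equivalent: (1) $\mathcal S_1$ is w.r.i. (relatively weakly injective) in $\mathcal S_2$, i.e. the canonical inclusion $\mathcal S_1\hookrightarrow \mathcal S_1^{**}$ extends to a ucp map $\mathcal S_2\to\mathcal S_1^{**}$; (2) for every matrix system $\mathcal R$, every ucp map $\varphi:\mathcal S_1\to\mathcal R$ has a ucp extension $\tilde\varphi:\mathcal S_2\to\mathcal R$; (3) for every operator system $\mathcal T$, every ucp map $\varphi:\mathcal S_1\to\mathcal T^{**}$ extends to a ucp map $\tilde\varphi:\mathcal S_2\to\mathcal T^{**}$; (4) for every $n$ and every null-subspace $J\subset M_n$, the canonical map gives a unital order embedding $\mathcal S_1\otimes_{\max}(M_n/J)\subseteq \mathcal S_2\otimes_{\max}(M_n/J)$; (5) for every operator system $\mathcal T$, the canonical map gives a complete order embedding $\mathcal S_1\otimes_{\max}\mathcal T\subseteq\mathcal S_2\otimes_{\max}\mathcal T$; (6) every state $\varphi$ on $\mathcal S_1$ has a state extension $\tilde\varphi$ on $\mathcal S_2$ such that every positive linear functional $\psi$ on $\mathcal S_1$ with $\psi\le\varphi$ has a positive extension $\tilde\psi$ on $\mathcal S_2$ with $\tilde\psi\le\tilde\varphi$; moreover, this can be achieved in such a way that $\psi\mapsto\tilde\psi$ is a cp map from the Effros system $[\varphi]$ to the Effros system $[\tilde\varphi]$; (7) $\mathcal S_1^{**}$ is w.r.i. in $\mathcal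 S_2^{**}$ and, moreover, the inclusion $\mathcal S_1^{**}\hookrightarrow\mathcal S_2^{**}$ (the second adjoint of $\mathcal S_1\hookrightarrow\mathcal S_2$) has a ucp inverse, i.e. there is a ucp map $E:\mathcal S_2^{**}\to\mathcal S_1^{**}$ whose composition with the inclusion is the identity of $\mathcal S_1^{**}$.
   Context: An operator system is a unital $*$-closed subspace of some $B(\mathcal H)$ with the induced matricial order; cp means completely positive, ucp means unital completely positive. A complete order embedding is a linear injection $\theta$ such that an element of a matrix level is positive iff its image under the amplification of $\theta$ is positive; an order embedding is the same at level one only. A matrix system is an operator subsystem $\mathcal R\subseteq M_n$ for some $n$. Duality: $\mathcal S^*$ is matrix ordered by $f^*(s)=\overline{f(s^* )}$ and $(f_{ij})\in M_n(\mathcal S^* )^+$ iff $s\mapsto(f_{ij}(s))$, $\mathcal S\to M_n$, is cp. The bidual $\mathcal S^{**}$, with the matrix order dual to that of $\mathcal S^*$ and unit the image of $1_{\mathcal S}$, is an operator system containing $\mathcal S$ canonically. An operator subsystem $\mathcal S_1$ of $\mathcal S_2$ is w.r.i. in $\mathcal S_2$ if the canonical inclusion $\mathcal S_1\hookrightarrow\mathcal S_1^{**}$ extends to a ucp map on $\mathcal S_2$ (this definition applies to any pair of operator systems). Effros system: for a state $f$ on $\mathcal S$, $[f]=\mathrm{span}\{g:\ g \text{ a positive functional on }\mathcal S,\ g\le f\}\subseteq\mathcal S^*$, with the matrix order inherited from $\mathcal S^*$ and unit $f$; it is an operator system. Null-subspaces and quotients: a null-subspace $J\subset M_n$ is a $*$-closed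 subspace containing no positive element other than $0$. The operator system quotient $M_n/J$ is the algebraic quotient with unit $I_n+J$ where $x\in M_k(M_n/J)$ is positive iff for every $\epsilon>0$ the element $x+\epsilon\,(I_n+J)\otimes I_k$ has the form $(s_{ij}+J)$ with $(s_{ij})\in M_k(M_n)^+$. Maximal tensor product: on the algebraic tensor product $\mathcal S\otimes\mathcal T$ let $D_n^{\max}=\{X^*(S\otimes T)X: S\in M_p(\mathcal S)^+,\ T\in M_q(\mathcal T)^+,\ X \text{ a } pq\times n \text{ scalar matrix},\ p,q\in\mathbb N\}$ and $C_n^{\max}=\{x\in M_n(\mathcal S\otimes\mathcal T): x+\epsilon(1\otimes1)_n\in D_n^{\max}\ \forall\epsilon>0\}$, where $(1\otimes 1)_n$ is the diagonal matrix with entries $1\otimes 1$. Then $\mathcal S\otimes_{\max}\mathcal T$ is the operator system $(\mathcal S\otimes\mathcal T,\{C_n^{\max}\},1\otimes1)$. *)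

(* Defs.v *)
From HB Require Import structures.
From mathcomp Require Import all_boot all_order all_algebra.
From mathcomp Require Import generic_quotient ring_quotient sesquilinear spectral.
From mathcomp Require Import all_classical all_reals all_analysis.
From mathcomp Require Import complex mxtens.

Set Implicit Arguments.
Unset Strict Implicit.
Unset Printing Implicit Defensive.

Import Order.TTheory GRing.Theory Num.Theory.
Import numFieldNormedType.Exports.
Local Open Scope classical_set_scope.
Local Open Scope ring_scope.
Local Open Scope complex_scope.
Local Open Scope quotient_scope.

Record linsub (K : nzRingType) (V : lmodType K) := LinSub {
  sp_set :> V -> Prop;
  sp0 : sp_set 0;
  spD : forall x y, sp_set x -> sp_set y -> sp_set (x + y);
  spZ : forall a x, sp_set x -> sp_set (a *: x) }.

Section Sub.
Variables (K : nzRingType) (V : lmodType K) (A : linsub V).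

Definition sp_pred : {pred V} := fun x => `[< A x >].

Lemma sp_pred_closed : submod_closed sp_pred.
Proof.
split; first by apply/asboolP; apply: sp0.
move=> a x y /asboolP Ax /asboolP Ay; apply/asboolP.
by apply: spD => //; apply: spZ.
Qed.

HB.instance Definition _ := GRing.isSubmodClosed.Build K V sp_pred sp_pred_closed.

Record sub := Sub { sub_val : V; sub_valP : sub_val \in sp_pred }.
HB.instance Definition _ := [isSub for sub_val].
HB.instance Definition _ := [Choice of sub by <:].
HB.instance Definition _ := [SubChoice_isSubLmodule of sub by <:].

Lemma subP (x : sub) : A (sub_val x).
Proof. by case: x => x /= /asboolP. Qed.

Lemma sub_valDE (x y : sub) : sub_val (x + y) = sub_val x + sub_val y.
Proof. by []. Qed.

Lemma sub_valZE a (x : sub) : sub_val (a *: x) = a *: sub_val x.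
Proof. by []. Qed.

Definition mksub (x : V) (Ax : A x) : sub := Sub (introT (asboolP _) Ax).
End Sub.

Section Span.
Variables (K : nzRingType) (V : lmodType K) (A : set V).

Definition span_set : set V :=
  [set x | exists2 r : seq (K * V),
     (forall p, p \in r -> A p.2) & x = \sum_(p <- r) p.1 *: p.2].

Lemma span0 : span_set 0.
Proof. by exists [::]; rewrite ?big_nil. Qed.

Lemma spanD x y : span_set x -> span_set y -> span_set (x + y).
Proof.
move=> [r rA ->] [s sA ->]; exists (r ++ s); last by rewrite big_cat.
by move=> p; rewrite mem_cat => /orP[/rA|/sA].
Qed.

Lemma spanZ a x : span_set x -> span_set (a *: x).
Proof.
move=> [r rA ->]; exists [seq (a * p.1, p.2) | p <- r].
  by move=> _ /mapP[p /rA Ap ->].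
by rewrite big_map scaler_sumr; apply: eq_bigr => p _; rewrite scalerA.
Qed.

Definition span : linsub V := LinSub span0 spanD spanZ.

Lemma mem_span x : A x -> span_set x.
Proof.
move=> Ax; exists [:: (1, x)]; last by rewrite big_seq1 scale1r.
by move=> p; rewrite inE => /eqP ->.
Qed.
End Span.

Section SubNormed.
Variables (R : realType) (V : normedModType R[i]) (A : linsub V).

Definition sub_norm (x : sub A) : R[i] := `|\val x|.

Fact sub_normD x y : sub_norm (x + y) <= sub_norm x + sub_norm y.
Proof. exact: ler_normD. Qed.

Fact sub_normZ (a : R[i]) x : sub_norm (a *: x) = `|a| * sub_norm x.
Proof. exact: normrZ. Qed.

Fact sub_norm_eq0 x : sub_norm x = 0 -> x = 0.
Proof. by move=> /normr0_eq0 x0; apply: val_inj. Qed.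

HB.instance Definition _ :=
  Lmodule_isNormed.Build R[i] (sub A) sub_normD sub_normZ sub_norm_eq0.
End SubNormed.

(* Only data: every cone below is given by an explicit formula, so the axioms
   of a matrix order are theorems about the instances.
   The involution is left out: on an operator system it is determined by the
   cones, and neither complete positivity nor order embeddings refer to it.
   It only enters through *-closedness of subspaces of B(H) and of M_n, where
   it is the adjoint. *)

HB.mixin Record hasMatrixCones (R : realType) V & GRing.Lmodule R[i] V := {
  mpos : forall n, set 'M[V]_n }.

#[short(type="mconeType")]
HB.structure Definition MCone (R : realType) :=
  {V of GRing.Lmodule R[i] V & hasMatrixCones R V}.

#[short(type="nmconeType")]
HB.structure Definition NormedMCone (R : realType) :=
  {V of NormedModule R[i] V & hasMatrixCones R V}.

HB.mixin Record hasOrderUnit (R : realType) V & GRing.Lmodule R[i] V := {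
  munit : V }.

#[short(type="umconeType")]
HB.structure Definition UnitalMCone (R : realType) :=
  {V of MCone R V & hasOrderUnit R V}.

#[short(type="unmconeType")]
HB.structure Definition UnitalNormedMCone (R : realType) :=
  {V of NormedMCone R V & hasOrderUnit R V}.

Section Maps.
Variable R : realType.

Definition cp (S T : mconeType R) (f : S -> T) :=
  forall n (X : 'M[S]_n), mpos n X -> mpos n (map_mx f X).

Definition ucp (S T : umconeType R) (f : S -> T) := cp f /\ f munit = munit.

Definition pos1 (S : mconeType R) (x : S) : Prop := mpos 1 (const_mx x).

Definition order_embedding (S T : mconeType R) (f : S -> T) :=
  injective f /\ forall x, pos1 x <-> pos1 (f x).

Definition complete_order_embedding (S T : mconeType R) (f : S -> T) :=
  injective f /\ forall n (X : 'M[S]_n), mpos n X <-> mpos n (map_mx f X).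

End Maps.

Section SubMCone.
Variable R : realType.
HB.instance Definition _ (V : mconeType R) (A : linsub V) :=
  hasMatrixCones.Build R (sub A)
    (fun n => [set X | mpos n (map_mx (@sub_val _ _ A) X)]).
HB.instance Definition _ (V : nmconeType R) (A : linsub V) :=
  NormedModule.on (sub A).
End SubMCone.

Section Bounded.
Variables (R : realType) (V W : normedModType R[i]).

Definition bounded_by (f : V -> W) (M : R) :=
  0 <= M /\ forall x, `|f x| <= M%:C * `|x|.

Definition bounded_linear (f : V -> W) : Prop :=
  linear f /\ exists M, bounded_by f M.

Fact bounded_linear0 : bounded_linear 0.
Proof.
split; first by move=> a x y; rewrite scaler0 addr0.
by exists 0; split=> // x; rewrite normr0 mul0r.
Qed.

Fact bounded_linearD f g : bounded_linear f -> bounded_linear g -> bounded_linear (f + g).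
Proof.
move=> [lf [M [M0 fM]]] [lg [N [N0 gN]]]; split.
  move=> a x y; rewrite !fctE lf lg scalerDr.
  by rewrite addrACA.
exists (M + N); split; first exact: addr_ge0.
move=> x; rewrite rmorphD mulrDl.
by apply: le_trans (ler_normD _ _) _; apply: lerD.
Qed.

Fact bounded_linearZ a f : bounded_linear f -> bounded_linear (a *: f).
Proof.
move=> [lf [M [M0 fM]]]; split.
  move=> b x y; rewrite !fctE lf scalerDr !scalerA.
  by rewrite mulrC.
exists (complex.Re `|a| * M); split.
  by apply: mulr_ge0 => //; have := normr_ge0 a; rewrite lecE => /andP[].
move=> x; rewrite !fctE normrZ rmorphM/= -mulrA.
have -> : (complex.Re `|a|)%:C = `|a| by rewrite RRe_real ?ger0_real.
exact: ler_wpM2l.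
Qed.

Definition bop_space : linsub (V -> W) := LinSub bounded_linear0 bounded_linearD bounded_linearZ.

Definition bop := sub bop_space.

HB.instance Definition _ := GRing.Lmodule.copy bop (sub bop_space).

Definition bop_fun (f : bop) : V -> W := sub_val f.

Lemma bopP (f : bop) : bounded_linear (bop_fun f).
Proof. exact: (subP f). Qed.

Definition mkbop (f : V -> W) (fP : bounded_linear f) : bop := @mksub _ _ bop_space f fP.

HB.instance Definition _ (f : bop) :=
  GRing.isLinear.Build R[i] V W *:%R (bop_fun f) (bopP f).1.

Lemma bop_ext (f g : bop) : (forall x, bop_fun f x = bop_fun g x) -> f = g.
Proof. by move=> fg; apply: val_inj; apply/funext. Qed.

Lemma bopDE (f g : bop) x : bop_fun (f + g) x = bop_fun f x + bop_fun g x.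
Proof. by []. Qed.

Lemma bopZE a (f : bop) x : bop_fun (a *: f) x = a *: bop_fun f x.
Proof. by []. Qed.

Definition opnorm (f : bop) : R := inf [set M : R | bounded_by (bop_fun f) M].

Lemma opnorm_has_inf (f : bop) : has_inf [set M : R | bounded_by (bop_fun f) M].
Proof.
split; first by have [_ [M fM]] := bopP f; exists M.
by exists 0 => M [].
Qed.

Lemma opnorm_ge0 f : 0 <= opnorm f.
Proof.
apply: lb_le_inf; first by have [] := opnorm_has_inf f.
by move=> M [].
Qed.

Lemma opnorm_le f (M : R) : bounded_by (bop_fun f) M -> opnorm f <= M.
Proof. by move=> fM; apply: ge_inf => //; have [] := opnorm_has_inf f. Qed.

Lemma ler_opnorm f x : `|bop_fun f x| <= (opnorm f)%:C * `|x|.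
Proof.
have nR (U : normedModType R[i]) (u : U) : `|u| = (complex.Re `|u|)%:C.
  by rewrite RRe_real ?ger0_real.
have [->|x0] := eqVneq x 0; first by rewrite linear0 !normr0 mulr0.
have x_gt0 : 0 < complex.Re `|x| by rewrite -ltcR -nR normr_gt0.
rewrite (nR _ x) (nR _ (bop_fun f x)) -rmorphM lecR -ler_pdivrMr//.
apply: lb_le_inf; first by have [] := opnorm_has_inf f.
move=> M [_ /(_ x)]; rewrite (nR _ x) (nR _ (bop_fun f x)) -rmorphM lecR.
by rewrite ler_pdivrMr.
Qed.

Lemma bounded_by_opnorm f : bounded_by (bop_fun f) (opnorm f).
Proof. by split; [exact: opnorm_ge0|exact: ler_opnorm]. Qed.

Definition opnormC f : R[i] := (opnorm f)%:C.

Fact opnormD f g : opnormC (f + g) <= opnormC f + opnormC g.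
Proof.
rewrite -rmorphD lecR; apply: opnorm_le; split.
  by rewrite addr_ge0 ?opnorm_ge0.
move=> x; rewrite rmorphD mulrDl.
by apply: le_trans (ler_normD _ _) _; apply: lerD; exact: ler_opnorm.
Qed.

Fact opnormZ_le a f : opnormC (a *: f) <= `|a| * opnormC f.
Proof.
have aE : `|a| = (complex.Re `|a|)%:C by rewrite RRe_real ?ger0_real.
rewrite aE -rmorphM lecR; apply: opnorm_le; split.
  apply: mulr_ge0; last exact: opnorm_ge0.
  by have := normr_ge0 a; rewrite lecE => /andP[].
move=> x; rewrite rmorphM/= -aE -mulrA normrZ; apply: ler_wpM2l => //.
exact: ler_opnorm.
Qed.

Fact opnormZ a f : opnormC (a *: f) = `|a| * opnormC f.
Proof.
apply/eqP; rewrite eq_le opnormZ_le/=.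
have [->|a0] := eqVneq a 0.
  by rewrite normr0 mul0r lecR opnorm_ge0.
rewrite -ler_pdivlMl ?normr_gt0// -normfV.
by rewrite -{1}[f](scalerK a0) opnormZ_le.
Qed.

Fact opnorm_eq0 f : opnormC f = 0 -> f = 0.
Proof.
move=> f0; apply: val_inj; apply/funext => x; apply/eqP.
rewrite -normr_le0; apply: le_trans (ler_opnorm f x) _.
by rewrite -/(opnormC f) f0 mul0r.
Qed.

HB.instance Definition _ := Lmodule_isNormed.Build R[i] bop opnormD opnormZ opnorm_eq0.

Lemma bop_normE (f : bop) : `|f| = (opnorm f)%:C. Proof. by []. Qed.
End Bounded.

Coercion bop_fun : bop >-> Funclass.

(* The inner product is linear in its first argument. *)
Record hilbertType (R : realType) := Hilbert {
  hcar :> completeNormedModType R[i];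
  hdot : {dot hcar for (@Num.conj R[i])};
  hdotE : forall x, hdot x x = `|x| ^+ 2 }.

Section Operators.
Variables (R : realType) (H : hilbertType R).

Definition BH := bop H H.
Identity Coercion bop_of_BH : BH >-> bop.
HB.instance Definition _ := NormedModule.copy BH (bop H H).

Fact id_bounded : bounded_linear (@idfun H).
Proof.
split; first by [].
by exists 1; split=> // x; rewrite mul1r.
Qed.

Definition BHid : BH := mkbop id_bounded.

(* Positivity of X as an operator on the direct sum of n copies of H. *)
HB.instance Definition _ := hasMatrixCones.Build R BH (fun n =>
  [set X | forall v : 'I_n -> H,
     0 <= \sum_i \sum_j hdot H ((X i j : BH) (v j)) (v i)]).

HB.instance Definition _ := hasOrderUnit.Build R BH BHid.

(* T' = T^*; by the Riesz representation theorem every T has exactly one. *)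
Definition adjoint (T T' : BH) := forall x y, hdot H (T x) y = hdot H x (T' y).

Record opsys := OpSys {
  os_space :> linsub BH;
  os_unit : os_space munit;
  os_star : forall T, os_space T -> exists2 T', os_space T' & adjoint T T' }.
End Operators.

Section OpSysType.
Variables (R : realType) (H : hilbertType R).

Definition opsys_car (S : opsys H) := sub S.
HB.instance Definition _ (S : opsys H) :=
  NormedMCone.copy (opsys_car S) (sub S).
HB.instance Definition _ (S : opsys H) :=
  hasOrderUnit.Build R (opsys_car S) (mksub (os_unit S)).
End OpSysType.

Coercion opsys_car : opsys >-> Sortclass.

Section Inclusion.
Variables (R : realType) (H : hilbertType R) (S1 S2 : opsys H).
Hypothesis S12 : forall T, os_space S1 T -> os_space S2 T.

Definition os_incl_fun (x : S1) : S2 := mksub (S12 (subP x)).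

Fact os_incl_bounded : bounded_linear os_incl_fun.
Proof.
split; first by move=> a x y; apply: val_inj.
by exists 1; split=> // x; rewrite mul1r.
Qed.

Definition os_incl : bop S1 S2 := mkbop os_incl_bounded.
End Inclusion.

Definition adjmx (R : realType) m n (A : 'M[R[i]]_(m, n)) : 'M[R[i]]_(n, m) :=
  map_mx (@Num.conj R[i]) A^T.

Section MatrixAlgebra.
Variables (R : realType) (n : nat).

Definition Mn := 'M[R[i]]_n.
HB.instance Definition _ := GRing.Lmodule.copy Mn 'M[R[i]]_n.

(* Positivity of the block matrix X as an operator on (C^n)^k. *)
HB.instance Definition _ := hasMatrixCones.Build R Mn (fun k =>
  [set X | forall v : 'I_k -> 'cV[R[i]]_n,
     0 <= \sum_i \sum_j (adjmx (v i) *m (X i j : 'M[R[i]]_n) *m v j) 0 0]).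

HB.instance Definition _ := hasOrderUnit.Build R Mn 1%:M.

Definition star_closed (J : linsub Mn) :=
  forall x : 'M[R[i]]_n, J x -> J (adjmx x).

Definition null_subspace (J : linsub Mn) :=
  star_closed J /\ forall x : Mn, J x -> pos1 x -> x = 0.

Record msys := MSys {
  ms_space :> linsub Mn;
  ms_unit : ms_space munit;
  ms_star : star_closed ms_space }.

Definition msys_car (S : msys) := sub S.
HB.instance Definition _ (S : msys) := MCone.copy (msys_car S) (sub S).
HB.instance Definition _ (S : msys) :=
  hasOrderUnit.Build R (msys_car S) (mksub (ms_unit S)).
End MatrixAlgebra.

Coercion msys_car : msys >-> Sortclass.

Section Dual.
Variables (R : realType) (S : nmconeType R).

(* The Banach dual; positive functionals on an operator system are bounded. *)
Definition bdual := bop S R[i]^o.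
Identity Coercion bop_of_dual : bdual >-> bop.
HB.instance Definition _ := NormedModule.copy bdual (bop S R[i]^o).

(* F is positive iff s |-> (F i j s) is completely positive into M_n. *)
HB.instance Definition _ := hasMatrixCones.Build R bdual (fun n =>
  [set F | cp (fun s : S => (\matrix_(i, j) (F i j : bdual) s) : Mn R n)]).

Definition dual_pos (f : bdual) := forall s : S, pos1 s -> (0 : R[i]) <= f s.

Definition dual_le (f g : bdual) := dual_pos (g - f).
End Dual.

Section Transpose.
Variables (R : realType) (S T : nmconeType R) (f : bop S T).

Fact dual_map_subproof (g : bdual T) : bounded_linear ((g : T -> R[i]^o) \o f).
Proof.
split; first by move=> a x y /=; rewrite !linearP.
exists (opnorm g * opnorm f); split; first by rewrite mulr_ge0 ?opnorm_ge0.
move=> x /=; apply: le_trans (ler_opnorm _ _) _.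
rewrite rmorphM -mulrA; apply: ler_wpM2l; last exact: ler_opnorm.
by rewrite lecR opnorm_ge0.
Qed.

Definition dual_map_fun (g : bdual T) : bdual S := mkbop (dual_map_subproof g).

Fact dual_map_bounded : bounded_linear dual_map_fun.
Proof.
split.
  move=> a g h; apply: bop_ext => x.
  by rewrite [RHS]bopDE [X in _ = X + _]bopZE.
exists (opnorm f); split; first exact: opnorm_ge0.
move=> g; rewrite bop_normE -rmorphM lecR; apply: opnorm_le; split.
  by rewrite mulr_ge0 ?opnorm_ge0.
move=> x /=; apply: le_trans (ler_opnorm _ _) _.
rewrite [opnorm f * _]mulrC rmorphM -mulrA; apply: ler_wpM2l; last exact: ler_opnorm.
by rewrite lecR opnorm_ge0.
Qed.

Definition dual_map : bop (bdual T) (bdual S) := mkbop dual_map_bounded.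
End Transpose.

Section Bidual.
Variables (R : realType) (S : unmconeType R).

Definition bidual := bdual (bdual S).
Identity Coercion dual_of_bidual : bidual >-> bdual.
HB.instance Definition _ := NormedMCone.copy bidual (bdual (bdual S)).

Fact ev_bounded (s : S) : bounded_linear (fun f : bdual S => f s).
Proof.
split; first by [].
exists (complex.Re `|s|); split.
  by have := normr_ge0 s; rewrite lecE => /andP[].
move=> f; rewrite mulrC RRe_real ?ger0_real//; exact: ler_opnorm.
Qed.

Definition bidual_in (s : S) : bidual := mkbop (ev_bounded s).

HB.instance Definition _ := hasOrderUnit.Build R bidual (bidual_in munit).
End Bidual.

Definition bidual_map (R : realType) (S T : unmconeType R) (f : bop S T) :
  bop (bidual S) (bidual T) := dual_map (dual_map f).

Definition wri (R : realType) (S T : unmconeType R) (j : S -> T) :=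
  exists2 Phi : {linear T -> bidual S}, ucp Phi &
    forall s, Phi (j s) = bidual_in s.

Record state (R : realType) (S : unmconeType R) := State {
  st_fun :> bdual S;
  st_pos : dual_pos st_fun;
  st_unit : st_fun munit = 1 }.

Section Effros.
Variables (R : realType) (S : unmconeType R) (phi : state S).

Definition below : set (bdual S) := [set g | dual_pos g /\ dual_le g phi].

Definition effros := sub (span below).
HB.instance Definition _ := MCone.copy effros (sub (span below)).

Fact phi_below : below phi.
Proof.
split; first exact: st_pos.
by move=> s _; rewrite /dual_le subrr.
Qed.

HB.instance Definition _ :=
  hasOrderUnit.Build R effros (@mksub _ _ (span below) (st_fun phi) (mem_span phi_below)).
Definition effros_val (g : effros) : bdual S := sub_val g.
End Effros.

Section Quotient.
Variables (K : nzRingType) (V : lmodType K) (J : linsub V).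

(* The type of canonical representatives of the cosets of J. *)
Definition quo := Quotient.quot (sp_pred J).
HB.instance Definition _ := GRing.Zmodule.copy quo (Quotient.quot (sp_pred J)).

Definition quo_pi (x : V) : quo := \pi_(Quotient.quot (sp_pred J)) x.
Definition quo_repr (x : quo) : V := repr (x : (Quotient.quot (sp_pred J))).

Lemma quo_piP x y : quo_pi x = quo_pi y <-> J (x - y).
Proof.
rewrite /quo_pi; split=> [/eqP|Jxy]; last apply/eqP.
  by rewrite -Quotient.idealrBE => /asboolP.
by rewrite -Quotient.idealrBE; apply/asboolP.
Qed.

Fact quo_reprK x : quo_pi (quo_repr x) = x.
Proof. exact: reprK. Qed.

Fact quo_piD x y : quo_pi (x + y) = quo_pi x + quo_pi y.
Proof. exact: raddfD. Qed.

Definition quo_scale (a : K) (x : quo) : quo := quo_pi (a *: quo_repr x).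

Fact quo_piZ a x : quo_pi (a *: x) = quo_scale a (quo_pi x).
Proof.
apply/quo_piP; rewrite -scalerBr; apply: spZ.
by apply/quo_piP; rewrite quo_reprK.
Qed.

Fact quo_scaleA a b x : quo_scale a (quo_scale b x) = quo_scale (a * b) x.
Proof. by rewrite -[x]quo_reprK -!quo_piZ scalerA. Qed.

Fact quo_scale1 : left_id 1 quo_scale.
Proof. by move=> x; rewrite -[x]quo_reprK -quo_piZ scale1r. Qed.

Fact quo_scaleDr : right_distributive quo_scale +%R.
Proof.
move=> a x y; rewrite -[x]quo_reprK -[y]quo_reprK -quo_piD -!quo_piZ.
by rewrite -quo_piD scalerDr.
Qed.

Fact quo_scaleDl x : {morph quo_scale^~ x : a b / a + b}.
Proof. by move=> a b; rewrite -[x]quo_reprK -!quo_piZ -quo_piD scalerDl. Qed.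

HB.instance Definition _ := GRing.Zmodule_isLmodule.Build K quo
  quo_scaleA quo_scale1 quo_scaleDr quo_scaleDl.

Fact quo_pi_linear : linear quo_pi.
Proof. by move=> a x y; rewrite quo_piD quo_piZ. Qed.

HB.instance Definition _ :=
  GRing.isLinear.Build K V quo *:%R quo_pi quo_pi_linear.
End Quotient.

Section QuotientCones.
Variables (R : realType) (V : umconeType R) (J : linsub V).

HB.instance Definition _ := hasMatrixCones.Build R (quo J) (fun k =>
  [set x | forall e : R, 0 < e -> exists2 s : 'M[V]_k,
     mpos k s & x + (e%:C *: quo_pi J munit)%:M = map_mx (quo_pi J) s]).

HB.instance Definition _ := hasOrderUnit.Build R (quo J) (quo_pi J munit).
End QuotientCones.

(* The algebraic tensor product is realized as the span of the elementary
   tensors s (x) t := (B |-> B s t) in the space of functionals on the space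
   of bilinear forms B : S x T -> C. *)

Section Tensor.
Variables (R : realType) (S T : lmodType R[i]).

Definition bilin := {bilinear S -> T -> R[i]^o}.

Definition tensor_fun (s : S) (t : T) : bilin -> R[i]^o := fun B => B s t.

Definition tens := sub (span [set F | exists s t, F = tensor_fun s t]).
HB.instance Definition _ := GRing.Lmodule.copy tens
  (sub (span [set F | exists s t, F = tensor_fun s t])).

Fact tensor_subproof s t :
  span [set F | exists s t, F = tensor_fun s t] (tensor_fun s t).
Proof. by apply: mem_span; exists s, t. Qed.

Definition tpure s t : tens := mksub (tensor_subproof s t).

Definition kron p q (A : 'M[S]_p) (B : 'M[T]_q) : 'M[tens]_(p * q) :=
  \matrix_(k, l) tpure (A (mxtens_unindex k).1 (mxtens_unindex l).1)
                        (B (mxtens_unindex k).2 (mxtens_unindex l).2).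
End Tensor.

(* X^* Y X *)
Definition mxcompress (R : realType) (V : lmodType R[i]) m n
    (X : 'M[R[i]]_(m, n)) (Y : 'M[V]_m) : 'M[V]_n :=
  \matrix_(i, j) \sum_k \sum_l (adjmx X i k * X l j) *: Y k l.

Section MaxTensor.
Variables (R : realType) (S T : umconeType R).

Definition tmax := tens S T.
HB.instance Definition _ := GRing.Lmodule.copy tmax (tens S T).

Definition Dmax n : set 'M[tmax]_n :=
  [set x | exists p q (A : 'M[S]_p) (B : 'M[T]_q) (X : 'M[R[i]]_(p * q, n)),
     [/\ mpos p A, mpos q B & x = mxcompress X (kron A B)]].

HB.instance Definition _ := hasMatrixCones.Build R tmax (fun n =>
  [set x | forall e : R, 0 < e ->
     Dmax (x + (e%:C *: (tpure munit munit : tmax))%:M)]).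

HB.instance Definition _ := hasOrderUnit.Build R tmax (tpure munit munit).
End MaxTensor.

Section TensorMap.
Variables (R : realType) (S1 S2 T : lmodType R[i]) (f : {linear S1 -> S2}).

Section Pullback.
Variable B : bilin S2 T.
Definition pull_fun (s : S1) (t : T) : R[i]^o := B (f s) t.
Fact pull_bilinear : bilinear_for *:%R *:%R pull_fun.
Proof.
split=> [t a x y|s a x y]; rewrite /pull_fun; last exact: linearPr.
by rewrite linearP linearPl.
Qed.
HB.instance Definition _ :=
  bilinear_isBilinear.Build R[i] S1 T R[i]^o *:%R *:%R pull_fun pull_bilinear.
Definition pull : bilin S1 T := pull_fun.
End Pullback.

Fact tens_map_subproof (F : tens S1 T) :
  span [set G | exists s t, G = @tensor_fun _ S2 T s t] (fun B => val F (pull B)).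
Proof.
case: F => F /= /asboolP[r rP ->].
have -> : (fun B => (\sum_(p <- r) p.1 *: p.2) (pull B)) =
    \sum_(p <- r) p.1 *: (fun B => p.2 (pull B)) :> (bilin S2 T -> R[i]^o).
  by apply/funext => B; rewrite !fct_sumE.
exists [seq (p.1, fun B => p.2 (pull B)) | p <- r]; last by rewrite big_map.
move=> _ /mapP[p /rP [s [t pE]] ->] /=; exists (f s), t.
by rewrite pE.
Qed.

(* f (x) id_T, see tens_map_tensor. *)
Definition tens_map (F : tens S1 T) : tens S2 T := mksub (tens_map_subproof F).

Lemma tens_map_tensor s t : tens_map (tpure s t) = tpure (f s) t.
Proof. by apply: val_inj. Qed.

Fact tens_map_linear : linear tens_map.
Proof.
move=> a x y; apply: val_inj; apply/funext => B.
have E F : sub_val (tens_map F) B = sub_val F (pull B) by [].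
rewrite [LHS]E sub_valDE sub_valZE.
by rewrite [\val (_ + _)]sub_valDE [sub_val (_ *: tens_map x)]sub_valZE !fctE !E.
Qed.

HB.instance Definition _ :=
  GRing.isLinear.Build R[i] (tens S1 T) (tens S2 T) *:%R tens_map tens_map_linear.
End TensorMap.

Definition tmax_map (R : realType) (S1 S2 T : umconeType R)
    (f : {linear S1 -> S2}) : tmax S1 T -> tmax S2 T := @tens_map R S1 S2 T f.

(* Main.v *)
(** All seven properties are equivalent to the existence of a cp map
    [P : S1^* -> S2^*] with [P f] an extension of [f]: such a [P] is the
    preadjoint of a ucp map [S2 -> S1^**] restricting to the canonical inclusion.
    A cp extension into a bidual, a matrix system or an Effros system is obtained
    by composing with [P], and dualising [P] gives the retraction in (7).

    Conversely, [P] exists as soon as it exists locally, i.e. as soon as every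
    positive matrix [F] over [S1^*] extends to a positive matrix [G] over [S2^*]
    satisfying all linear relations of [F]: the trace [s (x) f |-> f s] then
    extends from [S1 (x) S1^*] to a positive functional on [S2 (x) S1^*], by
    M. Riesz' extension theorem.  After a reduction to unital [F], the local
    extensions come from (2) applied to the matrix system of the [M] satisfying
    the relations of [F], from (6) applied to the trace state of [F], and from
    (4), (5) by extending a functional along [S1 (x) T -> S2 (x) T], where [T] is
    [M_n] modulo the relations of [F] in (4).  In (5) the same space carries the
    order dual to that of [S1], so that it acts by block multiplication on a
    Hilbert sum of the spaces [C^p] over the matrices [A] in [M_p(S1)^+]. *)
Require Import Defs.
From HB Require Import structures.
From mathcomp Require Import all_boot all_order all_algebra.
From mathcomp Require Import sesquilinear spectral.
From mathcomp Require Import all_classical all_reals all_analysis.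
From mathcomp Require Import complex mxtens.
From mathcomp Require Import ring.
Set Implicit Arguments.
Unset Strict Implicit.
Unset Printing Implicit Defensive.
Import Order.TTheory GRing.Theory Num.Theory.
Import numFieldNormedType.Exports.
Local Open Scope classical_set_scope.
Local Open Scope ring_scope.
Local Open Scope complex_scope.

(** * Convex cones and extension of functionals *)

(** The dual of [S1] has in general no order unit, so the trace cannot be extended by an order-unit
    argument. Its domain still majorizes: [a <= r 1] gives [a (x) f <= r 1 (x) f] for positive [f],
    and [1 (x) f] already lies in the smaller tensor product. The sign of the trace at one element
    of the cone involves finitely many functionals only, so finite matrices [F] suffice and no limit
    of local solutions is formed; the linear relations are kept so that [F k l |-> G k l] is a
    linear map. Unitality of [F] serves each construction that starts from it: it puts 1 into the
    matrix system, turns the relations into a null-subspace, and fixes the normalisation of the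
    blocks in the Hilbert sum. Clause (5) speaks of operator systems on Hilbert spaces, and the
    quotient that serves (4) is not given on one; this is why (5) needs a second order on the same
    space, one that is represented concretely. Its blocks are taken over matrices of normalised
    trace, so that the unit acts as the identity, and every positive matrix is reached from these
    after an arbitrarily small shift. *)

Lemma Zorn_above (T : Type) (P : set (set T)) (A0 : set T) :
  P A0 ->
  (forall F : set (set T), F !=set0 -> F `<=` P -> total_on F subset ->
     P (\bigcup_(X in F) X)) ->
  exists A, [/\ P A, A0 `<=` A & forall B, P B -> A `<=` B -> B = A].
Proof.
move=> PA0 PU; pose Q X := X = set0 \/ (P X /\ A0 `<=` X).
have [F FQ Ftot|A [QA Amax]] := @Zorn_bigcup T Q.
  have [[X [FX [PX A0X]]]|nF] := pselect (exists X, F X /\ (P X /\ A0 `<=` X)); last first.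
    left; rewrite -subset0 => x [X FX Xx]; have [X0|PX] := FQ _ FX.
      by rewrite X0 in Xx.
    by case: nF; exists X.
  pose F' := F `&` [set X | P X /\ A0 `<=` X].
  have FF' : \bigcup_(X in F) X = \bigcup_(X in F') X.
    rewrite eqEsubset; split=> x [Y FY Yx]; last by exists Y => //; case: FY.
    by have [Y0|PY] := FQ _ FY; [rewrite Y0 in Yx|exists Y].
  right; rewrite FF'; split; last first.
    by move=> x A0x; exists X; [split|apply: A0X].
  apply: PU; first by exists X.
  - by move=> Y [_ []].
  - by move=> Y Z [FY _] [FZ _]; apply: Ftot.
have {}QA : P A /\ A0 `<=` A.
  case: QA => // A_0; have A00 : A0 = set0.
    rewrite -subset0 => x A0x; apply: (Amax A0); last by rewrite /Q; right; split.
    by rewrite A_0; split; [apply: sub0set|move=> /(_ x A0x)].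
  by rewrite A_0 -[X in P X]A00; split=> //; rewrite A00.
exists A; split; [by case: QA|by case: QA|] => B PB AB.
apply: contrapT => BA; apply: (Amax B).
  by split=> // BsubA; apply: BA; rewrite eqEsubset.
by rewrite /Q; right; split=> //; apply: subset_trans AB; case: QA.
Qed.

Section LinearExtension.
Variables (K : fieldType) (V W : lmodType K).

Definition lin_graph (G : set (V * W)) :=
  forall a p q, G p -> G q -> G (a *: p + q).

(** Partial linear maps are represented by their graphs, so that subspaces need no types of their
    own and Zorn's lemma applies to sets of pairs. *)
Lemma linear_graph_extension (G0 : set (V * W)) :
  G0 0 -> lin_graph G0 -> (forall w, G0 (0, w) -> w = 0) ->
  exists g : {linear V -> W}, forall v w, G0 (v, w) -> g v = w.
Proof.
move=> G00 linG0 funG0.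
pose P (G : set (V * W)) := [/\ G 0, lin_graph G & forall w, G (0, w) -> w = 0].
have [//|F [X0 FX0] FP Ftot|G [[G_0 linG funG] G0G Gmax]] := @Zorn_above _ P G0.
  split.
  - by exists X0 => //; case: (FP _ FX0).
  - move=> a p q [X FX Xp] [Y FY Yq].
    have [XY|YX] := Ftot _ _ FX FY.
      by exists Y => //; case: (FP _ FY) => _ + _; apply=> //; apply: XY.
    by exists X => //; case: (FP _ FX) => _ + _; apply=> //; apply: YX.
  - by move=> w [X FX]; case: (FP _ FX) => _ _; apply.
have GD p q : G p -> G q -> G (p + q) by move=> Gp Gq; rewrite -[p]scale1r; apply: linG.
have GZ a p : G p -> G (a *: p) by move=> Gp; rewrite -[_ *: _]addr0; apply: linG.
have Gfun v w w' : G (v, w) -> G (v, w') -> w = w'.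
  move=> Gw Gw'; apply/eqP; rewrite -subr_eq0; apply/eqP/funG.
  have := linG (-1) _ _ Gw' Gw.
  by rewrite (_ : _ + _ = (-1 *: v + v, -1 *: w' + w))// !scaleN1r addNr addrC.
have Gtot v : exists w, G (v, w).
  apply: contrapT => /forallNP nG.
  (* The new vector [v] is sent to 0; since [v] is outside the domain, any value keeps the graph
     single-valued. *)
  pose G' : set (V * W) := [set p | exists2 q, G q & exists a, p = (q.1 + a *: v, q.2)].
  suff G'G : G' = G.
    apply: (nG 0); rewrite -G'G; exists 0 => //; exists 1.
    by rewrite /= add0r scale1r.
  apply: Gmax; last by move=> p Gp; exists p => //; exists 0; rewrite scale0r addr0; case: p Gp.
  split.
  - by exists 0 => //; exists 0; rewrite scale0r addr0.
  - move=> a _ _ [p Gp [b ->]] [q Gq [c ->]].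
    exists (a *: p + q); first exact: linG.
    exists (a * b + c); rewrite [LHS](_ : _ = (a *: (p.1 + b *: v) + (q.1 + c *: v), a *: p.2 + q.2))//.
    by rewrite scalerDr scalerDl scalerA addrACA.
  - move=> w [[x y] Gxy [a [/esym/eqP + ->]]] /=.
    have [->|a0] := eqVneq a 0.
      by rewrite scale0r addr0 => /eqP x0; apply: funG; rewrite -x0.
    rewrite addrC addr_eq0 => /eqP avx.
    case: (nG (- a^-1 *: y)).
    have := GZ (- a^-1) _ Gxy.
    by rewrite [_ *: _](_ : _ = (- a^-1 *: x, - a^-1 *: y))// scaleNr -scalerN -avx scalerA mulVf// scale1r.
pose g v := projT1 (cid (Gtot v)).
have gP v : G (v, g v) by rewrite /g; case: cid.
have g_lin : linear g.
  move=> a x y; apply: (Gfun (a *: x + y)); first exact: gP.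
  exact: (linG a _ _ (gP x) (gP y)).
pose gl := GRing.isLinear.Build K V W *:%R g g_lin.
pose gL : {linear V -> W} := HB.pack g gl.
by exists gL => v w G0vw; apply: (Gfun v); [apply: gP|apply: G0G].
Qed.

Lemma linear_left_inverse (j : {linear W -> V}) :
  injective j -> exists r : {linear V -> W}, cancel j r.
Proof.
move=> jI.
have [||w [w' []]|r rP] := @linear_graph_extension [set p | exists w, p = (j w, w)].
- by exists 0; rewrite linear0.
- move=> a _ _ [x ->] [y ->]; exists (a *: x + y).
  by rewrite linearP.
- by move=> /esym; rewrite -[RHS](linear0 j) => /jI -> ->.
by exists r => w; apply: rP; exists w.
Qed.
End LinearExtension.

Section RieszExtension.
Variables (R : realType) (V : lmodType R[i]).

Definition rlin_graph (G : set (V * R)) :=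
  forall (a : R) v r w s, G (v, r) -> G (w, s) -> G (a%:C *: v + w, a * r + s).

(* M. Riesz: a real functional that is positive on the part of the convex cone
   [C] lying in its domain extends, provided that the domain majorizes. *)
Lemma riesz_extension (C : set V) (G0 : set (V * R)) :
  C 0 -> (forall x y, C x -> C y -> C (x + y)) ->
  (forall (a : R) x, 0 < a -> C x -> C (a%:C *: x)) ->
  G0 (0, 0) -> rlin_graph G0 ->
  (forall v r, G0 (v, r) -> C v -> 0 <= r) ->
  (forall y, exists z r, G0 (z, r) /\ C (z - y)) ->
  exists u : V -> R, [/\ forall (a : R) x y, u (a%:C *: x + y) = a * u x + u y,
    forall x, C x -> 0 <= u x & forall v r, G0 (v, r) -> u v = r].
Proof.
move=> C0 CD CZ G00 linG0 posG0 majG0.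
pose P (G : set (V * R)) :=
  [/\ G (0, 0), rlin_graph G & forall v r, G (v, r) -> C v -> 0 <= r].
have [//|F [X0 FX0] FP Ftot|G [[G_0 linG posG] G0G Gmax]] := @Zorn_above _ P G0.
  split.
  - by exists X0 => //; case: (FP _ FX0).
  - move=> a v r w s [X FX Xp] [Y FY Yq].
    have [XY|YX] := Ftot _ _ FX FY.
      by exists Y => //; case: (FP _ FY) => _ + _; apply=> //; apply: XY.
    by exists X => //; case: (FP _ FX) => _ + _; apply=> //; apply: YX.
  - by move=> v r [X FX]; case: (FP _ FX) => _ _; apply.
have GD v r w s : G (v, r) -> G (w, s) -> G (v + w, r + s).
  by move=> Gp Gq; have := linG 1 _ _ _ _ Gp Gq; rewrite scale1r mul1r.
have GZ (a : R) v r : G (v, r) -> G (a%:C *: v, a * r).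
  by move=> Gp; have := linG a _ _ _ _ Gp G_0; rewrite !addr0.
have GN v r : G (v, r) -> G (- v, - r).
  by move=> Gp; have := GZ (- 1) _ _ Gp; rewrite rmorphN/= scaleN1r mulN1r.
have Gfun v r s : G (v, r) -> G (v, s) -> r = s.
  move=> Gr Gs; apply/eqP; rewrite eq_le; apply/andP; split; rewrite -subr_ge0.
    by apply: (posG (v - v)); [apply: GD => //; apply: GN|rewrite subrr].
  by apply: (posG (v - v)); [apply: GD => //; apply: GN|rewrite subrr].
have Gtot v : exists r, G (v, r).
  apply: contrapT => /forallNP nG.
  pose L := [set r | exists2 w, G (w, r) & C (v - w)].
  have Lub w s : G (w, s) -> C (w - v) -> ubound L s.
    move=> Gw Cw r [x Gx Cx]; rewrite -subr_ge0.
    apply: (posG (w - x)); first by apply: GD => //; apply: GN.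
    by rewrite -[w](subrK v) -addrA; apply: CD.
  have [z [s [/G0G Gz Cz]]] := majG0 v.
  have Lsup : has_sup L.
    split; last by exists s; apply: (Lub z).
    have [x [r [/G0G Gx Cx]]] := majG0 (- v).
    exists (- r); exists (- x); first exact: GN.
    by rewrite opprK addrC; rewrite opprK in Cx.
  (* [L] collects the values forced from below, by elements [w] of the domain with [v - w] in [C];
     [Lub] bounds it by the values forced from above. At the supremum both constraints hold, which
     after division by [|a|] is positivity of the extended functional at [w + a v]. *)
  pose t := sup L.
  pose G' : set (V * R) := [set p | exists w r, G (w, r) /\
     exists a : R, p = (w + a%:C *: v, r + a * t)].
  suff G'G : G' = G.
    apply: (nG t); rewrite -G'G; exists 0, 0; split=> //; exists 1.
    by rewrite /= !add0r scale1r mul1r.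
  apply: Gmax; last first.
    move=> [w r] Gp; exists w, r; split=> //; exists 0.
    by rewrite scale0r !addr0 mul0r addr0.
  split.
  - by exists 0, 0; split=> //; exists 0; rewrite scale0r mul0r !addr0.
  - move=> a _ _ _ _ [w [r [Gp [b [-> ->]]]]] [x [q [Gq [c [-> ->]]]]].
    exists (a%:C *: w + x), (a * r + q); split; first exact: linG.
    exists (a * b + c); rewrite scalerDr rmorphD rmorphM/= scalerDl scalerA.
    by rewrite addrACA; congr (_, _); ring.
  - move=> _ _ [w [r [Gw [a [-> ->]]]]].
    have [a0|a0|->] := ltgtP a 0; last first.
    + by rewrite scale0r mul0r !addr0; apply: posG.
    + move=> /(CZ a^-1); rewrite invr_gt0 => /(_ a0).
      rewrite scalerDr scalerA -rmorphM/= mulVf ?gt_eqF// scale1r => Cw.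
      rewrite -(pmulr_rge0 _ (_ : 0 < a^-1)) ?invr_gt0// mulrDr mulrA mulVf ?gt_eqF// mul1r.
      rewrite addrC -lerBlDr sub0r; apply: ub_le_sup; first by case: Lsup.
      exists (- (a^-1%:C *: w)); first exact/GN/GZ.
      by rewrite opprK addrC.
    + move=> /(CZ (- a^-1)); rewrite oppr_gt0 invr_lt0 => /(_ a0).
      rewrite scalerDr scalerA -rmorphM/= mulNr mulVf ?lt_eqF//.
      rewrite (_ : (- 1)%:C = -1); last by rewrite rmorphN.
      rewrite scaleN1r => Cw.
      rewrite -(pmulr_rge0 _ (_ : 0 < - a^-1)) ?oppr_gt0 ?invr_lt0//.
      rewrite mulrDr mulrA [X in X * t]mulNr mulVf ?lt_eqF// mulN1r subr_ge0.
      apply: ge_sup; first by case: Lsup.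
      by apply: Lub Cw; exact: GZ.
pose g v := projT1 (cid (Gtot v)).
have gP v : G (v, g v) by rewrite /g; case: cid.
exists g; split=> [a x y|x|v r /G0G Gvr].
- by apply: Gfun (gP _) _; apply: linG; apply: gP.
- exact/posG/gP.
- exact: Gfun (gP _) Gvr.
Qed.
End RieszExtension.

Section Cones.
Variables (R : realType) (V : lmodType R[i]).
Implicit Types (D : set V) (x y : V).

Record convex_cone D : Prop := ConvexCone {
  cone0 : D 0;
  coneD : forall x y, D x -> D y -> D (x + y);
  coneZ : forall (a : R) x, 0 <= a -> D x -> D (a%:C *: x) }.

(* A complex functional is nonnegative on [D] exactly when its real part is
   nonnegative on [complex_cone D]. *)
Definition complex_cone D : set V :=
  [set x | exists a b c, [/\ D a, D b, D c & x = a + 'i%C *: (b - c)]].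

Lemma complex_cone_sub D : convex_cone D -> D `<=` complex_cone D.
Proof.
by move=> cD x Dx; exists x, x, x; split=> //; rewrite subrr scaler0 addr0.
Qed.

Lemma complex_cone_cone D : convex_cone D -> convex_cone (complex_cone D).
Proof.
move=> cD; have [D0 DD DZ] := cD; split; first exact: complex_cone_sub.
- move=> _ _ [a [b [c [Da Db Dc ->]]]] [a' [b' [c' [Da' Db' Dc' ->]]]].
  exists (a + a'), (b + b'), (c + c'); split; [exact: DD..|].
  by rewrite addrACA -scalerDr opprD [b - c + _]addrACA.
- move=> t _ t0 [a [b [c [Da Db Dc ->]]]].
  exists (t%:C *: a), (t%:C *: b), (t%:C *: c); split; [exact: DZ..|].
  by rewrite scalerDr -scalerBr !scalerA mulrC.
Qed.

Lemma complex_cone_im D b : convex_cone D -> D b ->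
  complex_cone D ('i%C *: b) /\ complex_cone D (- ('i%C *: b)).
Proof.
move=> cD Db; have D0 := cone0 cD; split.
  by exists 0, b, 0; split=> //; rewrite subr0 add0r.
by exists 0, 0, b; split=> //; rewrite sub0r scalerN add0r.
Qed.

(* The set of elements all of whose complex multiples are dominated by [E] is a
   subspace. *)
Lemma majorant_gen D (E G : set V) : convex_cone D -> convex_cone E ->
  (forall x, G x -> D x /\ exists2 z, E z & D (z - x)) ->
  (forall Q : set V, Q 0 -> (forall a x y, Q x -> Q y -> Q (a *: x + y)) ->
     G `<=` Q -> forall y, Q y) ->
  forall y, exists2 z, E z & complex_cone D (z - y).
Proof.
move=> cD cE GD gen y.
pose Q := [set y | forall c : R[i], exists2 z, E z & complex_cone D (z - c *: y)].
have cD' := complex_cone_cone cD.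
suff : Q y by move=> /(_ 1); rewrite scale1r.
apply: gen => {y}.
- by move=> c; exists 0; [exact: cone0|rewrite scaler0 subr0; apply: cone0].
- move=> a x y Qx Qy c; have [t Et Dt] := Qx (c * a); have [s Es Ds] := Qy c.
  exists (t + s); first exact: coneD.
  rewrite scalerDr scalerA opprD addrACA.
  exact: coneD.
move=> x /GD[Dx [t Et Dt]] c.
rewrite [c]complexE; set a := complex.Re c; set b := complex.Im c.
suff [s Es Ds] : exists2 s, E s & complex_cone D (s - a%:C *: x).
  suff Di : complex_cone D (- (('i%C * b%:C) *: x)).
    by exists s => //; rewrite scalerDl opprD addrA; exact: coneD.
  have [b0|b0] := leP 0 b.
    by rewrite -scalerA; apply: (complex_cone_im cD _).2; apply: coneZ.
  rewrite -scalerA -scalerN -scaleNr -rmorphN; apply: (complex_cone_im cD _).1.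
  by apply: coneZ => //; rewrite oppr_ge0 ltW.
have [a0|a0] := leP 0 a.
  exists (a%:C *: t); first exact: coneZ.
  by rewrite -scalerBr; apply: complex_cone_sub => //; apply: coneZ.
exists 0; first exact: cone0.
rewrite sub0r -scaleNr -rmorphN; apply: complex_cone_sub => //.
by apply: coneZ => //; rewrite oppr_ge0 ltW.
Qed.

Lemma order_unit_gen D e (G : set V) : convex_cone D ->
  (forall x, G x -> D x /\ exists t : R, D (t%:C *: e - x)) ->
  (forall Q : set V, Q 0 -> (forall a x y, Q x -> Q y -> Q (a *: x + y)) ->
     G `<=` Q -> forall y, Q y) ->
  forall y, exists t : R, complex_cone D (t%:C *: e - y).
Proof.
move=> cD GD gen y.
suff [_ [t ->] Dt] : exists2 z, (exists t : R, z = t%:C *: e) & complex_cone D (z - y).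
  by exists t.
apply: (majorant_gen cD _ _ gen) y.
  split; first by exists 0; rewrite scale0r.
  - by move=> _ _ [t ->] [s ->]; exists (t + s); rewrite rmorphD scalerDl.
  - by move=> a _ _ [t ->]; exists (a * t); rewrite scalerA -rmorphM.
by move=> x /GD[Dx [t Dt]]; split=> //; exists (t%:C *: e) => //; exists t.
Qed.
End Cones.

Section Krein.
Variables (R : realType) (V1 V2 : lmodType R[i]).

(** The real part of [f] is extended by M. Riesz' theorem and then complexified. Since
    [complex_cone D] contains [i y] and [- i y] for [y] in [D], the real extension [u] vanishes at
    [i y]; hence the complex functional is real, and nonnegative, on [D]. *)
Lemma krein_extension (i : {linear V1 -> V2}) (f : {linear V1 -> R[i]^o}) (D : set V2) :
  convex_cone D ->
  (forall y, exists x, complex_cone D (i x - y)) ->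
  (forall x, complex_cone D (i x) -> 0 <= complex.Re (f x)) ->
  exists2 g : {linear V2 -> R[i]^o}, (forall x, g (i x) = f x) &
    forall y, D y -> 0 <= g y.
Proof.
move=> cD majD posD; have cD' := complex_cone_cone cD.
pose G0 : set (V2 * R) := [set p | exists x, p = (i x, complex.Re (f x))].
have ReZ (a : R) (z : R[i]) : complex.Re (a%:C * z) = a * complex.Re z.
  by case: z => x y /=; rewrite mul0r subr0.
have ReD (z w : R[i]) : complex.Re (z + w) = complex.Re z + complex.Re w.
  by case: z w => [? ?] [? ?].
have [|||||v r [x [-> ->]]|y|u [ulin upos uG]] := @riesz_extension R V2 (complex_cone D) G0.
- exact: cone0.
- exact: coneD.
- by move=> a x a0; apply: coneZ => //; apply: ltW.
- by exists 0; rewrite !linear0.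
- move=> a _ _ _ _ [x [-> ->]] [y [-> ->]]; exists (a%:C *: x + y).
  by rewrite !linearP ReD ReZ.
- exact: posD.
- by have [x Dx] := majD y; exists (i x), (complex.Re (f x)); split=> //; exists x.
(* The complex-linear functional whose real part is [u]. *)
pose g y : R[i]^o := (u y)%:C - 'i%C * (u ('i%C *: y))%:C.
have uD x y : u (x + y) = u x + u y.
  by have := ulin 1 x y; rewrite scale1r mul1r.
have u0 : u 0 = 0 by have /eqP := uD 0 0; rewrite addr0 -subr_eq0 opprD addrA subrr sub0r oppr_eq0 => /eqP.
have uZ (a : R) x : u (a%:C *: x) = a * u x.
  by have := ulin a x 0; rewrite !addr0 u0 addr0.
have uN x : u (- x) = - u x.
  by apply/eqP; rewrite -addr_eq0 -uD addNr u0.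
have ii : 'i%C * 'i%C = -1 :> R[i] by rewrite -expr2 sqr_i.
have glin : linear g.
  move=> c x y.
  have -> : c *: x + y = (complex.Re c)%:C *: x + ((complex.Im c)%:C *: ('i%C *: x) + y).
    by rewrite {1}[c]complexE scalerDl mulrC -scalerA addrA.
  rewrite /g; have -> : forall a b : R[i], 'i%C *: (a *: x + (b *: ('i%C *: x) + y)) =
      a *: ('i%C *: x) + (- (b *: x) + 'i%C *: y).
    move=> a b; rewrite !scalerDr !scalerA mulrC; congr (_ + (_ + _)).
    by rewrite ['i%C * b]mulrC -mulrA ii mulrN1 scaleNr.
  rewrite !uD !uN !uZ -[_ *: (_ - _)]/(c * (_ - _)) [in RHS](complexE c).
  rewrite !(rmorphD, rmorphN, rmorphM).
  set A := (u x)%:C; set B := (u y)%:C; set A' := (u _)%:C; set B' := (u _)%:C.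
  set a := _%:C; set b := (complex.Im c)%:C.
  apply/eqP; rewrite -subr_eq0; apply/eqP.
  transitivity ((1 + 'i%C * 'i%C) * (b * A')); first by ring.
  by rewrite ii subrr mul0r.
pose gl := GRing.isLinear.Build R[i] V2 R[i]^o *:%R g glin.
pose gL : {linear V2 -> R[i]^o} := HB.pack g gl.
exists gL => [x|y Dy] /=.
  rewrite /g (uG (i x) (complex.Re (f x))); last by exists x.
  rewrite -linearZ (uG _ (complex.Re (f ('i%C *: x)))); last by exists ('i%C *: x).
  rewrite (_ : f ('i%C *: x) = 'i%C * f x); last exact: linearZ.
  by case: (f x) => a b; simpc.
have [/upos h1 /upos h2] := complex_cone_im cD Dy.
have h3 := upos _ (complex_cone_sub cD Dy).
have -> : g y = (u y)%:C.
  rewrite /g (_ : u ('i%C *: y) = 0) ?mulr0 ?subr0//.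
  by apply/eqP; rewrite eq_le h1 andbT; rewrite uN oppr_ge0 in h2.
by rewrite lecR.
Qed.
End Krein.

Lemma conjE (R : rcfType) (z : R[i]) : Num.conj z = conjc z.
Proof. by []. Qed.

Lemma conjR (R : rcfType) (a : R) : Num.conj a%:C = a%:C.
Proof. by rewrite conjE conjc_real. Qed.

Lemma conjI (R : rcfType) : Num.conj ('i%C : R[i]) = - 'i%C.
Proof. by rewrite conjE; simpc. Qed.

Section Conj.
Variable R : rcfType.
Implicit Types z w : R[i].
Lemma conjM z w : Num.conj (z * w) = Num.conj z * Num.conj w.
Proof. exact: rmorphM. Qed.
Lemma conjD z w : Num.conj (z + w) = Num.conj z + Num.conj w.
Proof. exact: rmorphD. Qed.
Lemma conjB z w : Num.conj (z - w) = Num.conj z - Num.conj w.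
Proof. exact: rmorphB. Qed.
Lemma conjN z : Num.conj (- z) = - Num.conj z.
Proof. exact: rmorphN. Qed.
Lemma conj_sum (I : Type) (r : seq I) P (F : I -> R[i]) :
  Num.conj (\sum_(i <- r | P i) F i) = \sum_(i <- r | P i) Num.conj (F i).
Proof. exact: rmorph_sum. Qed.
Lemma conj1 : Num.conj (1 : R[i]) = 1.
Proof. exact: rmorph1. Qed.
Lemma conj0 : Num.conj (0 : R[i]) = 0.
Proof. exact: rmorph0. Qed.
Lemma conjcI : ('i%C : R[i]) != 0.
Proof. by rewrite eq_complex /= oner_eq0 andbF. Qed.
End Conj.

Section RealC.
Variable R : rcfType.
Implicit Types (a b : R) (z w : R[i]).
Lemma realcM a b : (a * b)%:C = a%:C * b%:C.
Proof. exact: rmorphM. Qed.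
Lemma realcD a b : (a + b)%:C = a%:C + b%:C.
Proof. exact: rmorphD. Qed.
Lemma realcB a b : (a - b)%:C = a%:C - b%:C.
Proof. exact: rmorphB. Qed.
Lemma realcN a : (- a)%:C = - a%:C.
Proof. exact: rmorphN. Qed.
Lemma realc1 : (1 : R)%:C = 1. Proof. by []. Qed.
Lemma realc0 : (0 : R)%:C = 0. Proof. by []. Qed.

Lemma ge0_realc (z : R[i]) : 0 <= z -> exists2 a : R, z = a%:C & 0 <= a.
Proof.
move=> z0; exists (complex.Re z); first by rewrite RRe_real// ger0_real.
by rewrite -lecR RRe_real// ger0_real.
Qed.
Lemma cnormD z w : `|z + w| <= `|z| + `|w|.
Proof. exact: ler_normD. Qed.

Lemma cnormM z w : `|z * w| = `|z| * `|w|.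
Proof. exact: normrM. Qed.

Lemma norm_realc a : `|a%:C : R[i]| = `|a|%:C.
Proof. by rewrite normc_def /= expr0n /= addr0 sqrtr_sqr. Qed.

Lemma norm_ic : `|'i%C : R[i]| = 1.
Proof. by rewrite normc_def /= expr0n expr1n /= add0r sqrtr1. Qed.
End RealC.

Section LinFun.
Variables (R : realType) (V : lmodType R[i]) (f : {linear V -> R[i]^o}).
Lemma linfunD x y : f (x + y) = (f x : R[i]) + f y.
Proof. exact: linearD. Qed.
Lemma linfunB x y : f (x - y) = (f x : R[i]) - f y.
Proof. exact: linearB. Qed.
Lemma linfunN x : f (- x) = - (f x : R[i]).
Proof. exact: linearN. Qed.
Lemma linfun_sum (I : Type) (r : seq I) P (F : I -> V) :
  f (\sum_(i <- r | P i) F i) = \sum_(i <- r | P i) (f (F i) : R[i]).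
Proof. exact: linear_sum. Qed.
Lemma linfunZ a x : f (a *: x) = a * f x.
Proof. exact: linearZ. Qed.
End LinFun.

(** * Ordered spaces with an involution and an order unit *)

Section UnitSpace.
Variables (R : realType) (V : lmodType R[i]).

(** [us_dom] is stated with [complex_cone] so that it makes sense for all [y]; for hermitian [y] the
    dominating difference falls back into [D], by [complex_cone_herm]. The cone may fail to be
    closed, which accounts for the [eps] of [us_separation] and for [closed_cone]. *)
Record unit_space (D : set V) (e : V) (st : V -> V) : Prop := UnitSpace {
  us_linear : forall a x y, st (a *: x + y) = Num.conj a *: st x + st y;
  us_starK : involutive st;
  us_cone : convex_cone D;
  us_herm : forall x, D x -> st x = x;
  us_unit : D e;
  us_dom : forall y, exists t : R, complex_cone D (t%:C *: e - y) }.

Variables (D : set V) (e : V) (st : V -> V).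
Hypothesis us : unit_space D e st.
Let cD := us_cone us.
Let sl := us_linear us.

Lemma us_star0 : st 0 = 0.
Proof. by have := sl (-1) 0 0; rewrite conjN conj1 !scaler0 addr0 scaleN1r addNr. Qed.

Lemma us_starD x y : st (x + y) = st x + st y.
Proof. by have := sl 1 x y; rewrite conj1 !scale1r. Qed.

Lemma us_starZ a x : st (a *: x) = Num.conj a *: st x.
Proof. by have := sl a x 0; rewrite us_star0 !addr0. Qed.

Lemma us_starN x : st (- x) = - st x.
Proof. by rewrite -scaleN1r us_starZ conjN conj1 scaleN1r. Qed.

Lemma us_starB x y : st (x - y) = st x - st y.
Proof. by rewrite us_starD us_starN. Qed.

(** Elements of [D] are hermitian, so [i (b - c)] is skew and disappears from the hermitian part. *)
Lemma complex_cone_re x : complex_cone D x -> D (2^-1 *: (x + st x)).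
Proof.
move=> [a [b [c [Da Db Dc ->]]]].
rewrite us_starD us_starZ us_starB !(us_herm us)// conjI scaleNr.
rewrite addrACA subrr addr0 -mulr2n -[a *+ 2]scaler_nat scalerA mulVf ?pnatr_eq0//.
by rewrite scale1r.
Qed.

Lemma complex_cone_herm x : st x = x -> complex_cone D x -> D x.
Proof.
move=> sx /complex_cone_re; rewrite sx -mulr2n -[x *+ 2]scaler_nat scalerA.
by rewrite mulVf ?pnatr_eq0// scale1r.
Qed.

Lemma us_unit_ge (t s : R) y : t <= s -> D (t%:C *: e - y) -> D (s%:C *: e - y).
Proof.
move=> ts Dt; rewrite -(subrK t s) rmorphD scalerDl -addrA.
by apply: (coneD cD) => //; apply: (coneZ cD); [rewrite subr_ge0|apply: us_unit us].
Qed.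

Lemma us_dom_herm y : st y = y -> exists2 t : R, 0 < t & D (t%:C *: e - y).
Proof.
move=> sy; have [t Dt] := us_dom us y.
exists (Num.max t 1); first by rewrite lt_max ltr01 orbT.
apply: (@us_unit_ge t); first by rewrite le_max lexx.
apply: complex_cone_herm => //.
by rewrite us_starB us_starZ conjR sy (us_herm us)//; apply: us_unit us.
Qed.

Section Functional.
Variable f : {linear V -> R[i]^o}.
Hypothesis fpos : forall x, D x -> 0 <= f x.

Lemma us_real x : st x = x -> f x = (complex.Re (f x))%:C.
Proof.
move=> sx; have [t t0 Dt] := us_dom_herm sx.
have : f x = (t%:C : R[i]) * f e - f (t%:C *: e - x).
  by rewrite linfunB linfunZ subKr.
have fr y : D y -> f y = (complex.Re (f y))%:C.
  by move=> /fpos fy; rewrite RRe_real// ger0_real.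
by rewrite (fr _ Dt) (fr _ (us_unit us)) -rmorphM -rmorphB => ->.
Qed.

Lemma us_conj x : f (st x) = Num.conj (f x).
Proof.
pose h := x + st x; pose k := 'i%C *: (x - st x).
have sh : st h = h by rewrite /h us_starD (us_starK us) addrC.
have sk : st k = k.
  by rewrite /k us_starZ us_starB (us_starK us) conjI scaleNr -scalerN opprB.
have fh : Num.conj (f h) = f h by rewrite (us_real sh) conjR.
have fk : Num.conj (f k) = f k by rewrite (us_real sk) conjR.
have e1 : Num.conj (f x) + Num.conj (f (st x)) = f x + f (st x).
  by rewrite -conjD -linfunD fh.
have e2 : Num.conj (f x) - Num.conj (f (st x)) = f (st x) - f x.
  move: fk; rewrite linfunZ linfunB conjM conjI mulNr -mulrN => /(mulfI (conjcI _)).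
  by rewrite conjB => H; rewrite -[LHS]opprK H opprB.
have : Num.conj (f x) *+ 2 = f (st x) *+ 2.
  have := congr2 (fun a b : R[i] => a + b) e1 e2.
  by rewrite addrACA subrr addr0 [f x + _]addrC addrACA subrr addr0 -!mulr2n.
by move/pmulrnI => /(_ isT) ->.
Qed.
End Functional.

(* Otherwise the cone spanned by [D] and [-(x + eps e)] would not contain
   [-e], and the functional [z e |-> z] would extend to it. *)
Lemma us_separation x (eps : R) : st x = x -> 0 < eps ->
  (forall f : {linear V -> R[i]^o}, (forall y, D y -> 0 <= f y) -> 0 <= f x) ->
  D (x + eps%:C *: e).
Proof.
move=> sx eps0 xpos; apply: contrapT => nD.
set z := x + _ in nD.
have sz : st z = z by rewrite us_starD us_starZ conjR sx (us_herm us)//; apply: us_unit us.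
have [D0 DD DZ] := cD; have De := us_unit us.
pose D1 : set V := [set y | exists a, D a /\ exists2 t : R, 0 <= t & y = a - t%:C *: z].
have DD1 : D `<=` D1 by move=> y Dy; exists y; split=> //; exists 0; rewrite // scale0r subr0.
have cD1 : convex_cone D1.
  split; first exact: DD1.
  - move=> _ _ [a [Da [t t0 ->]]] [b [Db [s s0 ->]]].
    exists (a + b); split; first exact: DD.
    by exists (t + s); [exact: addr_ge0|rewrite rmorphD scalerDl opprD addrACA].
  - move=> c _ c0 [a [Da [t t0 ->]]]; exists (c%:C *: a); split; first exact: DZ.
    by exists (c * t); [exact: mulr_ge0|rewrite rmorphM -scalerA scalerBr].
have D1h y : D1 y -> st y = y.
  move=> [a [Da [t t0 ->]]]; rewrite us_starB us_starZ conjR sz (us_herm us)//.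
have us1 : unit_space D1 e st.
  split=> //; [exact: us_starK us|exact: DD1|move=> y].
  have [t [a [b [c [Da Db Dc E]]]]] := us_dom us y.
  by exists t; exists a, b, c; split=> //; apply: DD1.
have nDe (d : R) : 0 < d -> ~ D1 (- (d%:C *: e)).
  (* If [t = 0], then [D] contains [- d e] and hence, as a multiple of [e] dominates [- z], also
     [z]; if [t > 0], division by [t] exhibits [z] in [D]. *)
  move=> d0 [a [Da [t t0 /eqP]]]; have [tE|t1] := eqVneq t 0.
    rewrite tE scale0r subr0 eqr_oppLR => /eqP dea.
    have [s s0 Ds] : exists2 s : R, 0 < s & D (s%:C *: e - (- z)).
      by apply: us_dom_herm; rewrite us_starN sz.
    apply: nD; rewrite opprK in Ds.
    have -> : z = (s%:C *: e + z) + (s / d)%:C *: a.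
      have -> : a = - d%:C *: e by rewrite scaleNr dea opprK.
      rewrite scalerA mulrN -rmorphM divfK ?gt_eqF// scaleNr addrAC subrr add0r//.
    by apply: (coneD cD) => //; apply: (coneZ cD) => //; rewrite divr_ge0 ?ltW.
  rewrite eq_sym subr_eq addrC -subr_eq opprK => /eqP atz.
  have t_gt0 : 0 < t by rewrite lt_def t1.
  apply: nD; have -> : z = t^-1%:C *: (a + d%:C *: e).
    by rewrite atz scalerA -rmorphM mulVf// scale1r.
  by apply: (coneZ cD); [rewrite invr_ge0|apply: (coneD cD) => //; apply: (coneZ cD) => //; apply: ltW].
pose i (w : R[i]^o) : V := w *: e.
have i_lin : linear i by move=> a w w'; rewrite /i scalerDl scalerA.
pose il := GRing.isLinear.Build R[i] R[i]^o V *:%R i i_lin.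
pose iL : {linear R[i]^o -> V} := HB.pack i il.
pose idL : {linear R[i]^o -> R[i]^o} := idfun.
have [y|w|f fe fpos] := @krein_extension R R[i]^o V iL idL D1 cD1.
- have [t Dt] := us_dom us1 y; exists t%:C; exact: Dt.
- move=> [a [b [c [Da Db Dc we]]]] /=.
  rewrite leNgt; apply/negP => w0.
  have : D1 (2^-1 *: (i w + st (i w))).
    rewrite [i w]we us_starD us_starZ us_starB !D1h// conjI scaleNr.
    rewrite addrACA subrr addr0 -mulr2n -[a *+ 2]scaler_nat scalerA mulVf ?pnatr_eq0//.
    by rewrite scale1r.
  rewrite /i us_starZ (us_herm us)// -scalerDl scalerA.
  rewrite conjE addcJ mulrA mulVf ?pnatr_eq0// mul1r.
  rewrite -[w in complex.Re w]opprK raddfN/= rmorphN scaleNr; apply: nDe.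
  by case: (w) w0 => u v /=; rewrite oppr_gt0.
have fe1 : f e = 1 by have := fe 1; rewrite /= /i scale1r.
have := xpos f (fun y Dy => fpos y (DD1 y Dy)).
have : 0 <= f (- z).
  by apply: fpos; exists 0; split=> //; exists 1; rewrite // scale1r sub0r.
rewrite linfunN linfunD linfunZ fe1 mulr1 oppr_ge0 => h1 h2.
have : 0 + eps%:C <= (0 : R[i]) by apply: le_trans h1; rewrite lerD2r.
by rewrite add0r lecR leNgt eps0.
Qed.
End UnitSpace.

(* Arveson-type extension of positive functionals along a unital embedding that
   reflects positivity. *)
Lemma us_extension (R : realType) (V1 V2 : lmodType R[i]) (D1 : set V1) (D2 : set V2)
    e1 e2 st1 st2 (i : {linear V1 -> V2}) (f : {linear V1 -> R[i]^o}) :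
  unit_space D1 e1 st1 -> unit_space D2 e2 st2 ->
  i e1 = e2 -> (forall x, i (st1 x) = st2 (i x)) -> (forall x, D2 (i x) -> D1 x) ->
  (forall x, D1 x -> 0 <= f x) ->
  exists2 g : {linear V2 -> R[i]^o}, (forall x, g (i x) = f x) &
    forall y, D2 y -> 0 <= g y.
Proof.
move=> us1 us2 ie ist iD fpos.
apply: krein_extension (us_cone us2) _ _ => [y|x Dx].
  by have [t Dt] := us_dom us2 y; exists (t%:C *: e1); rewrite linearZ/= ie.
have := complex_cone_re us2 Dx; rewrite -ist -linearD -linearZ => /iD/fpos.
rewrite linfunZ linfunD (us_conj us1 fpos) conjE addcJ mulrA mulVf ?pnatr_eq0// mul1r.
by rewrite lecR.
Qed.

(** * Matrix cones and operator systems *)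

Section IndexedCones.
Variables (R : realType).
Implicit Types V : mconeType R.

(** The two axioms of a matrix ordering: congruence by rectangular scalar matrices and direct sums.
    Closure under sums and positive multiples is derived from them. *)
Definition compressible V := forall m n (X : 'M[R[i]]_(m, n)) (Y : 'M[V]_m),
  mpos m Y -> mpos n (mxcompress X Y).

Definition dsummable V := forall p q (A : 'M[V]_p) (B : 'M[V]_q),
  mpos p A -> mpos q B -> mpos (p + q) (block_mx A 0 0 B).

(** Arbitrary finite index types let block matrices be indexed by sums and products of types, which
    avoids the arithmetic of ['I_(p + q)] and ['I_(p * q)]. *)
Definition posI V (I : finType) (X : I -> I -> V) : Prop :=
  mpos #|I| (\matrix_(i, j) X (enum_val i) (enum_val j)).

Definition comprI (V : lmodType R[i]) (I J : finType) (x : I -> J -> R[i]) (X : I -> I -> V) :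
  J -> J -> V :=
  fun j j' => \sum_i \sum_i' (Num.conj (x i j) * x i' j') *: X i i'.

Lemma eq_posI V (I : finType) (X Y : I -> I -> V) :
  (forall i j, X i j = Y i j) -> posI X -> posI Y.
Proof.
move=> XY; rewrite /posI; congr (mpos _ _).
by apply/matrixP => i j; rewrite !mxE.
Qed.

Lemma reindex_enum_val (V : nmodType) (I : finType) (F : I -> V) :
  \sum_i F i = \sum_(k < #|I|) F (enum_val k).
Proof.
rewrite (reindex (fun k : 'I_#|I| => enum_val k))//=.
by exists enum_rank => x _; rewrite ?enum_rankK ?enum_valK.
Qed.

Lemma sum_delta2 (V : lmodType R[i]) (I : finType) (X : I -> I -> V) (k l : I) :
  \sum_i \sum_i' (Num.conj ((i == k)%:R : R[i]) * (i' == l)%:R) *: X i i' = X k l.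
Proof.
rewrite (bigD1 k)//= eqxx (bigD1 l)//= eqxx conj1 mul1r scale1r.
rewrite big1 ?addr0; last by move=> i /negbTE ->; rewrite mulr0 scale0r.
rewrite big1 ?addr0// => i /negbTE ->.
by rewrite conj0 big1// => j _; rewrite mul0r scale0r.
Qed.

Lemma sqrt_conj (a : R) : 0 <= a -> exists c : R[i], Num.conj c * c = a%:C.
Proof.
move=> a0; exists (Num.sqrt a)%:C.
by rewrite conjR -realcM -expr2 sqr_sqrtr.
Qed.

Section One.
Variable V : mconeType R.
Hypothesis cV : compressible V.

Lemma posI_compr (I J : finType) (x : I -> J -> R[i]) (X : I -> I -> V) :
  posI X -> posI (comprI x X).
Proof.
move=> /(cV (\matrix_(i < #|I|, j < #|J|) x (enum_val i) (enum_val j))).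
rewrite /posI; congr (mpos _ _); apply/matrixP => i j; rewrite !mxE /comprI.
rewrite [RHS]reindex_enum_val; apply: eq_bigr => k _.
rewrite [RHS]reindex_enum_val; apply: eq_bigr => l _.
by rewrite !mxE.
Qed.

Lemma posI_reindex (I J : finType) (f : J -> I) (X : I -> I -> V) :
  posI X -> posI (fun i j => X (f i) (f j)).
Proof.
move=> /(posI_compr (fun i j => (i == f j)%:R)).
by apply: eq_posI => i j; apply: sum_delta2.
Qed.

Lemma posI_scale (I : finType) (a : R) (X : I -> I -> V) : 0 <= a -> posI X ->
  posI (fun i j => a%:C *: X i j).
Proof.
move=> /sqrt_conj[c cE] Xp.
have := posI_compr (fun i j => c * (i == j)%:R) Xp; apply: eq_posI => k l.
rewrite -[X k l](sum_delta2 X) scaler_sumr; apply: eq_bigr => i _.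
rewrite scaler_sumr; apply: eq_bigr => j _.
by rewrite conjM mulrACA cE [RHS]scalerA.
Qed.

Lemma posI_ord n (X : 'M[V]_n) : posI (fun i j => X i j) <-> mpos n X.
Proof.
split=> [|Xp].
  move=> /(cV (\matrix_(i < #|{: 'I_n}|, j < n) (enum_val i == j)%:R)).
  congr (mpos _ _); apply/matrixP => i j; rewrite !mxE.
  rewrite -[RHS](sum_delta2 (fun i j => X i j)).
  rewrite [RHS]reindex_enum_val; apply: eq_bigr => k _.
  rewrite [RHS]reindex_enum_val; apply: eq_bigr => l _.
  by rewrite !mxE.
have := cV (\matrix_(i < n, j < #|{: 'I_n}|) (i == enum_val j)%:R) Xp.
rewrite /posI; congr (mpos _ _); apply/matrixP => i j; rewrite !mxE.
rewrite -[RHS](sum_delta2 (fun i j => X i j)).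
by apply: eq_bigr => k _; apply: eq_bigr => l _; rewrite !mxE.
Qed.

Lemma posI_mx n (X : 'I_n -> 'I_n -> V) : posI X <-> mpos n (\matrix_(i, j) X i j).
Proof.
split=> [|/posI_ord]; last by apply: eq_posI => i j; rewrite mxE.
by move=> XP; apply/posI_ord; apply: eq_posI XP => i j; rewrite mxE.
Qed.

Lemma posI_unit (I : finType) (X : I -> I -> V) i : posI X -> pos1 (X i i).
Proof.
move=> /(posI_reindex (fun _ : 'I_1 => i)) /posI_mx; congr (mpos _ _).
by apply/matrixP => k l; rewrite !mxE.
Qed.

Lemma pos1_posI (x : V) : pos1 x <-> posI (fun _ _ : 'I_1 => x).
Proof.
rewrite /pos1 posI_mx; rewrite (_ : \matrix_(_, _) x = const_mx x)//.
by apply/matrixP => k l; rewrite !mxE.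
Qed.

Lemma pos1_compr (I : finType) (x : I -> R[i]) (X : I -> I -> V) : posI X ->
  pos1 (\sum_i \sum_i' (Num.conj (x i) * x i') *: X i i').
Proof. by move=> /(posI_compr (fun i (_ : 'I_1) => x i)) ?; apply/pos1_posI. Qed.

Lemma pos1_outer (I : finType) (x : I -> R[i]) (v : V) : pos1 v ->
  posI (fun i j => (Num.conj (x i) * x j) *: v).
Proof.
move=> /pos1_posI /(posI_compr (fun (_ : 'I_1) j => x j)).
by apply: eq_posI => i j; rewrite /comprI !big_ord1.
Qed.

Hypothesis dV : dsummable V.

Definition dsumI (I J : finType) (A : I -> I -> V) (B : J -> J -> V) (u v : I + J) : V :=
  match u, v with
  | inl i, inl j => A i j
  | inr i, inr j => B i j
  | _, _ => 0
  end.

Lemma posI_dsum (I J : finType) (A : I -> I -> V) (B : J -> J -> V) :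
  posI A -> posI B -> posI (dsumI A B).
Proof.
move=> Ap Bp; have /posI_ord := dV Ap Bp.
pose f (u : I + J) : 'I_(#|I| + #|J|) := match u with
  inl i => lshift _ (enum_rank i) | inr j => rshift _ (enum_rank j) end.
move=> /(posI_reindex f); apply: eq_posI.
case=> i [] j /=; rewrite ?block_mxEul ?block_mxEur ?block_mxEdl ?block_mxEdr !mxE//.
  by rewrite !enum_rankK.
by rewrite !enum_rankK.
Qed.

(** [A + B] is the congruence of the direct sum of [A] and [B] by the column of two identity
    matrices. *)
Lemma posI_add (I : finType) (A B : I -> I -> V) :
  posI A -> posI B -> posI (fun i j => A i j + B i j).
Proof.
move=> Ap Bp; have := posI_compr (fun (u : I + I) j =>
  (match u with inl i => i | inr i => i end == j)%:R) (posI_dsum Ap Bp).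
apply: eq_posI => k l; rewrite /comprI big_sumType /=.
rewrite -[A k l](sum_delta2 A) -[B k l](sum_delta2 B); congr (_ + _).
  apply: eq_bigr => i _; rewrite big_sumType /= [X in _ + X]big1 ?addr0//.
  by move=> j _; rewrite scaler0.
apply: eq_bigr => i _; rewrite big_sumType /= [X in X + _]big1 ?add0r//.
by move=> j _; rewrite scaler0.
Qed.

End One.
End IndexedCones.

(** * Positive sesquilinear forms and the cones they define *)

Section PositiveForms.
Variables (R : realType) (W : lmodType R[i]) (B : W -> W -> R[i]).
Hypotheses (Bl : forall a x y z, B (a *: x + y) z = a * B x z + B y z)
  (Br : forall a x y z, B z (a *: x + y) = Num.conj a * B z x + B z y)
  (Bge0 : forall x, 0 <= B x x).

Lemma psd_expand a b x y : B (a *: x + b *: y) (a *: x + b *: y) =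
  a * Num.conj a * B x x + (a * Num.conj b * B x y + Num.conj a * b * B y x)
    + b * Num.conj b * B y y.
Proof.
have B0r z : B z 0 = 0.
  by have := Br (-1) 0 0 z; rewrite scaler0 addr0 conjN conj1 mulN1r addNr.
have B0l z : B 0 z = 0.
  by have := Bl (-1) 0 0 z; rewrite scaler0 addr0 mulN1r addNr.
have BZr c z w : B z (c *: w) = Num.conj c * B z w by rewrite -[c *: w]addr0 Br B0r addr0.
have BZl c z w : B (c *: z) w = c * B z w by rewrite -[c *: z]addr0 Bl B0l addr0.
by rewrite Bl !Br !BZl !BZr; ring.
Qed.

(** The cross terms of the form at [a x + b y] are real for all [a], [b]; the pairs [1, 1] and
    [i, 1] give the two parts of the identity. *)
Lemma psd_herm x y : B x y = Num.conj (B y x).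
Proof.
have rxy a b : complex.Im (a * Num.conj b * B x y + Num.conj a * b * B y x) = 0.
  have : 0 <= B (a *: x + b *: y) (a *: x + b *: y) by [].
  rewrite psd_expand => /ger0_Im.
  rewrite raddfD raddfD /= (ger0_Im (_ : 0 <= a * Num.conj a * B x x)); last first.
    by rewrite mulr_ge0// conjE mulcJ_ge0.
  rewrite (ger0_Im (_ : 0 <= b * Num.conj b * B y y)); last first.
    by rewrite mulr_ge0// conjE mulcJ_ge0.
  by rewrite add0r addr0.
have := rxy 1 1; have := rxy 'i%C 1.
rewrite conj1 conjI !mulr1 !mul1r conjE.
case: (B x y) (B y x) => [p q] [r s]; simpc => /= /eqP h1 /eqP h2.
by apply/eqP; rewrite eq_complex /= -subr_eq0 h1 -addr_eq0 h2.
Qed.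

Lemma psd_CauchySchwarz x y : `|B x y| ^+ 2 <= B x x * B y y.
Proof.
have CS0 a : 0 <= a * Num.conj a * B x x
    + (a * B x y + Num.conj a * Num.conj (B x y)) + B y y.
  have := Bge0 (a *: x + 1 *: y).
  by rewrite psd_expand conj1 !mulr1 mul1r [B y x]psd_herm.
have [P PE P0] := ge0_realc (Bge0 x); have [Q QE Q0] := ge0_realc (Bge0 y).
have [|N NE N0] := @ge0_realc R (`|B x y| ^+ 2); first by rewrite exprn_ge0.
(* With [a] a real multiple of [conj (B x y)], positivity becomes that of a real quadratic
   polynomial in [t], where [N = |B x y|^2]; its minimum is at [t = 1 / P]. *)
have poly t : 0 <= t ^+ 2 * N * P - t * N *+ 2 + Q.
  have := CS0 (- t%:C * Num.conj (B x y)); rewrite PE QE.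
  rewrite -lecR mulr2n expr2 !(realcD, realcB, realcN, realcM) -NE sqr_normc -conjE.
  rewrite conjM conjN conjCK conjR; congr (_ <= _); ring.
rewrite NE PE QE -rmorphM lecR.
have [P_0|P1] := eqVneq P 0.
  rewrite P_0 mul0r leNgt; apply/negP => N_gt0.
  (* For [P = 0] the polynomial is affine, and this [t] gives it the value -1. *)
  have := poly ((Q + 1) / (2 * N)); rewrite P_0 mulr0 add0r.
  have -> : (Q + 1) / (2 * N) * N *+ 2 = Q + 1 by field; rewrite gt_eqF.
  by rewrite opprD addrAC addNr add0r oppr_ge0 ler10.
have := poly P^-1; have -> : P^-1 ^+ 2 * N * P - P^-1 * N *+ 2 + Q = (P * Q - N) / P.
  by field.
by rewrite pmulr_lge0 ?subr_ge0// invr_gt0 lt_def P1.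
Qed.
End PositiveForms.

Section QuadraticCones.
Variables (R : realType) (V : mconeType R) (W : lmodType R[i]) (q : V -> W -> W -> R[i]).
Hypotheses (qV : forall a X Y v w, q (a *: X + Y) v w = a * q X v w + q Y v w)
  (ql : forall X a v w z, q X (a *: v + w) z = a * q X v z + q X w z)
  (qr : forall X a v w z, q X z (a *: v + w) = Num.conj a * q X z v + q X z w)
  (mposE : forall n (X : 'M[V]_n), mpos n X <->
     forall v : 'I_n -> W, 0 <= \sum_i \sum_j q (X i j) (v j) (v i)).

Let q0 v w : q 0 v w = 0.
Proof. by have := qV (-1) 0 0 v w; rewrite scaler0 addr0 mulN1r addNr. Qed.

Let ql0 X w : q X 0 w = 0.
Proof. by have := ql X (-1) 0 0 w; rewrite scaler0 addr0 mulN1r addNr. Qed.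

Let qr0 X w : q X w 0 = 0.
Proof. by have := qr X (-1) 0 0 w; rewrite scaler0 addr0 conjN conj1 mulN1r addNr. Qed.

Let qVZ a X v w : q (a *: X) v w = a * q X v w.
Proof. by rewrite -[a *: X]addr0 qV q0 addr0. Qed.

Let qVsum I (r : seq I) (F : I -> V) v w :
  q (\sum_(i <- r) F i) v w = \sum_(i <- r) q (F i) v w.
Proof.
elim/big_rec2: _ => [|i y x _ <-]; first exact: q0.
by rewrite -[F i]scale1r qV mul1r scale1r.
Qed.

Let qlsum I (r : seq I) (a : I -> R[i]) (F : I -> W) X w :
  q X (\sum_(i <- r) a i *: F i) w = \sum_(i <- r) a i * q X (F i) w.
Proof. by elim/big_rec2: _ => [|i y x _ <-]; [exact: ql0|rewrite ql]. Qed.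

Let qrsum I (r : seq I) (a : I -> R[i]) (F : I -> W) X w :
  q X w (\sum_(i <- r) a i *: F i) = \sum_(i <- r) Num.conj (a i) * q X w (F i).
Proof. by elim/big_rec2: _ => [|i y x _ <-]; [exact: qr0|rewrite qr]. Qed.

(** The form of [X^* Y X] at [v] is that of [Y] at the vectors [sum_i X k i v_i]. *)
Lemma quad_compressible : compressible V.
Proof.
move=> m n X Y /mposE Yp; apply/mposE => v.
have := Yp (fun k => \sum_i X k i *: v i); congr (_ <= _).
under eq_bigr do under eq_bigr do rewrite qlsum.
under [RHS]eq_bigr do under eq_bigr do rewrite mxE qVsum.
under [RHS]eq_bigr do rewrite exchange_big/=.
rewrite [RHS]exchange_big/=; apply: eq_bigr => k _.
under [RHS]eq_bigr do under eq_bigr do rewrite qVsum.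
under [RHS]eq_bigr do rewrite exchange_big/=.
rewrite [RHS]exchange_big/=; apply: eq_bigr => l _.
rewrite [RHS]exchange_big/=; apply: eq_bigr => j _.
rewrite qrsum mulr_sumr; apply: eq_bigr => i _.
by rewrite qVZ !mxE mulrCA mulrA.
Qed.

Lemma quad_dsummable : dsummable V.
Proof.
move=> p r A B /mposE Ap /mposE Bp; apply/mposE => v.
rewrite big_split_ord/=; apply: addr_ge0.
  have := Ap (fun i => v (lshift r i)); congr (_ <= _).
  apply: eq_bigr => i _; rewrite big_split_ord/= [X in _ = _ + X]big1 ?addr0.
    by apply: eq_bigr => j _; rewrite block_mxEul.
  by move=> j _; rewrite block_mxEur mxE q0.
have := Bp (fun i => v (rshift p i)); congr (_ <= _).
apply: eq_bigr => i _; rewrite big_split_ord/= [X in _ = X + _]big1 ?add0r.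
  by apply: eq_bigr => j _; rewrite block_mxEdr.
by move=> j _; rewrite block_mxEdl mxE q0.
Qed.

(** The block matrix is one positive form on [n]-tuples; its symmetry is read off at tuples with a
    single nonzero entry. *)
Lemma quad_herm n (X : 'M[V]_n) i j v w : mpos n X ->
  q (X i j) v w = Num.conj (q (X j i) w v).
Proof.
move=> /mposE Xp.
pose B (f g : 'I_n -> W) := \sum_i \sum_j q (X i j) (f j) (g i).
have E k l x y : B (fun m => (m == l)%:R *: x) (fun m => (m == k)%:R *: y) = q (X k l) x y.
  rewrite /B (bigD1 k)//= [X in _ + X]big1 ?addr0.
    rewrite (bigD1 l)//= big1 ?addr0 ?eqxx ?scale1r// => m /negbTE ->.
    by rewrite scale0r ql0.
  by move=> m /negbTE ->; apply: big1 => m' _; rewrite scale0r qr0.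
rewrite -!E; apply: psd_herm => //.
- move=> a f g h; rewrite /B mulr_sumr -big_split/=; apply: eq_bigr => k _.
  by rewrite mulr_sumr -big_split/=; apply: eq_bigr => l _; rewrite ql.
- move=> a f g h; rewrite /B mulr_sumr -big_split/=; apply: eq_bigr => k _.
  by rewrite mulr_sumr -big_split/=; apply: eq_bigr => l _; rewrite qr.
Qed.
End QuadraticCones.

Section MatrixOrdered.
Variables (R : realType) (T : umconeType R) (st : T -> T).

(** What operator systems and quotients of [M_n] have in common, so that both can be the second
    tensor factor. [mo_gen] says that the positive elements below a multiple of the unit span the
    space, in the form of an induction principle. *)
Record matrix_ordered : Prop := MatrixOrdered {
  mo_linear : forall a x y, st (a *: x + y) = Num.conj a *: st x + st y;
  mo_starK : involutive st;
  mo_herm : forall n (X : 'M[T]_n), mpos n X -> forall i j, st (X i j) = X j i;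
  mo_compr : compressible T;
  mo_dsum : dsummable T;
  mo_unit : pos1 (munit : T);
  mo_gen : forall Q : set T, Q 0 -> (forall a x y, Q x -> Q y -> Q (a *: x + y)) ->
    (forall x : T, pos1 x -> (exists2 t : R, 0 <= t & pos1 (t%:C *: munit - x)) -> Q x) ->
    forall x, Q x }.
End MatrixOrdered.

(** * Operator systems on a Hilbert space *)

Section Hilbert.
Variables (R : realType) (H : hilbertType R).
Implicit Types x y z : H.

Lemma hdotPl a x y z : hdot H (a *: x + y) z = a * hdot H x z + hdot H y z.
Proof. exact: linearPl. Qed.

Lemma hdotPr a x y z : hdot H z (a *: x + y) = Num.conj a * hdot H z x + hdot H z y.
Proof. exact: linearPr. Qed.

Lemma hdot_ge0 x : 0 <= hdot H x x.
Proof. by rewrite hdotE exprn_ge0. Qed.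

Lemma hdotC x y : hdot H x y = Num.conj (hdot H y x).
Proof. exact: (psd_herm hdotPl hdotPr hdot_ge0). Qed.

Lemma hdot0l x : hdot H 0 x = 0. Proof. exact: linear0l. Qed.
Lemma hdot0r x : hdot H x 0 = 0. Proof. exact: linear0r. Qed.
Lemma hdotZr a x y : hdot H x (a *: y) = Num.conj a * hdot H x y.
Proof. by rewrite -[a *: y]addr0 hdotPr hdot0r addr0. Qed.
Lemma hdotDr x y z : hdot H z (x + y) = hdot H z x + hdot H z y.
Proof. by rewrite -[x]scale1r hdotPr conj1 mul1r scale1r. Qed.
Lemma hdotNr x y : hdot H x (- y) = - hdot H x y.
Proof. by rewrite -scaleN1r hdotZr conjN conj1 mulN1r. Qed.

Lemma hdot_inj x y : (forall z, hdot H z x = hdot H z y) -> x = y.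
Proof.
move=> xy; apply/eqP; rewrite -subr_eq0 -normr_eq0 -sqrf_eq0 -hdotE.
by rewrite hdotDr hdotNr xy subrr.
Qed.

Lemma hdot_CauchySchwarz x y : `|hdot H x y| <= `|x| * `|y|.
Proof.
rewrite -ler_sqr ?nnegrE ?mulr_ge0// exprMn -!hdotE.
exact: (psd_CauchySchwarz hdotPl hdotPr hdot_ge0).
Qed.

Lemma norm_real (U : normedModType R[i]) (u : U) : exists2 r : R, `|u| = r%:C & 0 <= r.
Proof. by apply: ge0_realc. Qed.

Definition bhq (T : BH H) (v w : H) := hdot H (T v) w.

Lemma bhq_V a (X Y : BH H) v w : bhq (a *: X + Y) v w = a * bhq X v w + bhq Y v w.
Proof. by rewrite /bhq bopDE bopZE hdotPl. Qed.

Lemma bhq_l (X : BH H) a v w z : bhq X (a *: v + w) z = a * bhq X v z + bhq X w z.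
Proof. by rewrite /bhq linearP hdotPl. Qed.

Lemma bhq_r (X : BH H) a v w z : bhq X z (a *: v + w) = Num.conj a * bhq X z v + bhq X z w.
Proof. by rewrite /bhq hdotPr. Qed.

End Hilbert.

Section OpSystem.
Variables (R : realType) (H : hilbertType R) (S : opsys H).
Implicit Types x y : S.

Definition osq (T : S) (v w : H) := bhq (sub_val T) v w.

Lemma osq_V a (X Y : S) v w : osq (a *: X + Y) v w = a * osq X v w + osq Y v w.
Proof. exact: bhq_V. Qed.

Lemma osq0 v w : osq 0 v w = 0.
Proof. by have := osq_V (-1) 0 0 v w; rewrite scaler0 addr0 mulN1r addNr. Qed.

Lemma osqN (X : S) v w : osq (- X) v w = - osq X v w.
Proof. by rewrite -scaleN1r -[_ *: _]addr0 osq_V osq0 addr0 mulN1r. Qed.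

Lemma osqB (X Y : S) v w : osq (X - Y) v w = osq X v w - osq Y v w.
Proof. by rewrite -[X]scale1r osq_V mul1r scale1r osqN. Qed.

Lemma osqZ a (X : S) v w : osq (a *: X) v w = a * osq X v w.
Proof. by rewrite -[_ *: _]addr0 osq_V osq0 addr0. Qed.

Lemma osq_l (X : S) a v w z : osq X (a *: v + w) z = a * osq X v z + osq X w z.
Proof. exact: bhq_l. Qed.

Lemma osq_r (X : S) a v w z : osq X z (a *: v + w) = Num.conj a * osq X z v + osq X z w.
Proof. exact: bhq_r. Qed.

Lemma os_mposE n (X : 'M[S]_n) : mpos n X <->
  forall v : 'I_n -> H, 0 <= \sum_i \sum_j osq (X i j) (v j) (v i).
Proof.
split=> Xp v; have := Xp v; congr (_ <= _);
by apply: eq_bigr => i _; apply: eq_bigr => j _; rewrite mxE.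
Qed.

Lemma os_compressible : compressible S.
Proof. exact: (quad_compressible osq_V osq_l osq_r os_mposE). Qed.

Lemma os_dsummable : dsummable S.
Proof. exact: (quad_dsummable osq_V os_mposE). Qed.

Lemma os_pos1E (x : S) : pos1 x <-> forall v, 0 <= osq x v v.
Proof.
rewrite /pos1 os_mposE; split=> xp v.
  by have := xp (fun=> v); rewrite !big_ord1 mxE.
by rewrite !big_ord1 mxE.
Qed.

Lemma osq_ext (x y : S) : (forall v w, osq x v w = osq y v w) -> x = y.
Proof.
move=> xy; apply: val_inj; apply: bop_ext => v; apply: hdot_inj => z.
by rewrite hdotC [RHS]hdotC; congr Num.conj; apply: xy.
Qed.

Lemma os_star_exists (x : S) : exists y : S, forall v w, osq x v w = hdot H v ((sub_val y : BH H) w).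
Proof. by have [T' ST' adjT] := os_star (subP x); exists (mksub ST'). Qed.

(** The involution is obtained by choice from [os_star]; [osq_ext] makes the adjoint unique, so that
    [os_stE] characterizes it. *)
Definition os_st (x : S) : S := projT1 (cid (os_star_exists x)).

Lemma os_stE x v w : osq (os_st x) v w = Num.conj (osq x w v).
Proof. by rewrite /os_st; case: cid => y /= xy; rewrite xy -hdotC. Qed.

Lemma os_st_linear a x y : os_st (a *: x + y) = Num.conj a *: os_st x + os_st y.
Proof.
by apply: osq_ext => v w; rewrite os_stE !osq_V conjD conjM !os_stE.
Qed.

Lemma os_stK : involutive os_st.
Proof. by move=> x; apply: osq_ext => v w; rewrite !os_stE conjCK. Qed.

Lemma os_herm n (X : 'M[S]_n) : mpos n X -> forall i j, os_st (X i j) = X j i.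
Proof.
move=> Xp i j; apply: osq_ext => v w; rewrite os_stE.
by rewrite -(quad_herm osq_l osq_r os_mposE).
Qed.

Lemma osq_unit v w : osq munit v w = hdot H v w.
Proof. by []. Qed.

Lemma os_unit_pos : pos1 (munit : S).
Proof. by apply/os_pos1E => v; rewrite osq_unit hdot_ge0. Qed.

Lemma os_normE (x : S) : `|x| = `|sub_val x|. Proof. by []. Qed.

Lemma osq_le (x : S) v : `|osq x v v| <= `|x| * (hdot H v v).
Proof.
apply: le_trans (hdot_CauchySchwarz _ _) _.
by rewrite hdotE expr2 mulrA ler_wpM2r// os_normE bop_normE ler_opnorm.
Qed.

Lemma os_dominated (x : S) (t : R) : os_st x = x -> `|x| <= t%:C ->
  pos1 (t%:C *: munit - x).
Proof.
move=> sx xt; apply/os_pos1E => v; rewrite osqB osqZ osq_unit subr_ge0.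
have xr : osq x v v \is Num.real.
  by apply/CrealP; rewrite -os_stE sx.
apply: le_trans (real_ler_norm xr) _; apply: le_trans (osq_le _ _) _.
by rewrite ler_wpM2r// hdot_ge0.
Qed.

(** With [x <= t], the Cauchy-Schwarz inequality for the positive form of [x] at [v] and [u = x v]
    reads [|u|^4 <= t |v|^2 t |u|^2]. *)
Lemma os_norm_le (x : S) (t : R) : 0 <= t -> pos1 x -> pos1 (t%:C *: munit - x) ->
  `|x| <= t%:C.
Proof.
move=> t0 /os_pos1E xp /os_pos1E xt.
rewrite os_normE bop_normE lecR; apply: opnorm_le; split=> // v.
have xle w : osq x w w <= t%:C * `|w| ^+ 2.
  by have := xt w; rewrite osqB osqZ osq_unit subr_ge0 hdotE.
set u := bop_fun _ v.
have := psd_CauchySchwarz (osq_l x) (osq_r x) xp v u.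
rewrite {1}/osq /bhq hdotE normrX normr_id.
have [u0|u0] := eqVneq u 0; first by rewrite u0 normr0 mulr_ge0// lecR.
move=> h; have {h} : `|u| ^+ 2 ^+ 2 <= (t%:C * `|v| ^+ 2) * (t%:C * `|u| ^+ 2).
  by apply: le_trans h _; apply: ler_pM.
have un : 0 < `|u| by rewrite normr_gt0.
rewrite (_ : _ ^+ 2 ^+ 2 = `|u| ^+ 2 * `|u| ^+ 2); last by rewrite expr2.
rewrite mulrA ler_pM2r ?exprn_gt0// => h.
rewrite -ler_sqr ?nnegrE ?mulr_ge0 ?lecR//; apply: le_trans h _.
by rewrite mulrAC -expr2 exprMn.
Qed.

(** A hermitian [x] of norm [r] is [(r + x) - r], a difference of positive elements below [2 r]; the
    general case is the decomposition into hermitian parts. *)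
Lemma os_gen (Q : set S) : Q 0 -> (forall a x y, Q x -> Q y -> Q (a *: x + y)) ->
  (forall x : S, pos1 x -> (exists2 t : R, 0 <= t & pos1 (t%:C *: munit - x)) -> Q x) ->
  forall x, Q x.
Proof.
move=> Q0 QL QP.
have st0 : os_st 0 = 0 by apply: osq_ext => v w; rewrite os_stE !osq0 conj0.
have stZ a x : os_st (a *: x) = Num.conj a *: os_st x by rewrite -[a *: x]addr0 os_st_linear st0 addr0.
have QZ a x : Q x -> Q (a *: x) by move=> Qx; rewrite -[_ *: _]addr0; apply: QL.
have unit_herm : os_st munit = munit.
  by apply: osq_ext => v w; rewrite os_stE !osq_unit -hdotC.
have Qu : Q munit.
  apply: QP; first exact: os_unit_pos; exists 1 => //.
  by rewrite scale1r subrr; apply/os_pos1E => v; rewrite osq0.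
have Qh x : os_st x = x -> Q x.
  move=> sx; have [r rE r0] := norm_real x.
  have -> : x = (- r%:C) *: munit + (r%:C *: munit - - x).
    by rewrite scaleNr opprK addKr.
  apply: (QL) => //; apply: QP.
    apply: os_dominated; last by rewrite normrN rE.
    by rewrite -scaleN1r stZ conjN conj1 sx.
  exists (r + r); first exact: addr_ge0.
  rewrite opprK opprD addrA realcD scalerDl addrK.
  by apply: os_dominated; rewrite // rE.
move=> x.
have -> : x = 2^-1 *: (x + os_st x) + (- 'i%C / 2) *: ('i%C *: (x - os_st x)).
  rewrite scalerA mulrAC mulNr -expr2 sqr_i opprK mul1r -scalerDr.
  by rewrite addrACA subrr addr0 -mulr2n -[x *+ 2]scaler_nat scalerA mulVf ?pnatr_eq0// scale1r.
apply: QL; last apply: QZ; apply: Qh.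
  by rewrite -[x]scale1r os_st_linear conj1 !scale1r os_stK addrC.
have -> : x - os_st x = -1 *: os_st x + x by rewrite scaleN1r addrC.
rewrite stZ conjI os_st_linear os_stK conjN conj1 !scaleN1r scaleNr -scalerN.
by rewrite opprD opprK addrC.
Qed.

Lemma os_matrix_ordered : matrix_ordered os_st.
Proof.
split; [exact: os_st_linear|exact: os_stK|exact: os_herm|exact: os_compressible|
  exact: os_dsummable|exact: os_unit_pos|exact: os_gen].
Qed.
End OpSystem.

(** * Matrix algebras and dual spaces *)

Section MatrixCones.
Variables (R : realType) (n : nat).

Definition mnq (M : Mn R n) (v w : 'cV[R[i]]_n) : R[i] := (adjmx w *m M *m v) 0 0.

Lemma mnqE M v w : mnq M v w = \sum_k \sum_l Num.conj (w k 0) * M k l * v l 0.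
Proof.
rewrite /mnq mxE exchange_big/=; apply: eq_bigr => l _.
by rewrite mxE mulr_suml; apply: eq_bigr => k _; rewrite !mxE.
Qed.

Lemma mnq_V a (X Y : Mn R n) v w : mnq (a *: X + Y) v w = a * mnq X v w + mnq Y v w.
Proof.
rewrite !mnqE mulr_sumr -big_split; apply: eq_bigr => k _.
rewrite mulr_sumr -big_split; apply: eq_bigr => l _.
by rewrite !mxE /=; ring.
Qed.

Lemma mnq_l X a v w z : mnq X (a *: v + w) z = a * mnq X v z + mnq X w z.
Proof.
rewrite !mnqE mulr_sumr -big_split; apply: eq_bigr => k _.
rewrite mulr_sumr -big_split; apply: eq_bigr => l _.
by rewrite !mxE /=; ring.
Qed.

Lemma mnq_r X a v w z : mnq X z (a *: v + w) = Num.conj a * mnq X z v + mnq X z w.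
Proof.
rewrite !mnqE mulr_sumr -big_split; apply: eq_bigr => k _.
rewrite mulr_sumr -big_split; apply: eq_bigr => l _.
by rewrite !mxE conjD conjM /=; ring.
Qed.

Lemma mn_mposE k (X : 'M[Mn R n]_k) : mpos k X <->
  forall v : 'I_k -> 'cV[R[i]]_n, 0 <= \sum_i \sum_j mnq (X i j) (v j) (v i).
Proof. by []. Qed.

Lemma mn_compressible : compressible (Mn R n).
Proof. exact: (quad_compressible mnq_V mnq_l mnq_r mn_mposE). Qed.

Lemma mn_dsummable : dsummable (Mn R n).
Proof. exact: (quad_dsummable mnq_V mn_mposE). Qed.

Lemma mnq_delta M k l : mnq M (delta_mx l 0) (delta_mx k 0) = M k l.
Proof.
rewrite mnqE (bigD1 k)//= [X in _ + X]big1 ?addr0.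
  rewrite (bigD1 l)//= big1 ?addr0; last first.
    by move=> i /negbTE il; rewrite [X in _ * X]mxE il mulr0.
  by rewrite !mxE !eqxx conj1 mul1r mulr1.
move=> i /negbTE ik; apply: big1 => j _.
by rewrite mxE ik /= conj0 !mul0r.
Qed.

Lemma mn_herm k (X : 'M[Mn R n]_k) i j : mpos k X -> adjmx (X i j) = X j i.
Proof.
move=> Xp; apply/matrixP => a b; rewrite !mxE.
by rewrite -!mnq_delta (quad_herm mnq_l mnq_r mn_mposE i j _ _ Xp) conjCK.
Qed.

Variable S : mconeType R.
Hypothesis cS : compressible S.

(** The correspondence between cp maps into [M_n] and positive functionals on [n x n] matrices:
    testing [phi] at any level on vectors [v] amounts to testing the sum on the compression of [X]
    by the matrix of coordinates of [v]. *)
Lemma cp_mxP (phi : S -> Mn R n) : linear phi ->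
  cp phi <-> forall A : 'M[S]_n, mpos n A -> 0 <= \sum_k \sum_l phi (A k l) k l.
Proof.
move=> phil; split=> [phicp A /phicp/mn_mposE/(_ (fun i => delta_mx i 0))|phip k X Xp].
  congr (_ <= _); apply: eq_bigr => i _; apply: eq_bigr => j _.
  by rewrite mnq_delta mxE.
have phi0 : phi 0 = 0.
  by have := phil (-1) 0 0; rewrite scaler0 addr0 scaleN1r addNr.
have phiZ a x : phi (a *: x) = a *: phi x by rewrite -[a *: x]addr0 phil phi0 addr0.
have phiS I (r : seq I) (f : I -> S) : phi (\sum_(i <- r) f i) = \sum_(i <- r) phi (f i).
  elim/big_rec2: _ => [|i y x _ <-] //.
  by rewrite -[f i]scale1r phil !scale1r.
apply/mn_mposE => v.
have := phip _ (cS (\matrix_(a, i) v a i 0) Xp); congr (_ <= _).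
under eq_bigr do under eq_bigr do rewrite mxE phiS summxE.
under eq_bigr do under eq_bigr do under eq_bigr do rewrite phiS summxE.
under eq_bigr do rewrite exchange_big.
rewrite exchange_big; apply: eq_bigr => a _ /=.
under eq_bigr do rewrite exchange_big.
rewrite exchange_big; apply: eq_bigr => b _ /=.
rewrite mnqE mxE; apply: eq_bigr => i _; apply: eq_bigr => j _.
by rewrite phiZ !mxE mulrAC.
Qed.
End MatrixCones.

Section DualCones.
Variables (R : realType) (S : nmconeType R).
Hypothesis cS : compressible S.

Lemma dual_mposP n (F : 'M[bdual S]_n) : mpos n F <->
  forall A : 'M[S]_n, mpos n A -> 0 <= \sum_k \sum_l (F k l : bdual S) (A k l).
Proof.
pose phi (s : S) : Mn R n := \matrix_(i, j) (F i j : bdual S) s.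
have phil : linear phi by move=> a x y; apply/matrixP => i j; rewrite !mxE linearP.
have := cp_mxP cS phil.
have E A : \sum_k \sum_l phi (A k l) k l = \sum_k \sum_l (F k l : bdual S) (A k l).
  by apply: eq_bigr => k _; apply: eq_bigr => l _; rewrite mxE.
move=> [h1 h2]; split=> [Fp A Ap|Fp]; first by rewrite -E; apply: h1.
by apply: h2 => A Ap; rewrite E; apply: Fp.
Qed.

Lemma bdual_sumE I (r : seq I) (P : pred I) (F : I -> bdual S) s :
  (\sum_(i <- r | P i) F i : bdual S) s = \sum_(i <- r | P i) (F i s : R[i]).
Proof. by elim/big_rec2: _ => [|i y x _ <-]. Qed.

(** Congruence by [x] on functionals is adjoint to congruence by the transpose of [x] on matrices;
    this carries [compressible] over to the dual. *)
Lemma dual_pairing_compr (I J : finType) (x : I -> J -> R[i]) (F : I -> I -> bdual S)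
    (A : J -> J -> S) :
  \sum_k \sum_l (comprI x F k l : bdual S) (A k l) =
  \sum_i \sum_j (F i j : bdual S) (comprI (fun k i => x i k) A i j).
Proof.
transitivity (\sum_k \sum_l \sum_i \sum_j (Num.conj (x i k) * x j l) * (F i j (A k l) : R[i])).
  apply: eq_bigr => k _; apply: eq_bigr => l _.
  by rewrite bdual_sumE; apply: eq_bigr => i _; rewrite bdual_sumE.
under eq_bigr do rewrite exchange_big.
rewrite exchange_big; apply: eq_bigr => i _ /=.
under eq_bigr do rewrite exchange_big.
rewrite exchange_big; apply: eq_bigr => j _ /=.
rewrite linear_sum; apply: eq_bigr => k _.
by rewrite linear_sum; apply: eq_bigr => l _; rewrite linearZ.
Qed.

Lemma bdual_compressible : compressible (bdual S).
Proof.
move=> m n X F /dual_mposP Fp; apply/dual_mposP => A Ap.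
have := Fp _ (cS (\matrix_(i, j) X j i) Ap); congr (_ <= _).
have := dual_pairing_compr (fun i j => X i j) (fun i j => F i j) (fun i j => A i j).
rewrite /comprI => /esym E; apply: etrans (etrans E _).
  apply: eq_bigr => i _; apply: eq_bigr => j _; rewrite !mxE; congr (bop_fun _ _).
  by apply: eq_bigr => k _; apply: eq_bigr => l _; rewrite !mxE.
apply: eq_bigr => i _; apply: eq_bigr => j _; rewrite !mxE; congr (bop_fun _ _).
by apply: eq_bigr => k _; apply: eq_bigr => l _; rewrite !mxE.
Qed.

Lemma dual_posIP (I : finType) (F : I -> I -> bdual S) : posI F <->
  forall A : I -> I -> S, posI A -> 0 <= \sum_k \sum_l (F k l : bdual S) (A k l).
Proof.
rewrite /posI dual_mposP; split=> Fp A Ap.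
  have := Fp _ Ap; congr (_ <= _).
  rewrite [RHS]reindex_enum_val; apply: eq_bigr => i _.
  by rewrite [RHS]reindex_enum_val; apply: eq_bigr => j _; rewrite !mxE.
have /(posI_reindex cS enum_rank) /Fp : posI (fun i j => A i j) by apply/posI_ord.
congr (_ <= _).
rewrite [LHS]reindex_enum_val; apply: eq_bigr => i _.
rewrite [LHS]reindex_enum_val; apply: eq_bigr => j _.
by rewrite !mxE !enum_valK.
Qed.

Lemma bdual_dsummable : dsummable (bdual S).
Proof.
move=> p q F G /dual_mposP Fp /dual_mposP Gp; apply/dual_mposP => A /(posI_ord cS) Ap.
have /(posI_mx cS)/Fp E1 := posI_reindex cS (@lshift p q) Ap.
have /(posI_mx cS)/Gp E2 := posI_reindex cS (@rshift p q) Ap.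
have := addr_ge0 E1 E2; congr (_ <= _).
rewrite [RHS]big_split_ord /=; congr (_ + _).
  apply: eq_bigr => i _; rewrite [RHS]big_split_ord/= [X in _ = _ + X]big1 ?addr0.
    by apply: eq_bigr => j _; rewrite block_mxEul mxE.
  by move=> j _; rewrite block_mxEur mxE.
apply: eq_bigr => i _; rewrite [RHS]big_split_ord/= [X in _ = X + _]big1 ?add0r.
  by apply: eq_bigr => j _; rewrite block_mxEdr mxE.
by move=> j _; rewrite block_mxEdl mxE.
Qed.

Lemma dual_pos1P (f : bdual S) : pos1 f <-> dual_pos f.
Proof.
rewrite /pos1 dual_mposP; split=> fp.
  by move=> s sp; have := fp (const_mx s) sp; rewrite !big_ord1 !mxE.
move=> A Ap; rewrite !big_ord1 mxE; apply: fp.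
by move: Ap; rewrite /pos1; congr (mpos _ _); apply/matrixP => i j; rewrite !mxE !ord1.
Qed.
End DualCones.

Section MatrixOrderedTheory.
Variables (R : realType) (T : umconeType R) (st : T -> T).
Hypothesis mo : matrix_ordered st.
Let cT := mo_compr mo.
Let dT := mo_dsum mo.

Lemma pos1D (x y : T) : pos1 x -> pos1 y -> pos1 (x + y).
Proof. by rewrite !(pos1_posI cT); apply: (posI_add cT dT). Qed.

Lemma pos1Z (a : R) (x : T) : 0 <= a -> pos1 x -> pos1 (a%:C *: x).
Proof. by rewrite !(pos1_posI cT); apply: (posI_scale cT). Qed.

Lemma pos1_0 : pos1 (0 : T).
Proof. by have := pos1Z (lexx 0) (mo_unit mo); rewrite scale0r. Qed.

Lemma posI_0 (I : finType) : posI (fun _ _ : I => 0 : T).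
Proof.
have := pos1_outer cT (fun _ : I => 0) pos1_0.
by apply: eq_posI => i j; rewrite scaler0.
Qed.

Lemma posI_star (I : finType) (X : I -> I -> T) i j : posI X -> st (X i j) = X j i.
Proof.
move=> Xp; have := mo_herm mo Xp (enum_rank i) (enum_rank j).
by rewrite !mxE !enum_rankK.
Qed.

Lemma pos1_star (x : T) : pos1 x -> st x = x.
Proof. by move=> /(pos1_posI cT)/posI_star; apply; apply: ord0. Qed.

Lemma pos1_cone : convex_cone (@pos1 R T).
Proof. by split; [exact: pos1_0|exact: pos1D|exact: pos1Z]. Qed.

Lemma mo_unit_space : unit_space (@pos1 R T) munit st.
Proof.
split; [exact: mo_linear|exact: mo_starK|exact: pos1_cone|exact: pos1_star|exact: mo_unit mo|].
apply: (@order_unit_gen R T (@pos1 R T) munit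
  [set x | pos1 x /\ exists2 t : R, 0 <= t & pos1 (t%:C *: munit - x)]) pos1_cone _ _.
- by move=> x [xp [t _ xt]]; split=> //; exists t.
- by move=> Q Q0 QL QG; apply: (mo_gen mo) => // x xp xd; apply: QG.
Qed.
End MatrixOrderedTheory.

(** The values at [1], [-1], [i], [-i], taken with coefficients [1], [-1], [-i], [i], add up to
    [4 x]. This passes from quadratic forms at [e_k + c e_l] with unimodular [c] to the off-diagonal
    entry [x]. *)
Lemma polarization2 (R : realType) (U : lmodType R[i]) (a b x y : U)
    (Q : set U) : (forall c x y, Q x -> Q y -> Q (c *: x + y)) ->
  (forall c : R[i], Num.conj c * c = 1 -> Q (a + b + (c *: x + Num.conj c *: y))) -> Q x.
Proof.
move=> QL QX; pose q c := a + b + (c *: x + Num.conj c *: y).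
(* Coordinates along [a], [b], [x], [y] reduce the identity to four scalar ones. *)
pose lin p1 p2 p3 p4 := p1 *: a + p2 *: b + (p3 *: x + p4 *: y).
have linD p1 p2 p3 p4 r1 r2 r3 r4 :
    lin p1 p2 p3 p4 + lin r1 r2 r3 r4 = lin (p1 + r1) (p2 + r2) (p3 + r3) (p4 + r4).
  by rewrite /lin addrACA [X in X + _]addrACA [X in _ + X]addrACA -!scalerDl.
have linZ c p1 p2 p3 p4 : c *: lin p1 p2 p3 p4 = lin (c * p1) (c * p2) (c * p3) (c * p4).
  by rewrite /lin !scalerDr !scalerA.
have qE c : q c = lin 1 1 c (Num.conj c) by rewrite /lin !scale1r.
have xE : x = lin 0 0 1 0 by rewrite /lin !scale0r !add0r addr0 scale1r.
have i2 : 'i%C * 'i%C = -1 :> R[i] by rewrite -expr2 sqr_i.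
have Qq c : Num.conj c * c = 1 -> Q (q c) by exact: QX.
have Q1 : Q (q 1) by apply: Qq; rewrite conj1 mulr1.
have Q0 : Q 0 by rewrite -(addNr (q 1)) -scaleN1r; apply: (QL).
have QZ c z : Q z -> Q (c *: z) by move=> Qz; rewrite -[_ *: z]addr0; apply: (QL).
have QD z w : Q z -> Q w -> Q (z + w) by move=> Qz Qw; rewrite -[z]scale1r; apply: (QL).
have -> : x = 4^-1 *: (q 1 + -1 *: q (-1) + - 'i%C *: (q 'i%C + -1 *: q (- 'i%C))).
  rewrite !qE xE !(conjN, conj1, conjI) !(linD, linZ).
  have i3 : - 'i%C * ('i%C + -1 * - 'i%C) = 2 :> R[i].
    by transitivity (- ('i%C * 'i%C) *+ 2 : R[i]); [ring|rewrite i2 opprK].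
  have i4 : - 'i%C * (- 'i%C + -1 * - - 'i%C) = -2 :> R[i].
    by transitivity (('i%C * 'i%C) *+ 2 : R[i]); [ring|rewrite i2 mulr2n; ring].
  by rewrite i3 i4; congr lin; field.
apply: (QZ); apply: (QD); first by apply: (QD) => //; apply/QZ/Qq; rewrite conjN conj1 mulrNN mulr1.
apply: (QZ); apply: (QD); first by apply: Qq; rewrite conjI mulNr i2 opprK.
by apply/QZ/Qq; rewrite conjN conjI opprK mulrN i2 opprK.
Qed.

(** The sum is the quadratic form of [X] at the vector [e_k + c e_l]. *)
Lemma quad_unimodular (R : realType) (U : lmodType R[i]) (I : finType) (X : I -> I -> U)
    (k l : I) (c : R[i]) : Num.conj c * c = 1 ->
  \sum_m \sum_m' (Num.conj ((m == k)%:R + c * (m == l)%:R) *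
                   ((m' == k)%:R + c * (m' == l)%:R)) *: X m m' =
  X k k + X l l + (c *: X k l + Num.conj c *: X l k).
Proof.
move=> c1.
transitivity (\sum_m \sum_m' ((Num.conj ((m == k)%:R : R[i]) * (m' == k)%:R) *: X m m' +
    (Num.conj c * c) *: ((Num.conj ((m == l)%:R : R[i]) * (m' == l)%:R) *: X m m') +
    (c *: ((Num.conj ((m == k)%:R : R[i]) * (m' == l)%:R) *: X m m') +
     Num.conj c *: ((Num.conj ((m == l)%:R : R[i]) * (m' == k)%:R) *: X m m')))).
  apply: eq_bigr => m _; apply: eq_bigr => m' _.
  by rewrite !scalerA -!scalerDl conjD conjM; congr (_ *: _); ring.
under eq_bigr do rewrite !big_split/=.
rewrite !big_split/= c1.
under [X in _ + X + _]eq_bigr do rewrite -scaler_sumr.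
under [X in _ + (X + _)]eq_bigr do rewrite -scaler_sumr.
under [X in _ + (_ + X)]eq_bigr do rewrite -scaler_sumr.
by rewrite -!scaler_sumr !(@sum_delta2 R) scale1r.
Qed.

Lemma polarization (R : realType) (U : lmodType R[i]) (I : finType) (X : I -> I -> U)
    (Q : set U) : (forall a x y, Q x -> Q y -> Q (a *: x + y)) ->
  (forall v : I -> R[i], Q (\sum_k \sum_l (Num.conj (v k) * v l) *: X k l)) ->
  forall k l, Q (X k l).
Proof.
move=> QL QX k l; apply: (@polarization2 _ _ (X k k) (X l l) _ (X l k)) => // c c1.
by rewrite -quad_unimodular//; apply: QX.
Qed.

(** * Functionals on operator systems *)

Lemma mk_linear (R : realType) (V : lmodType R[i]) (f : V -> R[i]^o) :
  linear f -> exists g : {linear V -> R[i]^o}, forall x, g x = f x.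
Proof.
move=> fl; pose m := GRing.isLinear.Build R[i] V R[i]^o *:%R f fl.
by pose F : {linear V -> R[i]^o} := HB.pack f m; exists F.
Qed.

Section Functionals.
Variables (R : realType) (H : hilbertType R) (S : opsys H).
Implicit Types x y : S.
Let us := mo_unit_space (os_matrix_ordered S).

(** For [u = x^* v], the number [|u|^2] is the modulus of the inner product of [x u] and [v], hence
    at most [|x| |u| |v|]. *)
Lemma os_norm_st x : `|os_st x| <= `|x|.
Proof.
have [r rE r0] := norm_real x; rewrite rE os_normE bop_normE lecR.
apply: opnorm_le; split=> // v; set u := bop_fun _ v.
have [->|u0] := eqVneq u 0; first by rewrite normr0 mulr_ge0// lecR.
have un : 0 < `|u| by rewrite normr_gt0.
rewrite -(ler_pM2r un) -expr2 -hdotE.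
have -> : hdot H u u = osq (os_st x) v u by [].
have u_ge0 : 0 <= osq (os_st x) v u by rewrite [osq _ _ _]hdotE exprn_ge0.
rewrite -(ger0_norm u_ge0) os_stE norm_conjC.
apply: le_trans (hdot_CauchySchwarz _ _) _; rewrite mulrAC -rE ler_wpM2r//.
by rewrite os_normE bop_normE ler_opnorm.
Qed.

Lemma os_st1 : os_st (munit : S) = munit.
Proof. exact/(us_herm us)/(us_unit us). Qed.

Section Positive.
Variable f : {linear S -> R[i]^o}.
Hypothesis fpos : forall x, pos1 x -> 0 <= f x.

Lemma posfun_herm_bound x : os_st x = x -> `|f x : R[i]| <= `|x| * f munit.
Proof.
move=> sx; have [r rE r0] := norm_real x.
have [c cE c0] := ge0_realc (fpos (us_unit us)).
have h1 : 0 <= f (r%:C *: munit - x) by apply/fpos/os_dominated; rewrite ?rE.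
have h2 : 0 <= f (r%:C *: munit - - x).
  by apply/fpos/os_dominated; rewrite ?normrN ?rE// (us_starN us) sx.
move: h1 h2; rewrite !linfunB linfunN !linfunZ cE (us_real us fpos sx) rE opprK.
rewrite norm_realc -!realcM -realcB -realcD !lecR subr_ge0 => h1 h2.
rewrite ler_norml h1 andbT.
by rewrite -subr_ge0 opprK addrC.
Qed.

(** The factor 2 comes from writing [x = h + i k] with hermitian [h], [k] of norm at most that of
    [x]. *)
Lemma posfun_bound x : `|f x : R[i]| <= 2 * `|x| * f munit.
Proof.
pose h := 2^-1 *: (x + os_st x); pose k := (2^-1 * - 'i%C) *: (x - os_st x).
have c2 : Num.conj (2^-1 : R[i]) = 2^-1.
  by rewrite fmorphV rmorph_nat.
have sh : os_st h = h by rewrite /h (us_starZ us) (us_starD us) os_stK addrC c2.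
have sk : os_st k = k.
  rewrite /k (us_starZ us) (us_starB us) os_stK conjM conjN conjI c2 opprK.
  by rewrite mulrN scaleNr -scalerN opprB.
have xE : x = h + 'i%C *: k.
  rewrite scalerA mulrCA mulrN -expr2 sqr_i opprK mulr1 -scalerDr.
  by rewrite addrACA subrr addr0 -mulr2n -[x *+ 2]scaler_nat scalerA mulVf ?pnatr_eq0// scale1r.
have n2 : `|2^-1 : R[i]| = 2^-1 by rewrite ger0_norm// invr_ge0 ler0n.
have avg (y z : S) : `|y| <= `|x| -> `|z| <= `|x| -> 2^-1 * `|y + z| <= `|x|.
  move=> yx zx; rewrite mulrC ler_pdivrMr ?ltr0n// mulr_natr mulr2n.
  by apply: le_trans (ler_normD _ _) _; apply: lerD.
have nh : `|h| <= `|x|.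
  by rewrite normrZ n2; apply: avg => //; exact: os_norm_st.
have nk : `|k| <= `|x|.
  rewrite normrZ normrM n2 normrN norm_ic mulr1.
  by apply: avg; rewrite ?normrN//; exact: os_norm_st.
have f1 := fpos (us_unit us).
rewrite {1}xE linfunD [f ('i%C *: k)]linfunZ.
apply: (@le_trans _ _ (`|f h : R[i]| + `|'i%C : R[i]| * `|f k : R[i]|)).
  by rewrite -cnormM; exact: cnormD.
rewrite norm_ic mul1r.
rewrite -mulrA mulr_natl mulr2n; apply: lerD.
  by apply: le_trans (posfun_herm_bound sh) _; apply: ler_wpM2r.
by apply: le_trans (posfun_herm_bound sk) _; apply: ler_wpM2r.
Qed.

Lemma posfun_bounded : bounded_linear f.
Proof.
split; first exact: linearP.
have [c cE c0] := ge0_realc (fpos (us_unit us)).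
exists (2 * c); split; first by rewrite mulr_ge0.
move=> x; rewrite realcM -cE rmorph_nat mulrAC; exact: posfun_bound.
Qed.
End Positive.

(** The quadratic combinations of the [F k l] are positive functionals, hence bounded, and
    boundedness passes to the entries by polarization. Functionals found by algebraic extension thus
    belong to the Banach dual. *)
Lemma pos_bilinear_bounded (I : finType) (F : I -> I -> {linear S -> R[i]^o}) :
  (forall A, posI A -> 0 <= \sum_k \sum_l F k l (A k l)) ->
  forall k l, bounded_linear (F k l).
Proof.
move=> Fp k l.
have cS := @os_compressible _ _ S.
pose G i j : S -> R[i]^o := F i j.
apply: (polarization (X := G) (Q := @bounded_linear R S R[i]^o)).
- by move=> a f g fb gb; apply: bounded_linearD => //; apply: bounded_linearZ.
move=> v; set g := \sum_k _.
have gE x : g x = \sum_i \sum_j F i j ((Num.conj (v i) * v j) *: x).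
  rewrite /g !fct_sumE; apply: eq_bigr => i _; rewrite fct_sumE.
  by apply: eq_bigr => j _; rewrite linfunZ.
have gl : linear g.
  move=> a x y; rewrite !gE scaler_sumr -big_split; apply: eq_bigr => i _ /=.
  rewrite scaler_sumr -big_split; apply: eq_bigr => j _ /=.
  by rewrite -[a *: (_ : R[i]^o)]/(a * _) -linfunZ -linfunD; congr (F i j _); rewrite scalerDr !scalerA mulrC.
have [g' g'E] := mk_linear gl.
have -> : g = g' by apply/funext => x; rewrite g'E.
apply: posfun_bounded => x xp; rewrite g'E gE; apply: Fp.
exact: pos1_outer.
Qed.

Lemma unit_eq0_trivial : munit = 0 :> S -> forall x, x = 0.
Proof.
move=> u0 x; apply: osq_ext => v w; rewrite osq0.
have /(congr1 (fun T => osq T v v)) := u0; rewrite osq_unit osq0 hdotE => /eqP.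
rewrite sqrf_eq0 normr_eq0 => /eqP ->.
by rewrite /osq /bhq linear0 hdot0l.
Qed.

End Functionals.

(** * Decomposition of bounded functionals into positive ones *)

Section Jordan.
Variables (R : realType) (H : hilbertType R) (S : opsys H).
Implicit Types x y : S.
Let us := mo_unit_space (os_matrix_ordered S).
Let cP := us_cone us.

(** On the zero space the unit is 0 and [t] may be negative, hence the maximum. *)
Lemma os_nonneg_scalar (t : R) x : pos1 x -> pos1 (t%:C *: munit - x) ->
  `|x| <= (Num.max t 0)%:C /\ ((munit : S) != 0 -> 0 <= t).
Proof.
move=> xp xt; split.
  apply: os_norm_le => //; first by rewrite le_max lexx orbT.
  by apply: (us_unit_ge us) xt; rewrite le_max lexx.
move=> u0; rewrite leNgt; apply/negP => t0.
have tp : pos1 (t%:C *: munit : S) by rewrite -(subrK x (_ *: _)); apply: (coneD cP).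
have : pos1 (0%:C *: munit - munit : S).
  rewrite scale0r sub0r -scaleN1r.
  have -> : (-1 : R[i]) = (- t^-1)%:C * t%:C.
    by rewrite -realcM mulNr mulVf ?lt_eqF// realcN.
  by rewrite -scalerA; apply: (coneZ cP) => //; rewrite oppr_ge0 invr_le0 ltW.
move=> /(os_norm_le (lexx _) (us_unit us)).
by rewrite normr_le0 (negbTE u0).
Qed.

(* Extend [(w 1, z) |-> M w - z] to a functional on [S * C] that is nonnegative
   on the pairs [(a + b, f b)] with [a, b >= 0]. *)
Lemma dominate_hermitian (f : {linear S -> R[i]^o}) (M : R) : 0 <= M ->
  (forall x, `|f x : R[i]| <= M%:C * `|x|) -> (forall x, f (os_st x) = Num.conj (f x)) ->
  exists g : {linear S -> R[i]^o}, [/\ (munit : S) != 0 -> g munit = M%:C,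
    forall x, pos1 x -> 0 <= g x & forall x, pos1 x -> 0 <= g x - f x].
Proof.
move=> M0 fM f_st.
have fr x : pos1 x -> f x = (complex.Re (f x))%:C.
  move=> xp; rewrite RRe_real//; apply/CrealP.
  by rewrite -[Num.conj _]f_st (us_herm us xp).
have [u0|u0] := eqVneq (munit : S) 0.
  exists \0; split=> [|x _|x _]; rewrite ?eqxx//=.
  by rewrite (unit_eq0_trivial u0 x) linear0 subr0.
(* Nonnegativity at [(a, 0)] makes [g = h (_, 0)] positive; nonnegativity at [(b, f b)] together
   with [h (0, z) = - z] gives [g b >= f b]. *)
pose D : set (S * R[i]^o) := [set p | exists a b : S, [/\ pos1 a, pos1 b & p = (a + b, f b)]].
have cD : convex_cone D.
  split.
  - by exists 0, 0; rewrite linear0 addr0; split=> //; apply: (cone0 cP).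
  - move=> _ _ [a [b [pa pb ->]]] [a' [b' [pa' pb' ->]]].
    exists (a + a'), (b + b'); split; [exact: (coneD cP)..|].
    by rewrite linearD addrACA.
  - move=> t _ t0 [a [b [pa pb ->]]].
    exists (t%:C *: a), (t%:C *: b); split; [exact: (coneZ cP)..|].
    by rewrite linearZ -scalerDr.
pose i (p : R[i]^o * R[i]^o) : S * R[i]^o := (p.1 *: munit, p.2).
have i_lin : linear i.
  by move=> a [w z] [w' z']; rewrite /i/= scalerDl -scalerA.
pose im := GRing.isLinear.Build R[i] (R[i]^o * R[i]^o)%type (S * R[i]^o)%type *:%R i i_lin.
pose iL : {linear (R[i]^o * R[i]^o)%type -> (S * R[i]^o)%type} := HB.pack i im.
pose h0 (p : R[i]^o * R[i]^o) : R[i]^o := M%:C * p.1 - p.2.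
have h0_lin : linear h0.
  move=> a [w z] [w' z']; rewrite /h0/= -[_ *: (_ - _)]/(a * (M%:C * w - z)).
  rewrite -[a *: w]/(a * w) -[a *: z]/(a * z); ring.
have [h0L h0E] := mk_linear h0_lin.
have D_a a : pos1 a -> D (a, 0).
  by move=> pa; exists a, 0; rewrite linear0 addr0; split=> //; apply: (cone0 cP).
have ReB (v w : R[i]) : complex.Re (v - w) = complex.Re v - complex.Re w by rewrite raddfB.
have ReZ (t : R) (v : R[i]) : complex.Re (t%:C * v) = t * complex.Re v.
  by case: v => p q; simpc.
have [[y z]|[w z]|h hi hD] := @krein_extension _ _ _ iL h0L D cD.
- have [t [a [b [c [pa pb pc E]]]]] := us_dom us y; exists (t%:C : R[i]^o, z).
  exists (a, 0), (b, 0), (c, 0); split; [exact: D_a..|].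
  apply: (@etrans _ _ (t%:C *: munit - y, z - z)) => //.
  rewrite E subrr.
  apply: (@etrans _ _ (a + 'i%C *: (b - c), 0 + 'i%C *: (0 - 0))) => //.
  by rewrite subrr scaler0 addr0.
- move=> [_ [_ [_ [[a [b [pa pb ->]]] [a1 [b1 [pa1 pb1 ->]]] [a2 [b2 [pa2 pb2 ->]]] E]]]].
  have E1 : w *: munit = a + b + 'i%C *: (a1 + b1 - (a2 + b2)) by have := congr1 fst E.
  have E2 : z = (f b : R[i]) + 'i%C * ((f b1 : R[i]) - f b2) by have := congr1 snd E.
  have E3 : Num.conj w *: munit = a + b - 'i%C *: (a1 + b1 - (a2 + b2)).
    have := congr1 (@os_st _ _ S) E1.
    rewrite (us_starZ us) (us_starD us (a + b)) (us_starZ us) (us_starB us) conjI scaleNr.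
    rewrite os_st1 !(us_herm us)//; exact: (coneD cP).
  pose t := complex.Re w.
  have E4 : t%:C *: munit = a + b.
    have : (w + Num.conj w) *: munit = (a + b) *+ 2.
      by rewrite scalerDl E1 E3 addrACA subrr addr0 mulr2n.
    rewrite conjE addcJ -scalerA -[(a + b) *+ 2]scaler_nat.
    by move/(scalerI (_ : 2 != 0 :> R[i])); apply; rewrite pnatr_eq0.
  (* From [0 <= b <= t 1] the norm of [b] is at most [t], so that [f b <= M t]. *)
  have [nb /(_ u0) t0] : `|b| <= (Num.max t 0)%:C /\ ((munit : S) != 0 -> 0 <= t).
    by apply: os_nonneg_scalar => //; rewrite E4 addrK.
  rewrite max_l// in nb.
  rewrite h0E /h0/= ReB ReZ E2 (fr _ pb) (fr _ pb1) (fr _ pb2) -realcB.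
  set r := complex.Re (f b); set r' := complex.Re _ - _.
  have -> : complex.Re (r%:C + 'i%C * r'%:C) = r by simpc.
  rewrite subr_ge0 -lecR.
  apply: (@le_trans _ _ (`|f b : R[i]|)).
    by rewrite (fr _ pb) norm_realc lecR ler_norm.
  by apply: le_trans (fM b) _; rewrite realcM; apply: ler_wpM2l; rewrite // lecR.
pose e1 : R[i]^o * R[i]^o := (1, 0).
have hg a y : h (a *: y, 0) = a *: h (y, 0).
  by rewrite -linearZ; congr (h _); congr pair; rewrite scaler0.
have g_lin : linear (fun y : S => h (y, 0) : R[i]^o).
  move=> a x y; rewrite -hg -linearD; congr (h _).
  by apply: (@etrans _ _ (a *: x + y, 0 + 0)) => //; rewrite addr0.
have [g gE] := mk_linear g_lin.
exists g; split=> [_|x xp|x xp]; rewrite gE.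
- have -> : (munit, 0) = iL (1, 0) by rewrite /= /i/= scale1r.
  by rewrite hi h0E /h0/= mulr1 subr0.
- exact/hD/D_a.
have : 0 <= h (x, f x).
  by apply: hD; exists 0, x; rewrite add0r; split=> //; exact: (cone0 cP).
have -> : (x, f x) = (x, 0) + iL (0, f x).
  apply: (@etrans _ _ (x + 0 *: munit, 0 + f x)) => //.
  by rewrite scale0r addr0 add0r.
by rewrite linfunD hi h0E /h0 /= mulr0 sub0r.
Qed.

Lemma posfun_dual (g : {linear S -> R[i]^o}) : (forall x, pos1 x -> 0 <= g x) ->
  exists2 g' : bdual S, dual_pos g' & forall x, g' x = g x.
Proof.
move=> gp; exists (mkbop (posfun_bounded gp)) => // x xp; exact: gp.
Qed.

(** For the majorant [g] of mass [M] the parts are [g] and [g - f], of masses at most [M] and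
    [2 M]. *)
Lemma jordan_hermitian (f : bdual S) (M : R) : 0 <= M ->
  (forall x, `|f x : R[i]| <= M%:C * `|x|) -> (forall x, f (os_st x) = Num.conj (f x)) ->
  exists g1 g2 : bdual S, [/\ dual_pos g1, dual_pos g2, f = g1 - g2 &
    (g1 munit : R[i]) + g2 munit <= (3 * M)%:C].
Proof.
move=> M0 fM f_st.
pose fl : {linear S -> R[i]^o} := f.
have [g [g1 gp gf]] := @dominate_hermitian fl M M0 fM f_st.
have [G Gp GE] := posfun_dual gp.
exists G, (G - f); split=> //.
- by move=> x xp; rewrite -[bop_fun _ x]/(G x - f x) GE; apply: gf.
- by rewrite opprB addrC subrK.
rewrite -[bop_fun (G - f) _]/((G munit : R[i]) - f munit).
have [u0|u0] := eqVneq (munit : S) 0.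
  have z0 (h : bdual S) : (h munit : R[i]) = 0.
    by rewrite u0; have := linear0 (h : {linear S -> R[i]^o}).
  by rewrite !z0 subr0 addr0 lecR mulr_ge0.
rewrite !GE (g1 u0).
have f1r : fl munit \is Num.real by apply/CrealP; rewrite -[Num.conj _]f_st os_st1.
have n1 : `|munit : S| <= 1%:C.
  apply: os_norm_le => //; first exact: us_unit us.
  by rewrite scale1r subrr; exact: (cone0 cP).
have h1 : - (fl munit : R[i]) <= M%:C.
  have := real_ler_norm (_ : - (fl munit : R[i]) \is Num.real); rewrite realN normrN => /(_ f1r).
  move=> /le_trans; apply; apply: le_trans (fM _) _.
  by rewrite -[X in _ <= X]mulr1; apply: ler_wpM2l; rewrite // lecR.
have -> : (3 * M)%:C = M%:C + (M%:C + M%:C).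
  by rewrite -!realcD; congr (_%:C); ring.
by apply: lerD; [exact: lexx|apply: lerD; [exact: lexx|exact: h1]].
Qed.

(** The constant 6 is 3 for each of the two hermitian parts of [f]. The control of the masses is
    what makes positive pairings with the dual continuous. *)
Lemma jordan (f : bdual S) : exists g1 g2 g3 g4 : bdual S,
  [/\ dual_pos g1 /\ dual_pos g2, dual_pos g3 /\ dual_pos g4,
    f = g1 - g2 + 'i%C *: (g3 - g4) &
    (g1 munit : R[i]) + g2 munit + (g3 munit + g4 munit) <= 6 * `|f|].
Proof.
pose M := opnorm f.
have M0 : 0 <= M by exact: opnorm_ge0.
have [Mb fM] := bounded_by_opnorm f.
have fstM x : `|f (os_st x) : R[i]| <= M%:C * `|x|.
  apply: le_trans (fM _) _; apply: ler_wpM2l; first by rewrite lecR.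
  exact: os_norm_st.
pose f1 x : R[i]^o := 2^-1 * ((f x : R[i]) + Num.conj (f (os_st x))).
pose f2 x : R[i]^o := 2^-1 * (- 'i%C * ((f x : R[i]) - Num.conj (f (os_st x)))).
have fst_lin a x y : Num.conj (f (os_st (a *: x + y))) =
    a * Num.conj (f (os_st x)) + Num.conj (f (os_st y)).
  by rewrite os_st_linear linfunD linfunZ conjD conjM conjCK.
have f1_lin : linear f1.
  move=> a x y; rewrite /f1 fst_lin linfunD linfunZ -[RHS]/(a * _ + _); ring.
have f2_lin : linear f2.
  move=> a x y; rewrite /f2 fst_lin linfunD linfunZ -[RHS]/(a * _ + _); ring.
have c2 : Num.conj (2^-1 : R[i]) = 2^-1 by rewrite fmorphV rmorph_nat.
have n2 : `|2^-1 : R[i]| = 2^-1 by rewrite ger0_norm// invr_ge0 ler0n.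
have avg (u v : R[i]) x : `|u| <= M%:C * `|x| -> `|v| <= M%:C * `|x| ->
    2^-1 * `|u + v| <= M%:C * `|x|.
  move=> ux vx; rewrite mulrC ler_pdivrMr ?ltr0n// mulr_natr mulr2n.
  by apply: le_trans (cnormD _ _) _; apply: lerD.
have f1M x : `|f1 x : R[i]| <= M%:C * `|x|.
  by rewrite /f1 cnormM n2; apply: avg; rewrite ?norm_conjC.
have f2M x : `|f2 x : R[i]| <= M%:C * `|x|.
  rewrite /f2 !cnormM n2 normrN norm_ic mul1r.
  by apply: avg; rewrite ?normrN ?norm_conjC.
have f1st x : f1 (os_st x) = Num.conj (f1 x).
  by rewrite /f1 os_stK conjM c2 conjD conjCK addrC.
have f2st x : f2 (os_st x) = Num.conj (f2 x).
  by rewrite /f2 os_stK !conjM c2 conjB conjCK conjN conjI opprK; ring.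
have f1b : bounded_linear f1 by split=> //; exists M; split.
have f2b : bounded_linear f2 by split=> //; exists M; split.
have [g1 [g2 [p1 p2 E12 n12]]] := @jordan_hermitian (mkbop f1b) M M0 f1M f1st.
have [g3 [g4 [p3 p4 E34 n34]]] := @jordan_hermitian (mkbop f2b) M M0 f2M f2st.
exists g1, g2, g3, g4; split=> //.
  rewrite -E12 -E34; apply: bop_ext => x.
  rewrite bopDE bopZE /= /f1 /f2 -[_ *: _]/('i%C * _).
  set u := (f x : R[i]); set v := Num.conj _.
  have ii : 'i%C * 'i%C = -1 :> R[i] by rewrite -expr2 sqr_i.
  transitivity (2^-1 * (u + v) - ('i%C * 'i%C) * (2^-1 * (u - v))); last by ring.
  by rewrite ii; field.
apply: le_trans (lerD n12 n34) _.
have -> : 6 * `|f| = (6 * M)%:C by rewrite bop_normE realcM rmorph_nat.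
rewrite -realcD; have -> : 3 * M + 3 * M = 6 * M by clear; move: M => a; ring.
exact: lexx.
Qed.
End Jordan.

Lemma mk_linear_map (R : realType) (V W : lmodType R[i]) (f : V -> W) :
  linear f -> exists g : {linear V -> W}, forall x, g x = f x.
Proof.
move=> fl; pose m := GRing.isLinear.Build R[i] V W *:%R f fl.
by pose F : {linear V -> W} := HB.pack f m; exists F.
Qed.

(** * Maps into a bidual and their preadjoints *)

Section Preadjoint.
Variables (R : realType) (H K : hilbertType R) (X : opsys H) (T : opsys K).

(** For positive [g] the functional [B _ g] is positive of mass [g 1], hence of norm at most twice
    that; summing over the Jordan parts of [f] multiplies the 2 by 6. *)
Lemma pos_pairing_bound (B : X -> bdual T -> R[i]^o) :
  (forall f, linear (B^~ f)) -> (forall x, linear (B x)) ->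
  (forall x f, pos1 x -> dual_pos f -> 0 <= B x f) ->
  (forall f, B munit f = f munit) ->
  forall x f, `|B x f : R[i]| <= 12 * `|f| * `|x|.
Proof.
move=> Bl Br Bp B1 x f.
have Bg g : dual_pos g -> `|B x g : R[i]| <= 2 * `|x| * g munit.
  move=> gp; have [h hE] := mk_linear (Bl g).
  rewrite -hE -B1 -hE; apply: posfun_bound => y yp; rewrite hE; exact: Bp.
have [b bE] := mk_linear (Br x).
have [g1 [g2 [g3 [g4 [[p1 p2] [p3 p4] -> n]]]]] := jordan f.
rewrite -bE linfunD linfunZ 2!linfunB !bE.
apply: le_trans (cnormD _ _) _; rewrite cnormM norm_ic mul1r.
apply: (@le_trans _ _ (`|B x g1 : R[i]| + `|B x g2 : R[i]| + (`|B x g3 : R[i]| + `|B x g4 : R[i]|))).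
  by apply: lerD; apply: le_trans (cnormD _ _) _; rewrite normrN.
apply: (@le_trans _ _ (2 * `|x| * (g1 munit + g2 munit + (g3 munit + g4 munit)))).
  by rewrite !mulrDr; apply: lerD; apply: lerD; apply: Bg.
have x0 : 0 <= 2 * `|x| by rewrite mulr_ge0.
apply: le_trans (ler_wpM2l x0 n) _.
set N := `|_ + _|; set y := `|x|.
suff -> : 2 * y * (6 * N) = 12 * N * y by [].
by ring.
Qed.

Lemma pos_pairing_bop (B : X -> bdual T -> R[i]^o) :
  (forall f, linear (B^~ f)) -> (forall x, linear (B x)) ->
  (forall x f, pos1 x -> dual_pos f -> 0 <= B x f) ->
  (forall f, B munit f = f munit) ->
  exists Q : bop (bdual T) (bdual X), forall f x, (Q f : bdual X) x = B x f.
Proof.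
move=> Bl Br Bp B1; have bound := pos_pairing_bound Bl Br Bp B1.
have Bb f : bounded_linear (B^~ f).
  split; first exact: Bl.
  have [r rE r0] := norm_real f; exists (12 * r); split; first by rewrite mulr_ge0.
  by move=> x; rewrite realcM rmorph_nat -rE; apply: bound.
pose q f : bdual X := mkbop (Bb f).
have qb : bounded_linear q.
  split; first by move=> a f g; apply: bop_ext => x; exact: Br.
  exists 12; split=> // f; have [r rE r0] := norm_real f.
  rewrite rmorph_nat rE -[12](rmorph_nat (real_complex R)) -realcM bop_normE lecR.
  apply: opnorm_le; split; first by rewrite mulr_ge0.
  by move=> x; rewrite realcM rmorph_nat -rE; apply: bound.
by exists (mkbop qb).
Qed.
End Preadjoint.

Section DualMaps.
Variables (R : realType) (V W : nmconeType R).
Hypotheses (cV : compressible V) (cW : compressible W).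

Lemma dual_map_cp (P : bop V W) : cp P -> cp (dual_map P : bdual W -> bdual V).
Proof.
move=> Pcp n F /(dual_mposP cW) Fp; apply/(dual_mposP cV) => A /Pcp/Fp.
by congr (_ <= _); apply: eq_bigr => k _; apply: eq_bigr => l _; rewrite !mxE.
Qed.
End DualMaps.

Lemma bidual_in_cp (R : realType) (V : unmconeType R) : compressible V ->
  cp (@bidual_in R V).
Proof.
move=> cV n A Ap; apply/(dual_mposP (bdual_compressible cV)) => F /(dual_mposP cV)/(_ _ Ap).
by congr (_ <= _); apply: eq_bigr => k _; apply: eq_bigr => l _; rewrite !mxE.
Qed.

Lemma bidual_in_linear (R : realType) (V : unmconeType R) : linear (@bidual_in R V).
Proof. by move=> a x y; apply: bop_ext => f; exact: linearP. Qed.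

Section Core.
Variables (R : realType) (H K : hilbertType R) (X : opsys H) (T : opsys K).
Let cX := @os_compressible _ _ X.
Let cT := @os_compressible _ _ T.

(** [Phi] is only assumed linear; the continuity of its preadjoint comes from positivity and
    unitality, through [pos_pairing_bop]. *)
Lemma ucp_preadjoint (Phi : {linear X -> bidual T}) : ucp Phi ->
  exists2 Q : bop (bdual T) (bdual X), cp Q &
    forall f x, (Q f : bdual X) x = (Phi x : bidual T) f.
Proof.
move=> [Phicp Phi1].
have [|||f|Q QE] := @pos_pairing_bop _ _ _ X T (fun x f => (Phi x : bidual T) f).
- by move=> f a x y /=; rewrite linearP.
- by move=> x; exact: linearP.
- move=> x f xp fp; apply: (_ : dual_pos (Phi x : bdual (bdual T))).
    apply/(dual_pos1P (bdual_compressible cT)).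
    have := Phicp _ _ xp; rewrite /pos1; congr (mpos _ _).
    by apply/matrixP => i k; rewrite !mxE.
  exact/(dual_pos1P cT).
- by rewrite /= Phi1.
exists Q => // n F /(dual_mposP cT) Fp; apply/(dual_mposP cX) => A Ap.
have /(dual_mposP (bdual_compressible cT)) h := Phicp _ _ Ap.
have := h _ (_ : mpos n F); move/(_ (iffRL (dual_mposP cT F) Fp)).
congr (_ <= _); apply: eq_bigr => k _; apply: eq_bigr => l _.
by rewrite !mxE QE.
Qed.

(** [Phi] is the adjoint of [Q], restricted to the canonical copy of [X] in its bidual. *)
Lemma ucp_of_preadjoint (Q : bop (bdual T) (bdual X)) : cp Q ->
  (forall f : bdual T, (Q f : bdual X) munit = f munit) ->
  exists2 Phi : {linear X -> bidual T}, ucp Phi &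
    forall f x, (Phi x : bidual T) f = (Q f : bdual X) x.
Proof.
move=> Qcp Q1.
have lin : linear (fun x => dual_map Q (bidual_in x) : bidual T).
  by move=> a x y; rewrite bidual_in_linear linearP.
have [Phi PhiE] := mk_linear_map lin.
exists Phi => [|f x]; last by rewrite PhiE.
split=> [n A Ap|]; last by rewrite PhiE; apply: bop_ext => f; exact: Q1.
have := dual_map_cp (bdual_compressible cT) (bdual_compressible cX) Qcp
  (bidual_in_cp cX Ap).
by congr (mpos _ _); apply/matrixP => k l; rewrite !mxE PhiE.
Qed.
End Core.

(** * Consequences of a completely positive extension of functionals *)

Lemma ms_mposE (R : realType) n (Q : msys R n) m (X : 'M[Q]_m) :
  mpos m X = mpos m (map_mx (fun x : Q => sub_val x : Mn R n) X).
Proof. by []. Qed.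

Section Implications.
Variables (R : realType) (H : hilbertType R) (S1 S2 : opsys H).
Hypothesis S12 : forall T : BH H, os_space S1 T -> os_space S2 T.
Let j : bop S1 S2 := os_incl S12.
Let c1 := @os_compressible _ _ S1.
Let c2 := @os_compressible _ _ S2.

Definition dual_extension := exists2 P : bop (bdual S1) (bdual S2), cp P &
  forall (f : bdual S1) s, (P f : bdual S2) (j s) = f s.

Lemma os_incl_unit : j munit = munit.
Proof. exact: val_inj. Qed.

Lemma os_incl_mpos n (A : 'M[S1]_n) : mpos n A <-> mpos n (map_mx j A).
Proof.
rewrite !os_mposE; split=> Ap v; have := Ap v; congr (_ <= _);
by apply: eq_bigr => k _; apply: eq_bigr => l _; rewrite ?mxE.
Qed.

Lemma wri_dual_extension : wri j <-> dual_extension.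
Proof.
split=> [[Phi Phiucp Phij]|[P Pcp Pj]].
  have [Q Qcp QE] := ucp_preadjoint Phiucp.
  by exists Q => // f s; rewrite QE Phij.
have P1 (f : bdual S1) : (P f : bdual S2) munit = f munit.
  by rewrite -os_incl_unit Pj.
have [Phi Phiucp PhiE] := ucp_of_preadjoint Pcp P1.
by exists Phi => // s; apply: bop_ext => f; rewrite PhiE Pj.
Qed.

Hypothesis de : dual_extension.

Lemma extend_into_bidual (K : hilbertType R) (T : opsys K) (phi : {linear S1 -> bidual T}) :
  ucp phi -> exists2 phi' : {linear S2 -> bidual T}, ucp phi' & forall s, phi' (j s) = phi s.
Proof.
move=> phiucp; have [Q Qcp QE] := ucp_preadjoint phiucp; have [P Pcp Pj] := de.
pose q (f : bdual T) : bdual S2 := P (Q f).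
have qb : bounded_linear q.
  split; first by move=> a f g; rewrite /q !linearP.
  exists (opnorm P * opnorm Q); split; first by rewrite mulr_ge0// opnorm_ge0.
  move=> f; apply: le_trans (ler_opnorm _ _) _.
  rewrite realcM -mulrA; apply: ler_wpM2l; first by rewrite lecR opnorm_ge0.
  exact: ler_opnorm.
have qcp : cp q.
  move=> n F /Qcp/Pcp; congr (mpos _ _); by apply/matrixP => k l; rewrite !mxE.
have q1 (f : bdual T) : q f munit = f munit.
  by rewrite /q -os_incl_unit Pj QE phiucp.2.
have [Phi Phiucp PhiE] := @ucp_of_preadjoint _ _ _ S2 T (mkbop qb) qcp q1.
by exists Phi => // s; apply: bop_ext => f; rewrite PhiE Pj QE.
Qed.

Lemma bidual_retraction : wri (bidual_map j) /\
  exists2 E : {linear bidual S2 -> bidual S1}, ucp E & forall x, E (bidual_map j x) = x.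
Proof.
have [P Pcp Pj] := de.
have [E EE] := @mk_linear_map _ _ _ (dual_map P : bidual S2 -> bidual S1) (linearP _).
have Ej x : E (bidual_map j x) = x.
  rewrite EE; apply: bop_ext => f; congr (bop_fun x _).
  by apply: bop_ext => s; exact: Pj.
have Eucp : ucp E.
  split=> [n A Ap|]; last first.
    by rewrite EE; apply: bop_ext => f; rewrite -[RHS]Pj os_incl_unit.
  have := dual_map_cp (bdual_compressible c1) (bdual_compressible c2) Pcp Ap.
  by congr (mpos _ _); apply/matrixP => k l; rewrite !mxE EE.
split; last by exists E.
have c1d : compressible (bidual S1) by exact: (bdual_compressible (bdual_compressible c1)).
(* [E] followed by the canonical embedding of the bidual of [S1] into its own bidual witnesses the
   w.r.i. property. *)
have [F FE] := @mk_linear_map _ _ _ (fun x => bidual_in (E x) : bidual (bidual S1))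
  (fun a x y => etrans (congr1 _ (linearP E a x y)) (bidual_in_linear _ _ _)).
exists F; last by move=> s; rewrite FE Ej.
split=> [n A /(Eucp.1 n)/(bidual_in_cp c1d)|]; last by rewrite FE Eucp.2.
by congr (mpos _ _); apply/matrixP => k l; rewrite !mxE FE.
Qed.

(** [P] is applied to each entry of [phi]. That a matrix lies in [Q] is a family of linear relations
    between its entries, encoded by a linear retraction [r] of [M_n] onto [Q], and the linear map
    [P] preserves them. *)
Lemma extend_matrix_system n (Q : msys R n) (phi : {linear S1 -> Q}) : ucp phi ->
  exists2 phi' : {linear S2 -> Q}, ucp phi' & forall s, phi' (j s) = phi s.
Proof.
move=> [phicp phi1]; have [P Pcp Pj] := de.
pose v (x : Q) : 'M[R[i]]_n := (sub_val x : Mn R n).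
have vD a x y : v (a *: x + y) = a *: v x + v y by [].
have F0 k l : linear (fun s : S1 => v (phi s) k l : R[i]^o).
  by move=> a x y; rewrite linearP vD !mxE.
pose F1 k l := projT1 (cid (mk_linear (F0 k l))).
have F1E k l s : F1 k l s = v (phi s) k l by rewrite /F1; case: cid.
have vcp : cp (fun s : S1 => v (phi s) : Mn R n).
  move=> m A Ap; have := phicp m A Ap; rewrite ms_mposE; congr (mpos _ _).
  by apply/matrixP => k l; rewrite !mxE.
have vlin : linear (fun s : S1 => v (phi s) : Mn R n) by move=> a x y; rewrite linearP vD.
have Fb : forall k l, bounded_linear (F1 k l).
  apply: pos_bilinear_bounded => A /(posI_mx c1)/((cp_mxP c1 vlin).1 vcp).
  congr (_ <= _); apply: eq_bigr => k _; apply: eq_bigr => l _.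
  by rewrite mxE F1E.
pose F : 'M[bdual S1]_n := \matrix_(k, l) mkbop (Fb k l).
have FE k l s : (F k l : bdual S1) s = v (phi s) k l by rewrite mxE -F1E.
have Fp : mpos n F.
  apply/(dual_mposP c1) => A Ap; have := (cp_mxP c1 vlin).1 vcp A Ap.
  by congr (_ <= _); apply: eq_bigr => k _; apply: eq_bigr => l _; rewrite FE.
have [vL vLE] := @mk_linear_map _ Q (Mn R n) (fun x => v x : Mn R n) vD.
have [|r rK] := @linear_left_inverse _ (Mn R n) Q vL.
  by move=> x y; rewrite !vLE => /val_inj.
pose d k l : Mn R n := delta_mx k l.
have rE (M : 'M[R[i]]_n) k l : v (r M) k l = \sum_a \sum_b M a b * v (r (d a b)) k l.
  rewrite -[in LHS](vLE (r M)) {1}[M]matrix_sum_delta !linear_sum summxE.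
  apply: eq_bigr => a _; rewrite !linear_sum summxE; apply: eq_bigr => b _.
  by rewrite !linearZ !mxE vLE.
pose G t : Mn R n := \matrix_(k, l) (P (F k l) : bdual S2) t.
have Glin : linear G by move=> a x y; apply/matrixP => k l; rewrite !mxE linearP.
have FR k l : F k l = \sum_a \sum_b v (r (d a b)) k l *: F a b.
  apply: bop_ext => s; rewrite bdual_sumE FE -[phi s]rK vLE rE.
  apply: eq_bigr => a _; rewrite bdual_sumE; apply: eq_bigr => b _.
  by rewrite bopZE FE mulrC.
have vrG t : v (r (G t)) = G t.
  apply/matrixP => k l; rewrite rE [RHS]mxE FR linear_sum bdual_sumE.
  apply: eq_bigr => a _; rewrite linear_sum bdual_sumE; apply: eq_bigr => b _.
  by rewrite linearZ bopZE mxE mulrC.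
have [phi' phi'E] := @mk_linear_map _ S2 Q (fun t => r (G t))
  (fun a x y => etrans (congr1 _ (Glin a x y)) (linearP r _ _ _)).
exists phi'; last first.
  move=> s; rewrite phi'E -[RHS]rK; congr (r _); rewrite vLE.
  by apply/matrixP => k l; rewrite mxE Pj FE.
split=> [m A Ap|]; last first.
  rewrite phi'E -phi1 -[RHS]rK; congr (r _); rewrite vLE.
  by apply/matrixP => k l; rewrite mxE -os_incl_unit Pj FE.
have /(_ m A Ap) : cp G.
  apply/(cp_mxP c2 Glin) => B Bp; have /(dual_mposP c2)/(_ _ Bp) := Pcp _ _ Fp.
  by congr (_ <= _); apply: eq_bigr => k _; apply: eq_bigr => l _; rewrite !mxE.
rewrite ms_mposE; congr (mpos _ _); apply/matrixP => k l; rewrite !mxE phi'E.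
exact: (esym (vrG _)).
Qed.

End Implications.

Lemma cp_pos1 (R : realType) (V W : mconeType R) (f : V -> W) x : cp f -> pos1 x -> pos1 (f x).
Proof.
move=> fcp /fcp; rewrite /pos1; congr (mpos _ _).
by apply/matrixP => k l; rewrite !mxE.
Qed.

Lemma effros_mposE (R : realType) (S : unmconeType R) (phi : state S) m (X : 'M[effros phi]_m) :
  mpos m X = mpos m (map_mx (@effros_val _ _ phi) X).
Proof. by []. Qed.

(** * States and their Effros systems *)

Section StateExtension.
Variables (R : realType) (H : hilbertType R) (S1 S2 : opsys H).
Hypothesis S12 : forall T : BH H, os_space S1 T -> os_space S2 T.
Let j : bop S1 S2 := os_incl S12.
Let c1 := @os_compressible _ _ S1.
Let c2 := @os_compressible _ _ S2.

Definition state_extension_at (phi : state S1) := exists phi' : state S2,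
  [/\ forall s, phi' (j s) = phi s,
      forall psi : bdual S1, dual_pos psi -> dual_le psi phi ->
        exists psi' : bdual S2,
          [/\ forall s, psi' (j s) = psi s, dual_pos psi' & dual_le psi' phi']
    & exists2 Theta : {linear effros phi -> effros phi'}, cp Theta &
        forall psi : effros phi,
          dual_pos (effros_val psi) -> dual_le (effros_val psi) phi ->
          [/\ forall s, effros_val (Theta psi) (j s) = effros_val psi s,
              dual_pos (effros_val (Theta psi))
            & dual_le (effros_val (Theta psi)) phi']].

Lemma dual_extension_state : dual_extension S12 -> forall phi, state_extension_at phi.
Proof.
move=> [P Pcp Pj] phi.
have Ppos (f : bdual S1) : dual_pos f -> dual_pos (P f).
  by move=> /(dual_pos1P c1)/(cp_pos1 Pcp)/(dual_pos1P c2).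
have P1 : (P (st_fun phi) : bdual S2) munit = 1.
  by rewrite -(os_incl_unit S12) Pj st_unit.
pose phi' := State (Ppos _ (@st_pos _ _ phi)) P1.
have Ple f : dual_le f phi -> dual_le (P f) phi'.
  by rewrite /dual_le => /Ppos; rewrite linearB.
exists phi'; split.
- exact: Pj.
- move=> psi psi0 psile; exists (P psi); split; [exact: Pj|exact: (Ppos _ _)|exact: (Ple _ _)].
have Pspan (g : effros phi) : Defs.span (below phi') (P (effros_val g)).
  have [r rb rE] := subP g; rewrite /effros_val rE; exists [seq (p.1, P p.2 : bdual S2) | p <- r].
    by move=> _ /mapP[p /rb [p0 ple] ->]; split; [exact: (Ppos _ _)|exact: (Ple _ _)].
  by rewrite big_map linear_sum; apply: eq_bigr => p _; rewrite linearZ.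
have Tlin : linear (fun g => mksub (Pspan g) : effros phi').
  by move=> a x y; apply: val_inj; exact: (linearP P a (effros_val x) (effros_val y)).
have [Tht ThtE] := mk_linear_map Tlin.
exists Tht => [n X Xp|psi psi0 psile]; last first.
  by rewrite ThtE; split; [exact: Pj|exact: (Ppos _ _)|exact: (Ple _ _)].
have := Pcp _ _ (Xp : mpos n (map_mx (@effros_val _ _ phi) X)).
by rewrite effros_mposE; congr (mpos _ _); apply/matrixP => k l; rewrite !mxE ThtE.
Qed.

Lemma bdualDE (S : nmconeType R) (f g : bdual S) x : (f + g : bdual S) x = (f x : R[i]) + g x.
Proof. by []. Qed.
Lemma bdualNE (S : nmconeType R) (f : bdual S) x : (- f : bdual S) x = - (f x : R[i]).
Proof. by []. Qed.
Lemma bdualZE (S : nmconeType R) a (f : bdual S) x : (a *: f : bdual S) x = a * (f x : R[i]).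
Proof. by []. Qed.

Definition local_extension n (F : 'M[bdual S1]_n) := exists G : 'M[bdual S2]_n,
  [/\ mpos n G, forall k l s, (G k l : bdual S2) (j s) = (F k l : bdual S1) s &
      forall c : 'M[R[i]]_n, \sum_k \sum_l c k l *: F k l = 0 ->
        \sum_k \sum_l c k l *: G k l = 0].

Lemma posfun0 (f : bdual S1) : dual_pos f -> f munit = 0 -> f = 0.
Proof.
move=> f0 f1; apply: bop_ext => s; apply/eqP; rewrite -normr_le0.
pose fl : {linear S1 -> R[i]^o} := f; have E : fl munit = 0 by [].
by have := @posfun_bound _ _ S1 fl f0 s; rewrite E mulr0.
Qed.

Lemma mpos_quad n (F : 'M[bdual S1]_n) (v : 'I_n -> R[i]) : mpos n F ->
  dual_pos (\sum_k \sum_l (Num.conj (v k) * v l) *: F k l).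
Proof.
by move=> /(posI_ord (bdual_compressible c1))/(pos1_compr (bdual_compressible c1) v)/(dual_pos1P c1).
Qed.

Lemma mpos_diag n (F : 'M[bdual S1]_n) k : mpos n F -> dual_pos (F k k).
Proof.
by move=> /(posI_ord (bdual_compressible c1))/(posI_unit (bdual_compressible c1) k)/(dual_pos1P c1).
Qed.

Definition unimodular_quad n (F : 'M[bdual S1]_n) k l (c : R[i]) : bdual S1 :=
  F k k + F l l + (c *: F k l + Num.conj c *: F l k).

Lemma unimodular_quad_pos n (F : 'M[bdual S1]_n) k l c : Num.conj c * c = 1 ->
  mpos n F -> dual_pos (unimodular_quad F k l c).
Proof.
move=> cc Fp; rewrite /unimodular_quad -(quad_unimodular (fun k l => F k l))//.
exact: mpos_quad.
Qed.

Lemma dual_posD (S : opsys H) (f g : bdual S) : dual_pos f -> dual_pos g -> dual_pos (f + g).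
Proof. by move=> fp gp s sp; rewrite bopDE addr_ge0// ?fp ?gp. Qed.

Lemma dual_posZ (S : opsys H) (a : R) (f : bdual S) : 0 <= a -> dual_pos f ->
  dual_pos (a%:C *: f).
Proof. by move=> a0 fp s sp; rewrite bopZE mulr_ge0// ?lecR ?fp. Qed.

Definition dual_trace n (F : 'M[bdual S1]_n) : bdual S1 := \sum_k F k k.

(** The cross terms for [c] and [- c] cancel, so the two quadratic values add up to
    [2 F k k + 2 F l l], at most 4 times the trace. With polarization this places every entry of [F]
    in the Effros system of its normalised trace. *)
Lemma unimodular_quad_le n (F : 'M[bdual S1]_n) k l c : Num.conj c * c = 1 ->
  mpos n F -> dual_le (unimodular_quad F k l c) (4%:C *: dual_trace F).
Proof.
move=> cc Fp; have Nc1 : Num.conj (- c) * (- c) = 1 by rewrite conjN mulrNN.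
have h1 := unimodular_quad_pos k l Nc1 Fp.
have h2 i : dual_pos (dual_trace F - F i i).
  rewrite /dual_trace (bigD1 i)//= addrAC subrr add0r => s sp.
  rewrite bdual_sumE; apply: sumr_ge0 => m _; exact: (mpos_diag m Fp).
rewrite /dual_le.
have -> : 4%:C *: dual_trace F - unimodular_quad F k l c =
   2%:C *: (dual_trace F - F k k) + 2%:C *: (dual_trace F - F l l) + unimodular_quad F k l (- c).
  apply: bop_ext => s; rewrite /unimodular_quad conjN.
  have n4 : (4 : R)%:C = 4 :> R[i] by rewrite rmorph_nat.
  have n2 : (2 : R)%:C = 2 :> R[i] by rewrite rmorph_nat.
  by rewrite !(bdualDE, bdualNE, bdualZE) n4 n2; ring.
apply: dual_posD (unimodular_quad_pos _ _ Nc1 Fp).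
by apply: dual_posD; apply: dual_posZ.
Qed.
End StateExtension.

(** * Local extensions *)

Lemma effros_valPE (R : realType) (S : unmconeType R) (phi : state S) a (x y : effros phi) s :
  effros_val (a *: x + y) s = a * (effros_val x s : R[i]) + effros_val y s.
Proof.
rewrite /effros_val [sub_val (_ + _)]sub_valDE [sub_val (a *: x)]sub_valZE.
rewrite bdualDE.
by rewrite bdualZE.
Qed.

Lemma effros_val_sum (R : realType) (S : unmconeType R) (phi : state S) n (c : 'M[R[i]]_n)
    (E : 'I_n -> 'I_n -> effros phi) :
  effros_val (\sum_k \sum_l c k l *: E k l) = \sum_k \sum_l c k l *: effros_val (E k l).
Proof.
have lin : linear (@effros_val _ _ phi) by move=> a x y; apply: bop_ext => s; exact: effros_valPE.
have [ev evE] := mk_linear_map lin; rewrite -evE linear_sum; apply: eq_bigr => k _.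
by rewrite linear_sum; apply: eq_bigr => l _; rewrite linearZ evE.
Qed.

Section StateToLocal.
Variables (R : realType) (H : hilbertType R) (S1 S2 : opsys H).
Hypothesis S12 : forall T : BH H, os_space S1 T -> os_space S2 T.
Let j : bop S1 S2 := os_incl S12.
Let k2 := @os_compressible _ _ S2.

Lemma dual_trace_pos n (F : 'M[bdual S1]_n) : mpos n F -> dual_pos (dual_trace F).
Proof. by move=> Fp s sp; rewrite bdual_sumE; apply: sumr_ge0 => m _; exact: (mpos_diag m Fp). Qed.

Lemma dual_trace0 n (F : 'M[bdual S1]_n) k l : mpos n F ->
  dual_trace F munit = 0 -> F k l = 0.
Proof.
move=> Fp /(posfun0 (dual_trace_pos Fp)) F0.
apply: (@polarization2 _ _ (F k k) (F l l) (F k l) (F l k) [set f | f = 0]).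
  by move=> c x y /= -> ->; rewrite scaler0 addr0.
move=> c cc /=; have := unimodular_quad_le k l cc Fp.
rewrite /dual_le F0 scaler0 sub0r => h1; have h2 := unimodular_quad_pos k l cc Fp.
apply: posfun0 => //; apply/eqP; rewrite eq_le h2 ?andbT; last exact: os_unit_pos.
by have := h1 _ (os_unit_pos S1); rewrite bdualNE oppr_ge0.
Qed.

(** [Theta] is known to extend functionals only on the generators of the Effros system; linearity
    carries this to their span, by induction on the list of a linear combination. *)
Lemma effros_extend (phi : state S1) (phi' : state S2) (Theta : {linear effros phi -> effros phi'}) :
  (forall psi : effros phi, dual_pos (effros_val psi) -> dual_le (effros_val psi) phi ->
    forall s, effros_val (Theta psi) (j s) = effros_val psi s) ->
  forall psi s, effros_val (Theta psi) (j s) = effros_val psi s.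
Proof.
move=> ext psi s; have [r rb rE] := subP psi.
elim: r => [|p r IHr] in psi rb rE *.
  have -> : psi = 0 by apply: val_inj; rewrite /= rE big_nil.
  by rewrite linear0.
have pb : below phi p.2 by apply: rb; rewrite mem_head.
pose g1 : effros phi := @mksub _ _ (Defs.span (below phi)) p.2 (mem_span pb).
pose g2 : effros phi := psi - p.1 *: g1.
have g2E : effros_val (Theta g2) (j s) = effros_val g2 s.
  apply: IHr; first by move=> q qr; apply: rb; rewrite in_cons qr orbT.
  by rewrite [sub_val g2](_ : _ = sub_val psi - p.1 *: p.2)// rE big_cons addrAC subrr add0r.
have psiE : psi = p.1 *: g1 + g2 by rewrite /g2 addrC subrK.
have [g10 g1le] := pb; have g1E := ext g1 g10 g1le s.
move: (g1) (g2) (p.1) psiE g1E g2E => h1 h2 a -> h1E h2E.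
by rewrite linearP !effros_valPE h1E h2E.
Qed.

Lemma state_local_extension n (F : 'M[bdual S1]_n) : mpos n F ->
  (forall phi, state_extension_at S12 phi) -> local_extension S12 F.
Proof.
move=> Fp ext.
have [t tE t0] : exists2 t : R, dual_trace F munit = t%:C & 0 <= t.
  by apply/ge0_realc/(dual_trace_pos Fp)/os_unit_pos.
(* A trace of mass 0 cannot be normalised to a state, but then [F] vanishes. *)
have [t_0|t1] := eqVneq t 0.
  have F0 k l : F k l = 0 by apply: dual_trace0; rewrite // tE t_0.
  exists 0; split=> [|k l s|c _].
  - apply/(dual_mposP k2) => A Ap; rewrite big1// => k _; rewrite big1// => l _.
    by rewrite mxE.
  - by rewrite mxE F0.
  - by rewrite big1// => k _; rewrite big1// => l _; rewrite mxE scaler0.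
have tp : 0 < t by rewrite lt_def t1.
have phi0 : dual_pos (t^-1%:C *: dual_trace F).
  by apply: dual_posZ; [rewrite invr_ge0|exact: dual_trace_pos].
have phi1 : (t^-1%:C *: dual_trace F : bdual S1) munit = 1.
  by rewrite bdualZE tE -realcM mulVf.
pose phi := State phi0 phi1.
have Fspan k l : Defs.span (below phi) (F k l).
  apply: (@polarization2 _ _ (F k k) (F l l) (F k l) (F l k) (Defs.span (below phi))).
    by move=> c x y sx sy; apply: (spD (l := Defs.span _)) => //; apply: (spZ (l := Defs.span _)).
  move=> c cc; set q := _ + _ + _.
  (* The 4 is that of [unimodular_quad_le] and [t] is the mass of the trace: divided by [4 t], the
     positive functional [q] lies below [phi]. *)
  have -> : q = (4 * t)%:C *: ((4 * t)^-1%:C *: q).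
    by rewrite scalerA -realcM divff ?scale1r// mulf_neq0// pnatr_eq0.
  apply: (spZ (l := Defs.span _)); apply: mem_span; split.
    by apply: dual_posZ; [rewrite invr_ge0 mulr_ge0|exact: unimodular_quad_pos].
  rewrite /dual_le.
  rewrite [X in dual_pos X](_ : _ = (4 * t)^-1%:C *: (4%:C *: dual_trace F - q)); last first.
    rewrite scalerBr scalerA -realcM; congr (_%:C *: _ - _).
    by rewrite invfM mulrAC mulVf ?mul1r// pnatr_eq0.
  by apply: dual_posZ; [rewrite invr_ge0 mulr_ge0|exact: unimodular_quad_le].
have [phi' [_ _ [Th Tcp Text]]] := ext phi.
pose E : 'M[effros phi]_n := \matrix_(k, l) mksub (Fspan k l).
have EE k l : effros_val (E k l) = F k l by rewrite mxE.
have Ep : mpos n E.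
  by rewrite effros_mposE; move: Fp; congr (mpos _ _); apply/matrixP => k l; rewrite mxE EE.
pose G : 'M[bdual S2]_n := \matrix_(k, l) effros_val (Th (E k l)).
have ext' : forall psi s, effros_val (Th psi) (j s) = effros_val psi s.
  by apply: effros_extend => psi p0 ple s; have [] := Text psi p0 ple.
exists G; split=> [|k l s|c].
- have := Tcp _ _ Ep; rewrite effros_mposE; congr (mpos _ _).
  by apply/matrixP => k l; rewrite !mxE.
- by rewrite mxE ext' EE.
move=> cF.
have cE : \sum_k \sum_l c k l *: E k l = 0.
  apply: val_inj; rewrite -[RHS]cF; apply: etrans (effros_val_sum _ _) _.
  by apply: eq_bigr => k _; apply: eq_bigr => l _; rewrite EE.
have := congr1 (fun x => effros_val (Th x)) cE; rewrite linear0 => E0.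
rewrite -[RHS](_ : effros_val (0 : effros phi') = 0)// -E0 linear_sum.
have -> : \sum_k Th (\sum_l c k l *: E k l) = \sum_k \sum_l c k l *: Th (E k l).
  apply: eq_bigr => k _; rewrite linear_sum; apply: eq_bigr => l _; exact: linearZ.
rewrite effros_val_sum; apply: eq_bigr => k _; apply: eq_bigr => l _.
by rewrite mxE.
Qed.
End StateToLocal.

Lemma mk_bilin (R : realType) (V W : lmodType R[i]) (b : V -> W -> R[i]^o) :
  (forall w, linear (b^~ w)) -> (forall v, linear (b v)) ->
  exists B : bilin V W, forall v w, B v w = b v w.
Proof.
move=> bl br.
have bb : bilinear_for *:%R *:%R b.
  by split=> [w a x y|v a x y]; [exact: bl|exact: br].
pose m := bilinear_isBilinear.Build R[i] V W R[i]^o *:%R *:%R b bb.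
by pose B : bilin V W := HB.pack b m; exists B.
Qed.

(** * Tensors as functionals on bilinear forms *)

Section Tensors.
Variables (R : realType) (V W : lmodType R[i]).

Lemma tpure_linl (w : W) : linear ((@tpure R V W)^~ w).
Proof.
move=> a x y; apply: val_inj; apply/funext => B.
exact: (linearPl B w a x y).
Qed.

Lemma tpure_linr (v : V) : linear (@tpure R V W v).
Proof.
move=> a x y; apply: val_inj; apply/funext => B.
exact: (linearPr B v a x y).
Qed.

Lemma tpure0l w : tpure 0 w = 0 :> tens V W.
Proof. by have := tpure_linl w (-1) 0 0; rewrite scaler0 addr0 scaleN1r addNr. Qed.

Lemma tpure0r v : tpure v 0 = 0 :> tens V W.
Proof. by have := tpure_linr v (-1) 0 0; rewrite scaler0 addr0 scaleN1r addNr. Qed.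

Lemma tpureZl a v w : tpure (a *: v) w = a *: tpure v w :> tens V W.
Proof. by rewrite -[a *: v]addr0 tpure_linl tpure0l addr0. Qed.

Lemma tpureZr a v w : tpure v (a *: w) = a *: tpure v w :> tens V W.
Proof. by rewrite -[a *: w]addr0 tpure_linr tpure0r addr0. Qed.

Lemma tpureDl x y w : tpure (x + y) w = tpure x w + tpure y w :> tens V W.
Proof. by rewrite -[x]scale1r tpure_linl !scale1r. Qed.

Lemma tpureDr v x y : tpure v (x + y) = tpure v x + tpure v y :> tens V W.
Proof. by rewrite -[x]scale1r tpure_linr !scale1r. Qed.

Lemma tpureBl x y w : tpure (x - y) w = tpure x w - tpure y w :> tens V W.
Proof. by rewrite tpureDl -scaleN1r tpureZl scaleN1r. Qed.

Lemma tpureBr v x y : tpure v (x - y) = tpure v x - tpure v y :> tens V W.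
Proof. by rewrite tpureDr -scaleN1r tpureZr scaleN1r. Qed.

Lemma tpure_suml I (r : seq I) (F : I -> V) w :
  tpure (\sum_(i <- r) F i) w = \sum_(i <- r) tpure (F i) w :> tens V W.
Proof. by elim/big_rec2: _ => [|i y x _ <-]; rewrite ?tpure0l ?tpureDl. Qed.

Lemma tpure_sumr I (r : seq I) v (F : I -> W) :
  tpure v (\sum_(i <- r) F i) = \sum_(i <- r) tpure v (F i) :> tens V W.
Proof. by elim/big_rec2: _ => [|i y x _ <-]; rewrite ?tpure0r ?tpureDr. Qed.

Lemma tens_ind (Q : set (tens V W)) : Q 0 ->
  (forall a x y, Q x -> Q y -> Q (a *: x + y)) ->
  (forall v w, Q (tpure v w)) -> forall x, Q x.
Proof.
move=> Q0 QL Qp x; have [r rP xE] := subP x.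
elim: r => [|p r IHr] in x rP xE *.
  have -> // : x = 0; by apply: val_inj; rewrite /= xE big_nil.
have [v [w pE]] : exists v w, p.2 = @tensor_fun R V W v w by apply: rP; rewrite mem_head.
have -> : x = p.1 *: tpure v w + (x - p.1 *: tpure v w) by rewrite addrC subrK.
apply: QL => //; apply: IHr; first by move=> q qr; apply: rP; rewrite in_cons qr orbT.
rewrite [sub_val _](_ : _ = sub_val x - p.1 *: p.2); last by rewrite pE.
by rewrite xE big_cons addrAC subrr add0r.
Qed.

Definition tens_ev (B : bilin V W) (x : tens V W) : R[i]^o := sub_val x B.

Lemma tens_ev_linear B : linear (tens_ev B).
Proof. by move=> a x y. Qed.

HB.instance Definition _ B :=
  GRing.isLinear.Build R[i] (tens V W) R[i]^o *:%R (tens_ev B) (tens_ev_linear B).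

Lemma tens_ev_pure B v w : tens_ev B (tpure v w) = B v w.
Proof. by []. Qed.

Lemma tens_ev_sum B n (X : 'M[V]_n) (Y : 'M[W]_n) :
  tens_ev B (\sum_k \sum_l tpure (X k l) (Y k l)) = \sum_k \sum_l (B (X k l) (Y k l) : R[i]).
Proof.
rewrite linear_sum; apply: eq_bigr => k _; rewrite linear_sum.
by apply: eq_bigr => l _; exact: tens_ev_pure.
Qed.

Lemma eq_tens_ev (B B' : bilin V W) x : (forall v w, B v w = B' v w) -> tens_ev B x = tens_ev B' x.
Proof.
move=> BB'; move: x; apply: tens_ind => [|a x y Ex Ey|v w].
- by rewrite !linear0.
- by rewrite !tens_ev_linear Ex Ey.
- by rewrite !tens_ev_pure.
Qed.

Lemma tens_ext (x y : tens V W) : (forall B, tens_ev B x = tens_ev B y) -> x = y.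
Proof. by move=> xy; apply: val_inj; apply/funext. Qed.

Lemma bilin_of_functional (g : {linear tens V W -> R[i]^o}) :
  exists B : bilin V W, (forall v w, B v w = g (tpure v w)) /\ forall x, g x = tens_ev B x.
Proof.
have [||B BE] := @mk_bilin R V W (fun v w => g (tpure v w)).
- by move=> w a x y; rewrite tpure_linl linearP.
- by move=> v a x y; rewrite tpure_linr linearP.
exists B; split=> //; apply: tens_ind => [|a x y Ex Ey|v w].
- by rewrite !linear0.
- by rewrite linearP tens_ev_linear Ex Ey.
- by rewrite tens_ev_pure BE.
Qed.
End Tensors.

Lemma tens_ev_map (R : realType) (V1 V2 W : lmodType R[i]) (f : {linear V1 -> V2})
    (B : bilin V2 W) (B' : bilin V1 W) x :
  (forall v w, B' v w = B (f v) w) -> tens_ev B (tens_map f x) = tens_ev B' x.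
Proof. move=> BB'; rewrite -[LHS]/(tens_ev (pull f B) x); by apply: eq_tens_ev => v w; rewrite BB'. Qed.

(** A left inverse of [f] extends every bilinear form from [V1] to [V2], and bilinear forms separate
    tensors. *)
Lemma tens_map_inj (R : realType) (V1 V2 W : lmodType R[i]) (f : {linear V1 -> V2}) :
  injective f -> injective (@tens_map R V1 V2 W f).
Proof.
move=> /linear_left_inverse[r rK] x y xy; apply: tens_ext => B.
have [||B' B'E] := @mk_bilin R V2 W (fun v w => B (r v) w).
- by move=> w a v v'; rewrite linearP linearPl.
- by move=> v a w w'; rewrite linearPr.
by rewrite -!(@tens_ev_map _ _ _ _ f B' B) ?xy// => v w; rewrite B'E rK.
Qed.

Section SchurCone.
Variables (R : realType) (V W : mconeType R).

(* The cone of the maximal tensor product at level 1, before closing it. *)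
Definition schur_cone : set (tens V W) :=
  [set x | exists n (A : 'M[V]_n) (B : 'M[W]_n),
     [/\ mpos n A, mpos n B & x = \sum_k \sum_l tpure (A k l) (B k l)]].

Hypotheses (cV : compressible V) (cW : compressible W).

Lemma schur_coneI (I : finType) (A : I -> I -> V) (B : I -> I -> W) :
  posI A -> posI B -> schur_cone (\sum_k \sum_l tpure (A k l) (B k l)).
Proof.
move=> Ap Bp; exists #|I|, (\matrix_(i, j) A (enum_val i) (enum_val j)),
  (\matrix_(i, j) B (enum_val i) (enum_val j)); split=> //.
rewrite [LHS]reindex_enum_val; apply: eq_bigr => k _.
by rewrite [LHS]reindex_enum_val; apply: eq_bigr => l _; rewrite !mxE.
Qed.

Lemma schur_cone_pure v w : pos1 v -> pos1 w -> schur_cone (tpure v w).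
Proof.
move=> /(pos1_posI cV) vp /(pos1_posI cW) wp.
by have := schur_coneI vp wp; rewrite !big_ord1.
Qed.

Hypotheses (dV : dsummable V) (dW : dsummable W) (v0 : pos1 (0 : V)) (w0 : pos1 (0 : W)).

(** Sums come from direct sums in both factors at once, as the off-diagonal blocks contribute
    nothing. *)
Lemma schur_cone_cone : convex_cone schur_cone.
Proof.
split.
- by have := schur_cone_pure v0 w0; rewrite tpure0l.
- move=> _ _ [n [A [B [Ap Bp ->]]]] [m [A' [B' [Ap' Bp' ->]]]].
  exists (n + m)%N, (block_mx A 0 0 A'), (block_mx B 0 0 B'); split; [exact: dV|exact: dW|].
  rewrite big_split_ord/=; congr (_ + _); apply: eq_bigr => k _; rewrite big_split_ord/=.
    rewrite [X in _ = _ + X]big1 ?addr0; last by move=> l _; rewrite !block_mxEur mxE tpure0l.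
    by apply: eq_bigr => l _; rewrite !block_mxEul.
  rewrite [X in _ = X + _]big1 ?add0r; last by move=> l _; rewrite !block_mxEdl mxE tpure0l.
  by apply: eq_bigr => l _; rewrite !block_mxEdr.
- move=> a _ a0 [n [A [B [Ap Bp ->]]]].
  exists n, (\matrix_(i, j) (a%:C *: A i j)), B; split=> //.
    by apply/(posI_mx cV)/(posI_scale cV a0)/(posI_ord cV).
  rewrite scaler_sumr; apply: eq_bigr => k _; rewrite scaler_sumr; apply: eq_bigr => l _.
  by rewrite mxE tpureZl.
Qed.
End SchurCone.

(** * From local extensions to a global one *)

Section LocalToGlobal.
Variables (R : realType) (H : hilbertType R) (S1 S2 : opsys H).
Hypothesis S12 : forall T : BH H, os_space S1 T -> os_space S2 T.
Let j : {linear S1 -> S2} := os_incl S12.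
Let k1 := @os_compressible _ _ S1.
Let k2 := @os_compressible _ _ S2.
Let kd := bdual_compressible k1.

Lemma os_incl_inj : injective j.
Proof. by move=> x y /(congr1 (@sub_val _ _ _)) xy; apply: val_inj. Qed.

Lemma bdual_pos1_0 (S : opsys H) : pos1 (0 : bdual S).
Proof. by apply/(dual_pos1P (@os_compressible _ _ S)) => s sp; exact: lexx. Qed.

Let D : set (tens S2 (bdual S1)) := @schur_cone R S2 (bdual S1).

Let cD : convex_cone D.
Proof.
apply: schur_cone_cone => //.
- exact: os_dsummable.
- exact: (bdual_dsummable k1).
- exact: pos1_0 (os_matrix_ordered S2).
- exact: bdual_pos1_0.
Qed.

(** The relations of [F] hold for [G], so [F k l |-> G k l] is well defined on the span of the
    entries. Its extension to the whole dual is purely algebraic; positivity is known only on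
    [F]. *)
Lemma local_extension_map n (F : 'M[bdual S1]_n) : local_extension S12 F ->
  exists2 L : {linear bdual S1 -> bdual S2}, mpos n (map_mx L F) &
    forall k l s, (L (F k l) : bdual S2) (j s) = F k l s.
Proof.
move=> [G [Gp Gext Grel]].
pose lc (V : lmodType R[i]) (X : 'M[V]_n) (c : 'M[R[i]]_n) : V := \sum_k \sum_l c k l *: X k l.
have lcP (V : lmodType R[i]) (X : 'M[V]_n) a c d : lc V X (a *: c + d) = a *: lc V X c + lc V X d.
  rewrite /lc scaler_sumr -big_split; apply: eq_bigr => k _ /=.
  rewrite scaler_sumr -big_split; apply: eq_bigr => l _ /=.
  by rewrite !mxE scalerDl scalerA.
have lcd (V : lmodType R[i]) (X : 'M[V]_n) k l : lc V X (delta_mx k l) = X k l.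
  rewrite /lc (bigD1 k)//= (bigD1 l)//= mxE !eqxx scale1r.
  rewrite big1 ?addr0; last by move=> i il; rewrite mxE (negbTE il) andbF scale0r.
  rewrite big1 ?addr0// => i ik; apply: big1 => m _.
  by rewrite mxE (negbTE ik) scale0r.
have [||w [c [c0 ->]]|L LP] := @linear_graph_extension R[i] (bdual S1) (bdual S2)
    [set p | exists c, p = (lc _ F c, lc _ G c)].
- exists 0; congr pair; rewrite /lc big1// => k _; rewrite big1// => l _; by rewrite mxE scale0r.
- by move=> a _ _ [c ->] [d ->]; exists (a *: c + d); rewrite !lcP.
- by apply: Grel; exact: esym c0.
have LE k l : L (F k l) = G k l.
  by apply: LP; exists (delta_mx k l); rewrite !lcd.
exists L => [|k l s]; last by rewrite LE Gext.
by move: Gp; congr (mpos _ _); apply/matrixP => k l; rewrite mxE LE.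
Qed.

(* Relative to a retraction [r] of [j], an element of [S1 (x) S1*] that lies in
   [S2 (x) W] with [W = span F_kl] also lies in [S1 (x) W]; so its trace can be
   computed with the extension of [F]. *)
Lemma trace_positive (x : tens S1 (bdual S1)) (t : bilin S1 (bdual S1)) :
  (forall n (F : 'M[bdual S1]_n), mpos n F -> local_extension S12 F) ->
  (forall s (f : bdual S1), t s f = f s) ->
  complex_cone D (tens_map j x) -> 0 <= complex.Re (tens_ev t x).
Proof.
move=> LE tE [_ [_ [_ [[n [A [F [Ap Fp ->]]]] [m [B [G [Bp Gp ->]]]] [p [C [K [Cp Kp ->]]]] xE]]]].
have dd := bdual_dsummable k1.
(* The three summands of an element of [complex_cone D] have to be treated by the same [L], hence
   the direct sum of their matrices. *)
pose M := block_mx F 0 0 (block_mx G 0 0 K).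
have Mp : mpos (n + (m + p)) M by apply: (dd) => //; apply: (dd).
have [L Lp Lext] := local_extension_map (LE _ _ Mp).
have [r rK] := linear_left_inverse os_incl_inj.
(* [b1] is the trace after [r], [b3] the pairing through [L], and [b2] the latter with [r] inserted.
   At [y], which comes from [S1], [b1] gives the trace of [x] and [b2] agrees with [b3]. On tensors
   whose second factors are entries of [M], [b1] agrees with [b2] because [L] extends these entries,
   and [b3] is positive on the summands. *)
have [||b1 b1E] := @mk_bilin R S2 (bdual S1) (fun v (f : bdual S1) => f (r v)).
- by move=> f a u v; rewrite !linearP.
- by move=> v a f g.
have [||b2 b2E] := @mk_bilin R S2 (bdual S1) (fun v f => (L f : bdual S2) (j (r v))).
- by move=> f a u v; rewrite !linearP.
- by move=> v a f g; rewrite linearP.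
have [||b3 b3E] := @mk_bilin R S2 (bdual S1) (fun v f => (L f : bdual S2) v).
- by move=> f a u v; rewrite linearP.
- by move=> v a f g; rewrite linearP.
set y := tens_map j x in xE.
have e1 : tens_ev b1 y = tens_ev t x.
  by apply: tens_ev_map => s f; rewrite tE b1E rK.
have e2 : tens_ev b2 y = tens_ev b3 y.
  have [||b4 b4E] := @mk_bilin R S1 (bdual S1) (fun v f => (L f : bdual S2) (j v)).
  - by move=> f a u v; rewrite !linearP.
  - by move=> v a f g; rewrite linearP.
  transitivity (tens_ev b4 x).
    by apply: tens_ev_map => s f; rewrite b2E rK b4E.
  by apply: esym; apply: tens_ev_map => s f; rewrite b3E b4E.
pose block a (f : 'I_a -> 'I_(n + (m + p))) (N : 'M[bdual S1]_a) := forall k l, M (f k) (f l) = N k l.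
have bF : block n (lshift _) F by move=> k l; rewrite /M block_mxEul.
have bG : block m (fun i => rshift n (lshift p i)) G.
  by move=> k l; rewrite /M block_mxEdr block_mxEul.
have bK : block p (fun i => rshift n (rshift m i)) K.
  by move=> k l; rewrite /M block_mxEdr block_mxEdr.
have b12 a f N (X : 'M[S2]_a) : block a f N ->
    tens_ev b1 (\sum_k \sum_l tpure (X k l) (N k l)) =
    tens_ev b2 (\sum_k \sum_l tpure (X k l) (N k l)).
  move=> fN; rewrite !tens_ev_sum; apply: eq_bigr => k _; apply: eq_bigr => l _.
  by rewrite b1E b2E -fN Lext.
have b3pos a f N (X : 'M[S2]_a) : block a f N -> mpos a X ->
    0 <= tens_ev b3 (\sum_k \sum_l tpure (X k l) (N k l)).
  move=> fN Xp; have /(posI_ord (bdual_compressible k2)) := Lp.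
  move=> /(posI_reindex (bdual_compressible k2) f)/(posI_mx (bdual_compressible k2)).
  move=> /(dual_mposP k2)/(_ _ Xp); rewrite tens_ev_sum; congr (_ <= _).
  by apply: eq_bigr => k _; apply: eq_bigr => l _; rewrite b3E mxE mxE fN.
have ev3 b : tens_ev b y = (tens_ev b (\sum_k \sum_l tpure (A k l) (F k l)) : R[i]) +
   'i%C * ((tens_ev b (\sum_k \sum_l tpure (B k l) (G k l)) : R[i]) -
           tens_ev b (\sum_k \sum_l tpure (C k l) (K k l))).
  by rewrite xE linfunD linfunZ linfunB.
have -> : tens_ev t x = tens_ev b3 y.
  by rewrite -e1 -e2 !ev3 (b12 _ _ _ A bF) (b12 _ _ _ B bG) (b12 _ _ _ C bK).
rewrite ev3.
have [u -> u0] := ge0_realc (b3pos _ _ _ _ bF Ap).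
have [v -> _] := ge0_realc (b3pos _ _ _ _ bG Bp).
have [w -> _] := ge0_realc (b3pos _ _ _ _ bK Cp).
by rewrite -realcB; simpc.
Qed.

Lemma local_extension_dual : 
  (forall n (F : 'M[bdual S1]_n), mpos n F -> local_extension S12 F) -> dual_extension S12.
Proof.
move=> LE; have j1 : j munit = munit := os_incl_unit S12.
have [||t tE] := @mk_bilin R S1 (bdual S1) (fun s (f : bdual S1) => f s).
- by move=> f a u v; exact: linearP.
- by move=> v a f g.
have [i iE] := @mk_linear_map R (tens S1 (bdual S1)) (tens S2 (bdual S1)) (tens_map j) (linearP _).
have [ev evE] := mk_linear (tens_ev_linear t).
have [y|x|g gi gD] := @krein_extension R _ _ i ev D cD.
- suff [_ [x ->]] : exists2 z, (exists x, z = i x) & complex_cone D (z - y) by exists x.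
  (* The generators [a (x) f] with [0 <= a <= r 1] and [f] positive are dominated by [r 1 (x) f],
     which comes from [S1]. They span because every functional has a Jordan decomposition. *)
  apply: (@majorant_gen R _ D _ [set z | exists a f, [/\ pos1 a, dual_pos f,
    exists2 t : R, 0 <= t & pos1 (t%:C *: munit - a) & z = tpure a f]] cD _ _ _ y).
  + split; first by exists 0; rewrite linear0.
      by move=> _ _ [x ->] [x' ->]; exists (x + x'); rewrite linearD.
    by move=> a _ _ [x ->]; exists (a%:C *: x); rewrite linearZ.
  + move=> _ [a [f [ap fp [r r0 ar] ->]]]; have /(dual_pos1P k1) fp1 := fp; split.
      exact: schur_cone_pure.
    exists (tpure (r%:C *: munit) f).
      exists (tpure (r%:C *: munit) f); rewrite iE tens_map_tensor.
      by rewrite linearZ -[X in _ *: X]j1.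
    by rewrite -tpureBl; exact: schur_cone_pure.
  + move=> Q Q0 QL QG; apply: tens_ind => // a f.
    have QZ c z : Q z -> Q (c *: z) by move=> Qz; rewrite -[_ *: z]addr0; apply: (QL).
    have QD z w : Q z -> Q w -> Q (z + w) by move=> Qz Qw; rewrite -[z]scale1r; apply: (QL).
    apply: (mo_gen (os_matrix_ordered S2) (Q := fun a => Q (tpure a f))) => [|c u v Qu Qv|].
    * by rewrite tpure0l.
    * by rewrite tpure_linl; apply: (QL).
    move=> {}a ap ad.
    have Qf g : dual_pos g -> Q (tpure a g) by move=> gp; apply: QG; exists a, g; split.
    have [g1 [g2 [g3 [g4 [[p1 p2] [p3 p4] -> _]]]]] := jordan f.
    rewrite tpureDr tpureZr !tpureBr.
    have QB z w : Q z -> Q w -> Q (z - w).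
      by move=> Qz Qw; apply: (QD) => //; rewrite -scaleN1r; apply: (QZ).
    by apply: (QD); [|apply: (QZ)]; apply: QB; apply: Qf.
- by rewrite iE evE => /trace_positive; apply => //.
(* [g] is turned into the map [P f = g (_ (x) f)]; positivity of [g] on [D] is complete positivity
   of [P]. *)
have [||a f ap fp|f|P PE] := @pos_pairing_bop _ _ _ S2 S1 (fun a f => g (tpure a f)).
- by move=> f c u v; rewrite tpure_linl linearP.
- by move=> a c u v; rewrite tpure_linr linearP.
- by apply: gD; apply: schur_cone_pure => //; apply/(dual_pos1P k1).
- by rewrite -j1 -tens_map_tensor -iE gi evE tens_ev_pure tE.
exists P => [n F Fp|f s]; last first.
  by rewrite PE -tens_map_tensor -iE gi evE tens_ev_pure tE.
apply/(dual_mposP k2) => A Ap.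
have : 0 <= g (\sum_k \sum_l tpure (A k l) (F k l)) by apply: gD; exists n, A, F.
congr (_ <= _); rewrite linear_sum; apply: eq_bigr => k _; rewrite linear_sum.
by apply: eq_bigr => l _; rewrite mxE PE.
Qed.
End LocalToGlobal.

Lemma mxcompressE (R : realType) (V : lmodType R[i]) m n (X : 'M[R[i]]_(m, n)) (Y : 'M[V]_m) k l :
  mxcompress X Y k l = \sum_a \sum_b (Num.conj (X a k) * X b l) *: Y a b.
Proof. by rewrite mxE; apply: eq_bigr => a _; apply: eq_bigr => b _; rewrite !mxE. Qed.

Lemma mxcompress_comp (R : realType) (V : lmodType R[i]) m n p (X : 'M[R[i]]_(n, p))
    (Z : 'M[R[i]]_(m, n)) (Y : 'M[V]_m) :
  mxcompress X (mxcompress Z Y) = mxcompress (Z *m X) Y.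
Proof.
apply/matrixP => k l; rewrite !mxcompressE.
transitivity (\sum_a \sum_b \sum_c \sum_d
    (Num.conj (X a k) * X b l * (Num.conj (Z c a) * Z d b)) *: Y c d).
  apply: eq_bigr => a _; apply: eq_bigr => b _; rewrite mxcompressE scaler_sumr.
  by apply: eq_bigr => c _; rewrite scaler_sumr; apply: eq_bigr => d _; rewrite scalerA.
under eq_bigr do rewrite exchange_big.
rewrite exchange_big; apply: eq_bigr => c _ /=.
under eq_bigr do rewrite exchange_big.
rewrite exchange_big; apply: eq_bigr => d _ /=.
under eq_bigr do rewrite -scaler_suml.
rewrite -scaler_suml; congr (_ *: _); rewrite !mxE conj_sum mulr_suml.
apply: eq_bigr => a _; rewrite mulr_sumr; apply: eq_bigr => b _.
by rewrite conjM; ring.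
Qed.

Lemma mxcompress1 (R : realType) (V : lmodType R[i]) n (Y : 'M[V]_n) : mxcompress 1%:M Y = Y.
Proof.
apply/matrixP => k l; rewrite mxcompressE -[RHS](sum_delta2 (fun a b => Y a b)).
by apply: eq_bigr => a _; apply: eq_bigr => b _; rewrite !mxE.
Qed.

Lemma psd_mx_CauchySchwarz (R : realType) n (M : Mn R n) k l :
  (forall v : 'I_n -> R[i], 0 <= \sum_k \sum_l Num.conj (v k) * v l * M k l) ->
  `|M k l| ^+ 2 <= M l l * M k k.
Proof.
move=> Mp; rewrite -!(mnq_delta M); apply: (psd_CauchySchwarz (mnq_l M) (mnq_r M)) => v.
have := Mp (fun k => v k 0); rewrite mnqE; congr (_ <= _).
by apply: eq_bigr => a _; apply: eq_bigr => b _; rewrite mulrAC.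
Qed.

Lemma psd_mx_herm (R : realType) n (M : Mn R n) k l :
  (forall v : 'I_n -> R[i], 0 <= \sum_k \sum_l Num.conj (v k) * v l * M k l) ->
  M k l = Num.conj (M l k).
Proof.
move=> Mp; rewrite -!(mnq_delta M); apply: (psd_herm (mnq_l M) (mnq_r M)) => v.
have := Mp (fun k => v k 0); rewrite mnqE; congr (_ <= _).
by apply: eq_bigr => a _; apply: eq_bigr => b _; rewrite mulrAC.
Qed.

Lemma bdual_sum2E (R : realType) (S : nmconeType R) n (c : 'M[R[i]]_n) (F : 'M[bdual S]_n) s :
  (\sum_k \sum_l c k l *: F k l : bdual S) s = \sum_k \sum_l c k l * (F k l s : R[i]).
Proof.
rewrite bdual_sumE; apply: eq_bigr => k _; rewrite bdual_sumE; apply: eq_bigr => l _.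
exact: bdualZE.
Qed.

Lemma cp_entries (R : realType) (H : hilbertType R) (S : opsys H) n (phi : S -> Mn R n) :
  linear phi -> cp phi ->
  exists2 F : 'M[bdual S]_n, mpos n F & forall k l s, F k l s = phi s k l.
Proof.
move=> lin phicp; have cS := @os_compressible _ _ S.
have F0 k l : linear (fun s : S => phi s k l : R[i]^o) by move=> a x y; rewrite lin !mxE.
pose F1 k l := projT1 (cid (mk_linear (F0 k l))).
have F1E k l s : F1 k l s = phi s k l by rewrite /F1; case: cid.
have Fb : forall k l, bounded_linear (F1 k l).
  apply: pos_bilinear_bounded => A /(posI_mx cS)/((cp_mxP cS lin).1 phicp).
  congr (_ <= _); apply: eq_bigr => k _; apply: eq_bigr => l _.
  by rewrite mxE F1E.
pose F : 'M[bdual S]_n := \matrix_(k, l) mkbop (Fb k l).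
have FE k l s : (F k l : bdual S) s = phi s k l by rewrite mxE -F1E.
exists F => //; apply/(dual_mposP cS) => A Ap; have := (cp_mxP cS lin).1 phicp A Ap.
by congr (_ <= _); apply: eq_bigr => k _; apply: eq_bigr => l _; rewrite FE.
Qed.

(** * Reduction to unital matrices of functionals *)

Section Unital.
Variables (R : realType) (H : hilbertType R) (S1 S2 : opsys H).
Hypothesis S12 : forall T : BH H, os_space S1 T -> os_space S2 T.
Let j : {linear S1 -> S2} := os_incl S12.
Let k1 := @os_compressible _ _ S1.
Let k2 := @os_compressible _ _ S2.

(** A relation [c] between the entries of the compressed matrix is the relation [d] between those of
    [F], so local extensions can be compressed along with [F]. *)
Lemma local_extension_compress m n (X : 'M[R[i]]_(m, n)) (F : 'M[bdual S1]_m) :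
  local_extension S12 F -> local_extension S12 (mxcompress X F).
Proof.
move=> [G [Gp Gext Grel]]; exists (mxcompress X G); split.
- exact: (bdual_compressible k2).
- move=> k l s; rewrite !mxcompressE !bdual_sumE; apply: eq_bigr => a _.
  by rewrite !bdual_sumE; apply: eq_bigr => b _; rewrite !bdualZE Gext.
move=> c.
pose d : 'M[R[i]]_m := \matrix_(a, b) \sum_k \sum_l c k l * (Num.conj (X a k) * X b l).
have E (V : lmodType R[i]) (Y : 'M[V]_m) :
    \sum_k \sum_l c k l *: mxcompress X Y k l = \sum_a \sum_b d a b *: Y a b.
  transitivity (\sum_k \sum_l \sum_a \sum_b (c k l * (Num.conj (X a k) * X b l)) *: Y a b).
    apply: eq_bigr => k _; apply: eq_bigr => l _; rewrite mxcompressE scaler_sumr.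
    by apply: eq_bigr => a _; rewrite scaler_sumr; apply: eq_bigr => b _; rewrite scalerA.
  under eq_bigr do rewrite exchange_big.
  rewrite exchange_big; apply: eq_bigr => a _ /=.
  under eq_bigr do rewrite exchange_big.
  rewrite exchange_big; apply: eq_bigr => b _ /=.
  under eq_bigr do rewrite -scaler_suml.
  by rewrite -scaler_suml mxE.
by rewrite !E; apply: Grel.
Qed.

Lemma local_extension0 n (F : 'M[bdual S1]_n) : mpos n F ->
  dual_trace F munit = 0 -> local_extension S12 F.
Proof.
move=> Fp t0; have F0 k l : F k l = 0 by exact: dual_trace0.
exists 0; split=> [|k l s|c _].
- apply/(dual_mposP k2) => A Ap; rewrite big1// => k _; rewrite big1// => l _.
  by rewrite mxE.
- by rewrite mxE F0.
- by rewrite big1// => k _; rewrite big1// => l _; rewrite mxE scaler0.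
Qed.

Lemma dual_trace_state n (F : 'M[bdual S1]_n) : mpos n F ->
  dual_trace F munit = 0 \/ exists phi : state S1, True.
Proof.
move=> Fp.
have [t tE t0] : exists2 t : R, dual_trace F munit = t%:C & 0 <= t.
  by apply/ge0_realc/(dual_trace_pos Fp)/os_unit_pos.
have [t_0|t1] := eqVneq t 0; first by left; rewrite tE t_0.
right.
have phi0 : dual_pos (t^-1%:C *: dual_trace F).
  by apply: dual_posZ; [rewrite invr_ge0|exact: dual_trace_pos].
have phi1 : (t^-1%:C *: dual_trace F : bdual S1) munit = 1.
  by rewrite bdualZE tE -realcM mulVf.
by exists (State phi0 phi1).
Qed.

Lemma mpos_zero n (F : 'M[bdual S1]_n) k l : mpos n F -> F k k = 0 ->
  F k l = 0 /\ F l k = 0.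
Proof.
move=> Fp F0.
have z s : pos1 s -> F k l s = 0 /\ F l k s = 0.
  move=> sp; pose M : Mn R n := \matrix_(a, b) F a b s.
  have Mp v : 0 <= \sum_k \sum_l Num.conj (v k) * v l * M k l.
    have := mpos_quad v Fp sp; rewrite bdual_sumE; congr (_ <= _).
    apply: eq_bigr => a _; rewrite bdual_sumE; apply: eq_bigr => b _.
    by rewrite bdualZE mxE.
  have := psd_mx_CauchySchwarz k l Mp; have := psd_mx_CauchySchwarz l k Mp.
  rewrite !mxE F0 mul0r mulr0.
  by split; apply/eqP; rewrite -normr_eq0 -sqrf_eq0 eq_le ?exprn_ge0// andbT.
have ext (f : bdual S1) : (forall s, pos1 s -> f s = 0) -> f = 0.
  move=> f0; pose fl : {linear S1 -> R[i]^o} := f; apply: bop_ext.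
  apply: (mo_gen (os_matrix_ordered S1) (Q := fun s => fl s = 0)) => [|a x y fx fy|s sp _].
  - by rewrite linear0.
  - by rewrite linfunD linfunZ fx fy mulr0 addr0.
  - exact: f0.
by split; apply: ext => s /z[].
Qed.

Definition unital n (F : 'M[bdual S1]_n) := forall k l, F k l munit = (k == l)%:R.

(** Where [d k] is nonzero, [F] is rescaled by its inverse square root; where it is zero, row and
    column [k] of [F] vanish and a state is put on the diagonal. The result [G] is unital, and
    congruence by the square roots of [d] recovers [F] and erases the added states. *)
Lemma local_extension_diag n (F : 'M[bdual S1]_n) (d : 'I_n -> R) :
  (forall m (G : 'M[bdual S1]_m), mpos m G -> unital G -> local_extension S12 G) ->
  mpos n F -> (forall k, 0 <= d k) -> (forall k l, F k l munit = (k == l)%:R * (d k)%:C) ->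
  local_extension S12 F.
Proof.
move=> LEu Fp d0 F1.
have [|[phi _]] := dual_trace_state Fp; first exact: local_extension0.
pose e k : R := if d k == 0 then 1 else Num.sqrt (d k).
have e0 k : e k != 0.
  by rewrite /e; case: (eqVneq (d k) 0) => dk; rewrite ?oner_eq0// sqrtr_eq0 -ltNge lt_def dk d0.
pose X : 'M[R[i]]_n := diag_mx (\row_k (e k)^-1%:C).
pose N : 'M[bdual S1]_n := \matrix_(k, l) (if (k == l) && (d k == 0) then phi : bdual S1 else 0).
have XE (V : lmodType R[i]) (Y : 'M[V]_n) (f : 'I_n -> R) k l :
    mxcompress (diag_mx (\row_k (f k)%:C)) Y k l = (f k * f l)%:C *: Y k l.
  rewrite mxcompressE (bigD1 k)//= [X in _ + X]big1 ?addr0; last first.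
    move=> a ak; apply: big1 => b _; rewrite !mxE (negbTE ak) mulr0n.
    by rewrite conj0 mul0r scale0r.
  rewrite (bigD1 l)//= big1 ?addr0; last first.
    by move=> b bl; rewrite !mxE (negbTE bl) mulr0n mulr0 scale0r.
  by rewrite !mxE !eqxx !mulr1n conjR -realcM.
pose G : 'M[bdual S1]_n := mxcompress X F + N.
have GE k l : G k l = ((e k)^-1 * (e l)^-1)%:C *: F k l + N k l by rewrite mxE XE.
have Np : mpos n N.
  apply/(dual_mposP k1) => A /(posI_ord k1) Ap; apply: sumr_ge0 => k _.
  rewrite (bigD1 k)//= big1 ?addr0; last first.
    by move=> l lk; rewrite mxE eq_sym (negbTE lk).
  rewrite mxE eqxx /=; case: ifP => _; last exact: lexx.
  by apply: (@st_pos _ _ phi); exact: (posI_unit k1 k Ap).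
have Gp : mpos n G.
  apply/(dual_mposP k1) => A Ap.
  have /(dual_mposP k1)/(_ _ Ap) h1 := bdual_compressible k1 X Fp.
  have /(dual_mposP k1)/(_ _ Ap) h2 := Np.
  have := addr_ge0 h1 h2; congr (_ <= _); rewrite -big_split; apply: eq_bigr => k _.
  by rewrite -big_split; apply: eq_bigr => l _; rewrite [G k l]mxE bdualDE.
have Gu : unital G.
  move=> k l; rewrite GE bdualDE bdualZE F1 [N k l]mxE.
  have [->|kl] := eqVneq k l; last by rewrite mul0r mulr0 add0r.
  rewrite mul1r -realcM /e; have [->|dl] := eqVneq (d l) 0.
    by rewrite mulr0 add0r /=; exact: st_unit.
  by rewrite -invfM -expr2 sqr_sqrtr// mulVf// addr0.
have FE : F = mxcompress (diag_mx (\row_k (Num.sqrt (d k))%:C)) G.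
  apply/matrixP => k l; rewrite XE GE.
  have zero i : d i = 0 -> F i i = 0.
    by move=> di; apply: posfun0; [exact: mpos_diag|rewrite F1 di mulr0].
  have [dk|dk] := eqVneq (d k) 0.
    by rewrite dk sqrtr0 mul0r scale0r; have [] := mpos_zero l Fp (zero k dk).
  have [dl|dl] := eqVneq (d l) 0.
    by rewrite dl sqrtr0 mulr0 scale0r; have [] := mpos_zero k Fp (zero l dl).
  rewrite mxE (negbTE dk) andbF addr0 scalerA -realcM /e (negbTE dk) (negbTE dl).
  rewrite mulrACA divff ?sqrtr_eq0 -?ltNge ?lt_def ?dk ?d0//.
  by rewrite divff ?sqrtr_eq0 -?ltNge ?lt_def ?dl ?d0// mulr1 scale1r.
by rewrite FE; apply/local_extension_compress/LEu.
Qed.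

(** The values of [F] at 1 form a positive scalar matrix; a unitary congruence from its spectral
    decomposition makes it diagonal. *)
Lemma local_extension_unital n (F : 'M[bdual S1]_n) :
  (forall m (G : 'M[bdual S1]_m), mpos m G -> unital G -> local_extension S12 G) ->
  mpos n F -> local_extension S12 F.
Proof.
move=> LEu Fp.
pose a : 'M[R[i]]_n := \matrix_(k, l) F k l munit.
have ap v : 0 <= \sum_k \sum_l Num.conj (v k) * v l * a k l.
  have := mpos_quad v Fp (os_unit_pos S1); rewrite bdual_sumE; congr (_ <= _).
  apply: eq_bigr => k _; rewrite bdual_sumE; apply: eq_bigr => l _.
  by rewrite bdualZE mxE.
have ah : a \is hermsymmx.
  apply/is_hermitianmxP; rewrite expr0 scale1r; apply/matrixP => k l.
  transitivity (Num.conj (a l k)); first exact: psd_mx_herm.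
  by rewrite [RHS]mxE; congr Num.conj; rewrite [RHS]mxE.
have /orthomx_spectralP := hermitian_normalmx ah.
set U := spectralmx a; set d := spectral_diag a => aE.
have Uu : U \in unitmx by exact: spectral_unit.
have UE : invmx U = adjmx U by apply: invmx_unitary; exact: spectral_unitarymx.
pose G : 'M[bdual S1]_n := mxcompress (adjmx U) F.
have adjK (X : 'M[R[i]]_n) : adjmx (adjmx X) = X.
  by apply/matrixP => k l; rewrite !mxE conjCK.
have G1 k l : G k l munit = (k == l)%:R * d 0 l.
  transitivity ((U *m a *m adjmx U) k l).
    rewrite mxcompressE bdual_sumE; under eq_bigr do rewrite bdual_sumE.
    rewrite exchange_big [RHS]mxE; apply: eq_bigr => l' _.
    rewrite [X in _ = X * _]mxE mulr_suml; apply: eq_bigr => k' _.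
    by rewrite bdualZE !mxE conjCK mulrAC.
  rewrite aE -UE !mulmxA mulmxV// mul1mx -mulmxA mulmxV// mulmx1 !mxE.
  by case: eqVneq => [->|_]; rewrite ?mulr1n ?mul1r ?mulr0n ?mul0r.
have Gp : mpos n G by exact: bdual_compressible.
have dr k : exists2 t : R, d 0 k = t%:C & 0 <= t.
  apply/ge0_realc; have := mpos_diag k Gp (os_unit_pos S1).
  by rewrite G1 eqxx mul1r.
pose D k := projT1 (cid2 (dr k)).
have DE k : d 0 k = (D k)%:C by rewrite /D; case: cid2.
have D0 k : 0 <= D k by rewrite /D; case: cid2.
have -> : F = mxcompress U G by rewrite mxcompress_comp -UE mulVmx// mxcompress1.
apply: local_extension_compress; apply: (@local_extension_diag _ _ D) => // k l.
rewrite G1; case: eqVneq => [->|_]; last by rewrite !mul0r.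
by rewrite DE.
Qed.

Lemma dual_mpos_star n (F : 'M[bdual S1]_n) k l s : mpos n F ->
  F k l (os_st s) = Num.conj (F l k s).
Proof.
move=> Fp.
pose fl a b : {linear S1 -> R[i]^o} := F a b.
apply: (mo_gen (os_matrix_ordered S1)
  (Q := fun s => fl k l (os_st s) = Num.conj (fl l k s :> R[i]))) => [|a x y Ex Ey|{}s sp _].
- have st0 : os_st (0 : S1) = 0 := us_star0 (mo_unit_space (os_matrix_ordered S1)).
  by rewrite st0 !linear0 conj0.
- by rewrite os_st_linear !linfunD !linfunZ conjD conjM Ex Ey.
rewrite (pos1_star (os_matrix_ordered S1) sp).
have := @psd_mx_herm R n (\matrix_(a, b) F a b s) k l; rewrite !mxE; apply.
move=> v; have := mpos_quad v Fp sp; rewrite bdual_sumE; congr (_ <= _).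
apply: eq_bigr => a _; rewrite bdual_sumE; apply: eq_bigr => b _.
by rewrite bdualZE mxE.
Qed.

(** [F] is hermitian, so conjugating a relation at the adjoint of [s] gives the adjoint relation at
    [s]. This makes both the relations and their common solutions closed under adjoints. *)
Lemma relation_star n (F : 'M[bdual S1]_n) (c : 'M[R[i]]_n) : mpos n F ->
  \sum_k \sum_l c k l *: F k l = 0 -> \sum_k \sum_l (adjmx c) k l *: F k l = 0.
Proof.
move=> Fp c0.
apply: bop_ext => s.
have E : (\sum_k \sum_l c k l *: F k l : bdual S1) (os_st s) = 0 by rewrite c0.
transitivity (Num.conj ((\sum_k \sum_l c k l *: F k l : bdual S1) (os_st s))).
  rewrite !bdual_sum2E [RHS]conj_sum; under [RHS]eq_bigr do rewrite conj_sum.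
  rewrite [RHS]exchange_big; apply: eq_bigr => k _; apply: eq_bigr => l _.
  by rewrite dual_mpos_star// conjM conjCK !mxE.
by rewrite E conj0.
Qed.

(* The bilinear relations among the entries of [F] cut out a matrix system
   through which [F] factors. *)
Lemma matrix_system_local n (F : 'M[bdual S1]_n) : mpos n F -> unital F ->
  (forall (n : nat) (Q : msys R n) (phi : {linear S1 -> Q}), ucp phi ->
     exists2 phi' : {linear S2 -> Q}, ucp phi' & forall s, phi' (j s) = phi s) ->
  local_extension S12 F.
Proof.
move=> Fp F1 ext.
pose Qset : set (Mn R n) := [set M | forall c : 'M[R[i]]_n,
  \sum_k \sum_l c k l *: F k l = 0 -> \sum_k \sum_l c k l * M k l = 0].
have Q0 : Qset 0.
  by move=> c _; rewrite big1// => k _; rewrite big1// => l _; rewrite mxE mulr0.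
have QD x y : Qset x -> Qset y -> Qset (x + y).
  move=> Qx Qy c c0.
  transitivity (\sum_k \sum_l c k l * x k l + \sum_k \sum_l c k l * y k l).
    rewrite -big_split; apply: eq_bigr => k _; rewrite -big_split; apply: eq_bigr => l _ /=.
    by rewrite mxE mulrDr.
  by rewrite Qx// Qy// addr0.
have QZ a x : Qset x -> Qset (a *: x).
  move=> Qx c c0; transitivity (a * \sum_k \sum_l c k l * x k l); last by rewrite Qx// mulr0.
  rewrite mulr_sumr; apply: eq_bigr => k _; rewrite mulr_sumr; apply: eq_bigr => l _.
  by rewrite mxE mulrCA.
have QF s : Qset (\matrix_(k, l) F k l s).
  move=> c c0.
  have E : (\sum_k \sum_l c k l *: F k l : bdual S1) s = 0 by rewrite c0.
  rewrite bdual_sum2E in E; rewrite -[RHS]E.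
  by apply: eq_bigr => k _; apply: eq_bigr => l _; rewrite mxE.
(* Here unitality enters: the unit is the value of [F] at 1. *)
have Q1 : Qset munit.
  have := QF munit; congr (Qset _); apply/matrixP => k l; rewrite !mxE F1.
  by case: eqVneq.
pose Qs : linsub (Mn R n) := @LinSub _ (Mn R n) Qset Q0 QD QZ.
have Qst : star_closed Qs.
  move=> x Qx c c0; have h := relation_star Fp c0.
  have h2 := Qx _ h; rewrite -[RHS](conj0 R) -[X in _ = Num.conj X]h2 [RHS]conj_sum.
  under [RHS]eq_bigr do rewrite conj_sum.
  rewrite [RHS]exchange_big; apply: eq_bigr => k _; apply: eq_bigr => l _.
  by rewrite conjM !mxE conjCK.
pose Q : msys R n := @MSys R n Qs Q1 Qst.
have plin : linear (fun s => mksub (A := Q) (QF s) : Q).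
  by move=> a x y; apply: val_inj; apply/matrixP => k l; rewrite !mxE linearP.
have [phi phiE] := mk_linear_map plin.
have philin : linear (fun s : S1 => \matrix_(k, l) F k l s : Mn R n).
  by move=> a x y; apply/matrixP => k l; rewrite !mxE linearP.
have phiucp : ucp phi.
  split=> [m A Ap|]; last first.
    rewrite phiE; apply: val_inj; apply/matrixP => k l.
    by rewrite !mxE F1; case: eqVneq.
  have /(_ m A Ap) : cp (fun s : S1 => \matrix_(k, l) F k l s : Mn R n).
    apply/(cp_mxP k1 philin) => B Bp; have /(dual_mposP k1)/(_ _ Bp) := Fp.
    by congr (_ <= _); apply: eq_bigr => k _; apply: eq_bigr => l _; rewrite !mxE.
  by rewrite ms_mposE; congr (mpos _ _); apply/matrixP => k l; rewrite !mxE phiE.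
have [phi' [phi'cp _] phi'j] := ext _ _ _ phiucp.
pose v (x : Q) : Mn R n := sub_val x.
have vlin : linear (fun t => v (phi' t)) by move=> a x y; rewrite linearP.
have vcp : cp (fun t => v (phi' t)).
  move=> m A Ap; have := phi'cp m A Ap; rewrite ms_mposE; congr (mpos _ _).
  by apply/matrixP => k l; rewrite !mxE.
have [G Gp GE] := cp_entries vlin vcp.
exists G; split=> // [k l s|c c0].
  by rewrite GE phi'j phiE /v /= mxE.
apply: bop_ext => t; rewrite bdual_sum2E; apply: etrans (subP (phi' t) c c0).
by apply: eq_bigr => k _; apply: eq_bigr => l _; rewrite GE.
Qed.
End Unital.

(** * The maximal tensor product *)

Section TensorStar.
Variables (R : realType) (V W : lmodType R[i]) (sV : V -> V) (sW : W -> W).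
Hypotheses (sVl : forall a x y, sV (a *: x + y) = Num.conj a *: sV x + sV y)
  (sWl : forall a x y, sW (a *: x + y) = Num.conj a *: sW x + sW y)
  (sVK : involutive sV) (sWK : involutive sW).

(** Tensors being functionals on bilinear forms, their involution is defined by duality from an
    involution of forms. *)
Lemma bilin_star_exists (B : bilin V W) :
  exists B' : bilin V W, forall v w, B' v w = Num.conj (B (sV v) (sW w)).
Proof.
apply: mk_bilin => [w a x y|v a x y] /=.
  rewrite sVl linearPl conjD -[Num.conj a *: _]/(Num.conj a * _) conjM conjCK.
  by [].
rewrite sWl linearPr conjD -[Num.conj a *: _]/(Num.conj a * _) conjM conjCK.
by [].
Qed.

Definition bilin_star B := projT1 (cid (bilin_star_exists B)).

Lemma bilin_starE B v w : bilin_star B v w = Num.conj (B (sV v) (sW w)).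
Proof. by rewrite /bilin_star; case: cid. Qed.

Lemma tens_star_exists (x : tens V W) :
  exists y : tens V W, forall B, tens_ev B y = Num.conj (tens_ev (bilin_star B) x).
Proof.
move: x; apply: tens_ind => [|a x y [x' Ex] [y' Ey]|v w].
- by exists 0 => B; rewrite !linear0 conj0.
- exists (Num.conj a *: x' + y') => B.
  rewrite !tens_ev_linear Ex Ey conjD -[a *: _]/(a * _) conjM.
  by [].
- by exists (tpure (sV v) (sW w)) => B; rewrite !tens_ev_pure bilin_starE conjCK.
Qed.

Definition tens_st x := projT1 (cid (tens_star_exists x)).

Lemma tens_stE x B : tens_ev B (tens_st x) = Num.conj (tens_ev (bilin_star B) x).
Proof. by rewrite /tens_st; case: cid. Qed.

Lemma tens_st_pure v w : tens_st (tpure v w) = tpure (sV v) (sW w).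
Proof. by apply: tens_ext => B; rewrite tens_stE !tens_ev_pure bilin_starE conjCK. Qed.

Lemma tens_st_linear a x y : tens_st (a *: x + y) = Num.conj a *: tens_st x + tens_st y.
Proof.
apply: tens_ext => B; rewrite tens_ev_linear !tens_stE tens_ev_linear conjD.
by rewrite -[a *: _]/(a * _) conjM.
Qed.

Lemma tens_st0 : tens_st 0 = 0.
Proof. by apply: tens_ext => B; rewrite tens_stE !linear0 conj0. Qed.

Lemma tens_stK : involutive tens_st.
Proof.
apply: tens_ind => [|a x y Ex Ey|v w].
- by rewrite !tens_st0.
- by rewrite !tens_st_linear Ex Ey conjCK.
- by rewrite !tens_st_pure sVK sWK.
Qed.

Lemma tens_st_sum I (r : seq I) (F : I -> tens V W) :
  tens_st (\sum_(i <- r) F i) = \sum_(i <- r) tens_st (F i).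
Proof.
elim/big_rec2: _ => [|i y x _ <-]; first exact: tens_st0.
by rewrite -[F i]scale1r tens_st_linear conj1 !scale1r.
Qed.
End TensorStar.

Section SchurMatrices.
Variables (R : realType) (S T : umconeType R) (sS : S -> S) (sT : T -> T).
Hypotheses (moS : matrix_ordered sS) (moT : matrix_ordered sT).
Let cS := mo_compr moS.
Let cT := mo_compr moT.
Let dS := mo_dsum moS.
Let dT := mo_dsum moT.
Variable n : nat.

Local Notation tmx := ('I_n -> 'I_n -> tens S T).

Definition schur_elt (I : finType) (A : I -> I -> S) (B : I * 'I_n -> I * 'I_n -> T) :
  tmx := fun k l => \sum_a \sum_b tpure (A a b) (B (a, k) (b, l)).

(* [Dmax n], with the scalar compression absorbed into the second factor. *)
Definition schur_mx : set tmx :=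
  [set x | exists (I : finType) (A : I -> I -> S) (B : I * 'I_n -> I * 'I_n -> T),
     [/\ posI A, posI B & x = schur_elt A B]].

Lemma posI_sum (M : Type) (r : seq M) (I : finType) (X : M -> I -> I -> T) :
  (forall m, posI (X m)) -> posI (fun i j => \sum_(m <- r) X m i j).
Proof.
move=> Xp; elim: r => [|m r IHr].
  by apply: eq_posI (posI_0 moT I) => i j; rewrite big_nil.
by apply: eq_posI (posI_add cT dT (Xp m) IHr) => i j; rewrite big_cons.
Qed.

Lemma posI_diag (I : finType) (b : I -> T) : (forall i, pos1 (b i)) ->
  posI (fun i j => if i == j then b i else 0).
Proof.
move=> bp.
have := @posI_sum _ (index_enum I) I (fun m i j =>
  (Num.conj ((i == m)%:R : R[i]) * (j == m)%:R) *: b m)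
  (fun m => pos1_outer cT (fun i => (i == m)%:R) (bp m)).
apply: eq_posI => i j; rewrite (bigD1 i)//= eqxx conj1 mul1r big1 ?addr0.
  by rewrite eq_sym; case: eqVneq; rewrite ?scale1r ?scale0r.
by move=> m mi; rewrite eq_sym (negbTE mi) conj0 mul0r scale0r.
Qed.

Lemma schur_mx_I (I : finType) (A : I -> I -> S) (B : I * 'I_n -> I * 'I_n -> T) :
  posI A -> posI B -> schur_mx (schur_elt A B).
Proof. by move=> Ap Bp; exists I, A, B. Qed.

Lemma schur_mx_outer (a : S) (B : 'I_n -> 'I_n -> T) : pos1 a -> posI B ->
  schur_mx (fun k l => tpure a (B k l)).
Proof.
move=> /(pos1_posI cS) ap Bp.
have Bp' : posI (fun u v : 'I_1 * 'I_n => B u.2 v.2) by exact: (posI_reindex cT snd Bp).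
have := schur_mx_I ap Bp'; congr (schur_mx _); apply/funext => k; apply/funext => l.
by rewrite /schur_elt !big_ord1.
Qed.

Lemma schur_mx_cone : @convex_cone R tmx schur_mx.
Proof.
split.
- have := schur_mx_outer (pos1_0 moS) (posI_0 moT 'I_n); congr (schur_mx _).
  by apply/funext => k; apply/funext => l; rewrite ?fctE tpure0l.
- move=> _ _ [I [A [B [Ap Bp ->]]]] [J [A' [B' [Ap' Bp' ->]]]].
  pose f (u : (I + J) * 'I_n) : I * 'I_n + J * 'I_n :=
    match u.1 with inl i => inl (i, u.2) | inr i => inr (i, u.2) end.
  have := schur_mx_I (posI_dsum cS dS Ap Ap') (posI_reindex cT f (posI_dsum cT dT Bp Bp')).
  congr (schur_mx _); apply/funext => k; apply/funext => l; rewrite /schur_elt big_sumType/=.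
  congr (_ + _); apply: eq_bigr => i _; rewrite big_sumType/=.
    by rewrite [X in _ + X]big1 ?addr0// => i' _; rewrite tpure0l.
  by rewrite [X in X + _]big1 ?add0r// => i' _; rewrite tpure0l.
- move=> a _ a0 [I [A [B [Ap Bp ->]]]].
  have := schur_mx_I (posI_scale cS a0 Ap) Bp; congr (schur_mx _).
  apply/funext => k; apply/funext => l; rewrite /schur_elt [RHS]scaler_sumr; apply: eq_bigr => i _.
  by rewrite scaler_sumr; apply: eq_bigr => i' _; rewrite tpureZl.
Qed.

Definition mx_at (k l : 'I_n) (z : tens S T) : tmx :=
  fun i j => ((i == k)%:R * (j == l)%:R : R[i]) *: z.

Lemma mx_at_lin k l : linear (mx_at k l).
Proof.
move=> c x y; apply/funext => i; apply/funext => j.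
rewrite -[RHS]/(c *: mx_at k l x i j + mx_at k l y i j) /mx_at scalerDr !scalerA.
by rewrite [_ * c]mulrC.
Qed.

Lemma mx_at0 k l : mx_at k l 0 = 0.
Proof. by apply/funext => i; apply/funext => j; rewrite /mx_at scaler0. Qed.

Lemma mx_at_sum (X : tmx) : X = \sum_k \sum_l mx_at k l (X k l).
Proof.
apply/funext => i; apply/funext => j; rewrite !fct_sumE.
rewrite (bigD1 i)//= [X in _ + X]big1 ?addr0.
  rewrite !fct_sumE (bigD1 j)//= big1 ?addr0; first by rewrite /mx_at !eqxx mulr1 scale1r.
  by move=> l lj; rewrite /mx_at [j == l]eq_sym (negbTE lj) mulr0 scale0r.
move=> k ki; rewrite !fct_sumE big1// => l _.
by rewrite /mx_at [i == k]eq_sym (negbTE ki) mul0r scale0r.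
Qed.

Definition schur_unit : tmx := fun k l => if k == l then tpure munit munit else 0.

Definition schur_st (X : tmx) : tmx :=
  fun k l => tens_st (mo_linear moS) (mo_linear moT) (X l k).

Lemma schur_st_elt I A B : @posI R S I A -> posI B -> schur_st (schur_elt A B) = schur_elt A B.
Proof.
move=> Ap Bp; apply/funext => k; apply/funext => l; rewrite /schur_st /schur_elt tens_st_sum.
under eq_bigr do rewrite tens_st_sum.
rewrite exchange_big; apply: eq_bigr => i _; apply: eq_bigr => i' _.
rewrite tens_st_pure; [|exact: mo_starK..].
by rewrite (posI_star moS _ _ Ap) (posI_star moT _ _ Bp).
Qed.

(** Domination by the unit is the substantial part. By polarization, matrices over the tensor
    product are spanned by [a (x) q], with [a], [b] positive and dominated by [t], [s], and [q] the
    rank-one matrix of [e_k + c e_l] multiplied by [b]. *)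
Lemma schur_unit_space : @unit_space R tmx schur_mx schur_unit schur_st.
Proof.
have S1 := mo_unit moS; have T1 := mo_unit moT.
have e_in : schur_mx schur_unit.
  have := schur_mx_outer S1 (posI_diag (fun _ : 'I_n => T1)); congr (schur_mx _).
  by apply/funext => k; apply/funext => l; rewrite /schur_unit; case: eqVneq => _; rewrite ?tpure0r.
split.
- by move=> a X Y; apply/funext => k; apply/funext => l; exact: tens_st_linear.
- move=> X; apply/funext => k; apply/funext => l; rewrite /schur_st tens_stK//; exact: mo_starK.
- exact: schur_mx_cone.
- by move=> _ [I [A [B [Ap Bp ->]]]]; exact: schur_st_elt.
- exact: e_in.
pose q (k l : 'I_n) (c : R[i]) (b : T) (i i' : 'I_n) : T :=
  (Num.conj ((i == k)%:R + c * (i == l)%:R) * ((i' == k)%:R + c * (i' == l)%:R)) *: b.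
have qp k l c b : pos1 b -> posI (q k l c b) by exact: (pos1_outer cT (fun i => (i == k)%:R + c * (i == l)%:R)).
apply: (@order_unit_gen R tmx schur_mx schur_unit
  [set X | exists k l c a b, [/\ Num.conj c * c = 1,
    pos1 a /\ (exists2 t : R, 0 <= t & pos1 (t%:C *: munit - a)),
    pos1 b /\ (exists2 t : R, 0 <= t & pos1 (t%:C *: munit - b)) &
    X = fun i j => tpure a (q k l c b i j)]] schur_mx_cone).
- move=> _ [k [l [c [a [b [cc [ap [t t0 at']] [bp [s s0 bs]] ->]]]]]].
  split; first by apply: schur_mx_outer => //; exact: qp.
  (* The chain is [a (x) q_c <= t 1 (x) q_c <= 4 t 1 (x) b I <= 4 t s], and [X1], [X2], [X3] are its
     differences up to scalars. For the middle one, the values for [c] and [- c] add up to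
     [2 b (P_k + P_l) <= 4 b I], where [P_k] is the diagonal matrix unit at [k]. *)
  exists (4 * (t * s)).
  have cN : Num.conj (- c) * (- c) = 1 by rewrite conjN mulrNN.
  pose del (P : pred 'I_n) (z : T) (i j : 'I_n) : T := if i == j then (if P i then z else 0) else 0.
  have delp P z : pos1 z -> posI (del P z).
    by move=> zp; apply: posI_diag => i; case: (P i) => //; exact: (pos1_0 moT).
  have X1 := schur_mx_outer at' (qp k l c b bp).
  have two0 : 0 <= (2 : R) by [].
  have X2 := schur_mx_outer S1 (posI_add cT dT (posI_add cT dT
     (posI_scale cT two0 (delp (fun i => i != k) _ bp))
     (posI_scale cT two0 (delp (fun i => i != l) _ bp))) (qp k l (- c) b bp)).
  have X3 := schur_mx_outer S1 (delp predT _ bs).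
  have t4 : 0 <= 4 * t by rewrite mulr_ge0.
  have := coneD schur_mx_cone X1 (coneD schur_mx_cone (coneZ schur_mx_cone t0 X2)
    (coneZ schur_mx_cone t4 X3)).
  congr (schur_mx _); apply/funext => i; apply/funext => j.
  have E : 2%:C *: del (fun i0 => i0 != k) b i j + 2%:C *: del (fun i0 => i0 != l) b i j
      + q k l (- c) b i j = (if i == j then 4%:C *: b else 0) - q k l c b i j.
    apply/eqP; rewrite eq_sym subr_eq -!addrA; apply/eqP; rewrite /q -scalerDl.
    have n4 : (4 : R)%:C = 4 :> R[i] by rewrite rmorph_nat.
    have n2 : (2 : R)%:C = 2 :> R[i] by rewrite rmorph_nat.
    have nb (x : bool) : Num.conj (x%:R : R[i]) = x%:R by rewrite rmorph_nat.
    set x := (_ + _ : R[i]).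
    have -> : x = 2 * ((i == k)%:R * (j == k)%:R) + 2 * ((i == l)%:R * (j == l)%:R).
      rewrite /x !conjD !conjM !nb conjN.
      transitivity (2 * ((i == k)%:R * (j == k)%:R) +
        2 * (Num.conj c * c) * ((i == l)%:R * (j == l)%:R) : R[i]); first by ring.
      by rewrite cc mulr1.
    rewrite /del n4 n2; have [<-|ij] := eqVneq i j.
      case: (i == k); case: (i == l); rewrite /= ?scaler0 ?add0r -?scalerDl -?scalerDl; congr (_ *: _); ring.
    have ne m : (i == m)%:R * (j == m)%:R = 0 :> R[i].
      by case: (eqVneq i m) => [im|_]; rewrite ?mul0r// -im eq_sym (negbTE ij) mulr0.
    by rewrite !ne !mulr0 !scaler0 addr0 scale0r !addr0.
  rewrite -[LHS]/(tpure (t%:C *: munit - a) (q k l c b i j) + (t%:C *: tpure munit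
    (2%:C *: del (fun i0 => i0 != k) b i j + 2%:C *: del (fun i0 => i0 != l) b i j
      + q k l (- c) b i j) + (4 * t)%:C *: tpure munit (del predT (s%:C *: munit - b) i j))) E.
  rewrite -[RHS]/((4 * (t * s))%:C *: schur_unit i j - tpure a (q k l c b i j)).
  rewrite tpureBl tpureZl tpureBr scalerBr /schur_unit /del /=.
  have R4 : (4 * (t * s))%:C = 4 * t%:C * s%:C :> R[i] by rewrite !realcM rmorph_nat mulrA.
  have R4' : (4 * t)%:C = 4 * t%:C :> R[i] by rewrite realcM rmorph_nat.
  have n4 : (4 : R)%:C = 4 :> R[i] by rewrite rmorph_nat.
  rewrite R4 R4' n4; set u := tpure munit (q _ _ _ _ _ _); set w := tpure a _.
  have [_|_] := eqVneq i j.
    rewrite tpureZr tpureBr tpureZr; set y := tpure munit b; set z := tpure munit munit.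
    rewrite !scalerBr !scalerA [t%:C * 4]mulrC.
    set X := (4 * t%:C) *: y; set Z := _ *: z; set tu := t%:C *: u.
    have -> : X - tu + (Z - X) = Z - tu by rewrite addrC addrA subrK.
    by rewrite addrC addrA subrK.
  by rewrite !tpure0r !scaler0 addr0 !sub0r addrAC subrr add0r.
move=> Q Q0 QL QG.
have QZ c z : Q z -> Q (c *: z) by move=> Qz; rewrite -[_ *: z]addr0; apply: (QL).
have QD z w : Q z -> Q w -> Q (z + w) by move=> Qz Qw; rewrite -[z]scale1r; apply: (QL).
have Qat k l z : Q (mx_at k l z).
  apply: (tens_ind (Q := fun z => Q (mx_at k l z))) z => [|c x y Qx Qy|a b].
  - by rewrite mx_at0.
  - by rewrite mx_at_lin; apply: (QL).
  apply: (mo_gen moS (Q := fun a => Q (mx_at k l (tpure a b)))) a => [|c x y Qx Qy|a ap ad].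
  - by rewrite tpure0l mx_at0.
  - by rewrite tpure_linl mx_at_lin; apply: (QL).
  apply: (mo_gen moT (Q := fun b => Q (mx_at k l (tpure a b)))) b => [|c x y Qx Qy|b bp bd].
  - by rewrite tpure0r mx_at0.
  - by rewrite tpure_linr mx_at_lin; apply: (QL).
  apply: (@polarization2 R tmx (mx_at k k (tpure a b)) (mx_at l l (tpure a b)) _ (mx_at l k (tpure a b))) => //.
  move=> c cc; apply: QG; exists k, l, c, a, b; split=> //.
  apply/funext => i; apply/funext => j; rewrite /q tpureZr.
  rewrite -[LHS]/(mx_at k k (tpure a b) i j + mx_at l l (tpure a b) i j +
    (c *: mx_at k l (tpure a b) i j + Num.conj c *: mx_at l k (tpure a b) i j)).
  rewrite /mx_at !scalerA -!scalerDl; congr (_ *: _).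
  have nb (x : bool) : Num.conj (x%:R : R[i]) = x%:R by rewrite rmorph_nat.
  rewrite conjD conjM !nb.
  transitivity ((i == k)%:R * (j == k)%:R + (Num.conj c * c) * ((i == l)%:R * (j == l)%:R) +
    (c * ((i == k)%:R * (j == l)%:R) + Num.conj c * ((i == l)%:R * (j == k)%:R)) : R[i]).
    by rewrite cc mul1r.
  ring.
move=> X; rewrite (mx_at_sum X).
elim/big_rec: _ => // k Y _ QY; apply: (QD) => //.
by elim/big_rec: _ => // l Z _ QZ'; apply: (QD).
Qed.
End SchurMatrices.

Section MaxTensorCone.
Variables (R : realType) (S T : umconeType R) (sS : S -> S) (sT : T -> T).
Hypotheses (moS : matrix_ordered sS) (moT : matrix_ordered sT).
Let cS := mo_compr moS.
Let cT := mo_compr moT.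

Lemma sum_mxtens (V : nmodType) p q (F : 'I_(p * q) -> V) :
  \sum_u F u = \sum_a \sum_b F (mxtens_index (a, b)).
Proof.
rewrite pair_bigA/= (reindex (@mxtens_index p q))/=; first by apply: eq_bigr => -[].
by exists (@mxtens_unindex p q) => u _; rewrite ?mxtens_indexK ?mxtens_unindexK.
Qed.

Lemma Dmax_schur n (x : 'M[tmax S T]_n) : Dmax x <-> schur_mx (fun k l => x k l).
Proof.
split=> [[p [q [A [B [X [Ap Bp ->]]]]]]|[I [A [B [Ap Bp xE]]]]].
  have := schur_mx_I (proj2 (posI_ord cS A) Ap)
    (posI_compr cT (fun b (u : 'I_p * 'I_n) => X (mxtens_index (u.1, b)) u.2) (proj2 (posI_ord cT B) Bp)).
  congr (schur_mx _); apply/funext => k; apply/funext => l; rewrite mxE /schur_elt sum_mxtens.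
  apply: eq_bigr => a _.
  under [RHS]eq_bigr do rewrite sum_mxtens.
  rewrite exchange_big; apply: eq_bigr => a' _.
  rewrite /comprI tpure_sumr; apply: eq_bigr => b _; rewrite tpure_sumr; apply: eq_bigr => b' _.
  by rewrite tpureZr !mxE !mxtens_indexK.
(* The scalar matrix selects from the Kronecker product the rows indexed by [a] together with
   [(a, k)]. *)
exists #|I|, #|{: I * 'I_n}|, (\matrix_(a, b) A (enum_val a) (enum_val b)),
  (\matrix_(a, b) B (enum_val a) (enum_val b)),
  (\matrix_(u, k) (enum_val (mxtens_unindex u).2 == (enum_val (mxtens_unindex u).1, k))%:R).
split=> //; apply/matrixP => k l; rewrite mxE sum_mxtens.
have -> := congr1 (fun f => f k l) xE.
rewrite /schur_elt reindex_enum_val; apply: eq_bigr => a _.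
under [RHS]eq_bigr do rewrite sum_mxtens.
rewrite exchange_big reindex_enum_val; apply: eq_bigr => a' _.
rewrite -[B _ _](sum_delta2 B) [X in tpure _ X]reindex_enum_val tpure_sumr; apply: eq_bigr => b _.
rewrite [X in tpure _ X]reindex_enum_val tpure_sumr; apply: eq_bigr => b' _.
by rewrite tpureZr !mxE !mxtens_indexK.
Qed.

Lemma tmax_mposP n (x : 'M[tmax S T]_n) : mpos n x <->
  forall e : R, 0 < e -> schur_mx ((fun k l => x k l : tens S T) + e%:C *: schur_unit S T (n := n)).
Proof.
have E (e : R) : (fun k l => (x + (e%:C *: (tpure munit munit : tmax S T))%:M) k l : tens S T) =
    (fun k l => x k l : tens S T) + e%:C *: schur_unit S T (n := n).
  apply/funext => k; apply/funext => l; rewrite !mxE.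
  rewrite -[RHS]/((x k l : tens S T) + e%:C *: schur_unit S T k l) /schur_unit.
  by case: eqVneq; rewrite ?mulr1n ?mulr0n ?scaler0.
by split=> xp e /xp; [move=> /Dmax_schur|move=> xe; apply/Dmax_schur]; rewrite E.
Qed.
End MaxTensorCone.

Lemma cp_posI (R : realType) (V W : mconeType R) (f : V -> W) (I : finType) (A : I -> I -> V) :
  cp f -> posI A -> posI (fun i j => f (A i j)).
Proof.
move=> fcp /fcp; rewrite /posI; congr (mpos _ _).
by apply/matrixP => i j; rewrite !mxE.
Qed.

Lemma ge0_shift (R : realType) (z u : R[i]) : 0 <= u ->
  (forall e : R, 0 < e -> 0 <= z + e%:C * u) -> 0 <= z.
Proof.
move=> /ge0_realc[a -> a0] zp.
have [b bE _] := ge0_realc (zp 1 ltr01).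
have {bE} zE : z = (b - a)%:C.
  by rewrite realcB -bE realc1 mul1r addrK.
move: zp; rewrite {}zE => zp; rewrite -realc0 lecR; set c := b - a in zp *.
apply/ler_addgt0Pr => e e0.
have d0 : 0 < e / (a + 1) by rewrite divr_gt0// ltr_wpDl.
have := zp _ d0; rewrite -realcM -realcD -realc0 lecR => /le_trans; apply.
rewrite lerD2l -mulrA ler_piMr ?(ltW e0)// mulrC ler_pdivrMr ?ltr_wpDl// mul1r.
by rewrite lerDl.
Qed.

(* The hypothesis is an equation so that unification never has to match the
   nested function-space structures of a concrete [V]. *)
Lemma linfun_sum2 (R : realType) (V : lmodType R[i]) (f : {linear V -> R[i]^o}) (I : finType)
    (F : I -> I -> V) X : X = \sum_k \sum_l F k l -> f X = \sum_k \sum_l (f (F k l) : R[i]).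
Proof. by move=> ->; rewrite linfun_sum; apply: eq_bigr => k _; rewrite linfun_sum. Qed.

(** * Functionals on matrices over a maximal tensor product *)

Section DualToTensor.
Variables (R : realType) (H : hilbertType R) (S1 S2 : opsys H).
Hypothesis S12 : forall T : BH H, os_space S1 T -> os_space S2 T.
Let j : {linear S1 -> S2} := os_incl S12.
Let k1 := @os_compressible _ _ S1.
Let k2 := @os_compressible _ _ S2.
Variables (T : umconeType R) (sT : T -> T).
Hypotheses (moT : matrix_ordered sT).
Let cT := mo_compr moT.
Variable n : nat.

Local Notation tmx S := ('I_n -> 'I_n -> tens S T).

Definition tmx_map (X : tmx S1) : tmx S2 := fun k l => tens_map j (X k l).

Lemma schur_mx_map X : schur_mx X -> schur_mx (tmx_map X).
Proof.
move=> [I [A [B [Ap Bp ->]]]].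
have jcp : cp j by move=> m Y /(os_incl_mpos S12).
have := schur_mx_I (cp_posI jcp Ap) Bp; congr (schur_mx _); apply/funext => k; apply/funext => l.
rewrite /schur_elt /tmx_map linear_sum; apply: eq_bigr => a _.
by rewrite linear_sum; apply: eq_bigr => b _; exact: (esym (tens_map_tensor j _ _)).
Qed.

(** A functional on matrices over the tensor product is a matrix of bilinear forms [b], and each
    [b _ t] is a functional on [S1], to which [P] is applied. At a Schur element with factors [A]
    and [B] the value is the pairing of [A] with a matrix [G] of functionals built from [B], and [P]
    preserves the positivity of [G]. *)
Lemma dual_extension_functional (f : {linear tmx S1 -> R[i]^o}) : dual_extension S12 ->
  (forall X, schur_mx X -> 0 <= f X) ->
  exists2 g : tmx S2 -> R[i], (forall X, g (tmx_map X) = f X) & forall Y, schur_mx Y -> 0 <= g Y.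
Proof.
move=> [P Pcp Pj] fp.
have [b bE] : exists b : 'I_n * 'I_n -> bilin S1 T, forall u z,
    f (mx_at u.1 u.2 z) = tens_ev (b u) z.
  suff /choice[b bE] : forall u : 'I_n * 'I_n, exists b : bilin S1 T, forall z,
      f (mx_at u.1 u.2 z) = tens_ev b z by exists b.
  move=> u.
  have [|g gE] := @mk_linear R (tens S1 T) (fun z => f (mx_at u.1 u.2 z)).
    by move=> a x y; rewrite mx_at_lin linearP.
  by have [B [_ BE]] := bilin_of_functional g; exists B => z; rewrite -gE BE.
have fE (X : tmx S1) : f X = \sum_k \sum_l (tens_ev (b (k, l)) (X k l) : R[i]).
  have -> := @linfun_sum2 _ _ f 'I_n (fun k l => mx_at k l (X k l)) X (mx_at_sum X).
  by apply: eq_bigr => k _; apply: eq_bigr => l _; exact: (bE (k, l)).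
have /choice[c cE] : forall t : T, exists c : 'I_n * 'I_n -> bdual S1, forall u s, c u s = b u s t.
  apply: (mo_gen moT) => [|a x y [c cE] [d dE]|t tp _].
  - by exists (fun _ => 0) => u s; rewrite linear0r.
  - exists (fun u => a *: c u + d u) => u s.
    by rewrite bdualDE bdualZE cE dE linearPr.
  have /choice[F FE] : forall u : 'I_n * 'I_n, exists F : {linear S1 -> R[i]^o}, forall s, F s = b u s t.
    by move=> u; apply: mk_linear => a x y; rewrite linearPl.
  have Fp A : posI A -> 0 <= \sum_k \sum_l (F (k, l) (A k l) : R[i]).
    move=> Ap.
    (* The rank-one matrix of the vector [sum_k e_k (x) e_k], multiplied by [t], makes [schur_elt]
       the matrix with entries [A k l (x) t]. *)
    have := fp _ (schur_mx_I Ap (pos1_outer cT (fun u : 'I_n * 'I_n => (u.1 == u.2)%:R) tp)).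
    rewrite fE; congr (_ <= _); apply: eq_bigr => k _; apply: eq_bigr => l _.
    rewrite /schur_elt FE -tens_ev_pure; congr (tens_ev _ _).
    rewrite -[in RHS](sum_delta2 A k l) tpure_suml; apply: eq_bigr => a _.
    by rewrite tpure_suml; apply: eq_bigr => a' _; rewrite tpureZl tpureZr.
  have Fb := @pos_bilinear_bounded _ _ _ _ (fun k l => F (k, l)) Fp.
  have Fb' u : bounded_linear (F u) by case: u => k l; exact: Fb.
  by exists (fun u => mkbop (Fb' u)) => u s; exact: FE.
have [b' b'E] : exists b' : 'I_n * 'I_n -> bilin S2 T, forall u s t, b' u s t = (P (c t u) : bdual S2) s.
  suff /choice[b' b'E] : forall u : 'I_n * 'I_n, exists b' : bilin S2 T, forall s t, b' s t = (P (c t u) : bdual S2) s by exists b'.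
  move=> u; apply: mk_bilin => [t|s] a x y; first exact: linearP.
  have -> : c (a *: x + y) u = a *: c x u + c y u.
    by apply: bop_ext => s'; rewrite bdualDE bdualZE !cE linearPr.
  by rewrite linearP.
exists (fun Y => \sum_k \sum_l (tens_ev (b' (k, l)) (Y k l) : R[i])) => [X|_ [I [A [B [Ap Bp ->]]]]].
  rewrite fE; apply: eq_bigr => k _; apply: eq_bigr => l _; apply: tens_ev_map => s t.
  by rewrite b'E Pj cE.
pose G a a' : bdual S1 := \sum_k \sum_l c (B (a, k) (a', l)) (k, l).
have Gp : posI G.
  apply/(dual_posIP k1) => A' A'p; have := fp _ (schur_mx_I A'p Bp).
  rewrite fE; congr (_ <= _).
  rewrite [RHS](_ : _ = \sum_a \sum_a' \sum_k \sum_l (b (k, l) (A' a a') (B (a, k) (a', l)) : R[i])).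
    rewrite [RHS](_ : _ = \sum_k \sum_l \sum_a \sum_a' (b (k, l) (A' a a') (B (a, k) (a', l)) : R[i])).
      apply: eq_bigr => k _; apply: eq_bigr => l _; rewrite linfun_sum; apply: eq_bigr => a _.
      by rewrite linfun_sum.
    under eq_bigr do rewrite exchange_big; rewrite exchange_big.
    apply: eq_bigr => k _; under eq_bigr do rewrite exchange_big; rewrite exchange_big.
    by [].
  apply: eq_bigr => a _; apply: eq_bigr => a' _; rewrite bdual_sumE; apply: eq_bigr => k _.
  by rewrite bdual_sumE; apply: eq_bigr => l _; rewrite cE.
have := proj1 (dual_posIP k2 _) (cp_posI Pcp Gp) A Ap; congr (_ <= _).
rewrite [LHS](_ : _ = \sum_a \sum_a' \sum_k \sum_l (b' (k, l) (A a a') (B (a, k) (a', l)) : R[i])).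
  rewrite [RHS](_ : _ = \sum_k \sum_l \sum_a \sum_a' (b' (k, l) (A a a') (B (a, k) (a', l)) : R[i])).
    under eq_bigr do rewrite exchange_big; rewrite exchange_big.
    apply: eq_bigr => k _; under eq_bigr do rewrite exchange_big; rewrite exchange_big.
    by [].
  apply: eq_bigr => k _; apply: eq_bigr => l _; rewrite linfun_sum; apply: eq_bigr => a _.
  by rewrite linfun_sum.
apply: eq_bigr => a _; apply: eq_bigr => a' _; rewrite linear_sum bdual_sumE; apply: eq_bigr => k _.
by rewrite linear_sum bdual_sumE; apply: eq_bigr => l _; rewrite b'E.
Qed.
End DualToTensor.

Section TensorEmbedding.
Variables (R : realType) (H : hilbertType R) (S1 S2 : opsys H).
Hypothesis S12 : forall T : BH H, os_space S1 T -> os_space S2 T.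
Let j : {linear S1 -> S2} := os_incl S12.
Variables (T : umconeType R) (sT : T -> T).
Hypotheses (moT : matrix_ordered sT).
Let mo1 := os_matrix_ordered S1.
Let mo2 := os_matrix_ordered S2.

Lemma tens_map_star x :
  tens_map j (tens_st (mo_linear mo1) (mo_linear moT) x) =
  tens_st (mo_linear mo2) (mo_linear moT) (tens_map j x).
Proof.
move: x; apply: tens_ind => [|a x y Ex Ey|v w].
- by rewrite tens_st0 linear0 tens_st0.
- by rewrite tens_st_linear !(tens_map_linear j) tens_st_linear Ex Ey.
rewrite tens_st_pure.
have E v' w' : tens_map j (tpure v' w') = tpure (j v') w' := tens_map_tensor j v' w'.
rewrite !E tens_st_pure.
congr (tpure _ _); apply: osq_ext => x y; rewrite os_stE.
by rewrite -[LHS]/(osq (os_st v) x y) os_stE.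
Qed.

(** Reflection of positivity is by duality: every positive functional on the smaller matrices
    extends to a positive one on the larger, so it is nonnegative at an element with positive image,
    and [us_separation] gives membership in the cone up to [e]. *)
Lemma dual_extension_tensor : dual_extension S12 ->
  complete_order_embedding (tmax_map j : tmax S1 T -> tmax S2 T).
Proof.
move=> de; have j_inj : injective j := @os_incl_inj _ _ _ _ S12.
have t_inj := @tens_map_inj R S1 S2 T j j_inj.
split; first exact t_inj.
have mapU n : tmx_map S12 (schur_unit S1 T (n := n)) = schur_unit S2 T (n := n).
  apply/funext => k; apply/funext => l; rewrite /tmx_map /schur_unit.
  case: (k == l); last by rewrite linear0.
  exact: (etrans (tens_map_tensor j munit munit) (congr1 (fun s => tpure s munit) (os_incl_unit S12))).
have mapE n (x : 'M[tmax S1 T]_n) e : (fun k l => map_mx (tmax_map j) x k l : tens S2 T) + e *: schur_unit S2 T (n := n)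
    = tmx_map S12 ((fun k l => x k l : tens S1 T) + e *: schur_unit S1 T (n := n)).
  rewrite -mapU; apply/funext => k; apply/funext => l.
  rewrite -[RHS]/(tens_map j ((x k l : tens S1 T) + e *: schur_unit S1 T k l)) linearD linearZ.
  rewrite -[LHS]/((map_mx (tmax_map j) x k l : tens S2 T) + e *: tens_map j (schur_unit S1 T k l)).
  by rewrite mxE.
move=> n x; split=> [/(tmax_mposP mo1 moT) xp|/(tmax_mposP mo2 moT) xp].
  apply/(tmax_mposP mo2 moT) => e /xp; rewrite mapE => h.
  exact: (schur_mx_map S12 h).
have Up m : schur_mx (schur_unit S1 T (n := m)) := us_unit (schur_unit_space mo1 moT m).
have us1 := schur_unit_space mo1 moT n; have us2 := schur_unit_space mo2 moT n.
apply/(tmax_mposP mo1 moT) => e e0.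
pose X : 'I_n -> 'I_n -> tens S1 T := fun k l => x k l.
have Xe d : 0 < d -> schur_mx (tmx_map S12 (X + d%:C *: schur_unit S1 T (n := n))).
  by move=> /xp; rewrite mapE.
have map_inj Y Z : tmx_map S12 (n := n) Y = tmx_map S12 Z -> Y = Z :> ('I_n -> 'I_n -> tens S1 T).
  move=> YZ; apply/funext => k; apply/funext => l; apply: t_inj.
  exact: (congr1 (fun f => f k l) YZ).
have map_st Y : tmx_map S12 (schur_st mo1 moT Y) = schur_st mo2 moT (tmx_map S12 Y) :> ('I_n -> 'I_n -> tens S2 T).
  by apply/funext => k; apply/funext => l; exact: tens_map_star.
have Xst : schur_st mo1 moT X = X.
  have : schur_st mo1 moT (X + 1%:C *: schur_unit S1 T (n := n)) = X + 1%:C *: schur_unit S1 T (n := n).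
    by apply: map_inj; rewrite map_st (us_herm us2)//; exact: (Xe _ ltr01).
  rewrite (us_starD us1) (us_starZ us1) conjR (us_herm us1 (Up n)).
  exact: addIr.
apply: (us_separation us1 Xst e0) => f fp.
have [g gf gp] := dual_extension_functional moT de fp.
apply: (@ge0_shift _ _ (f (schur_unit S1 T (n := n)))); first exact: (fp _ (Up n)).
move=> d d0; rewrite -linfunZ -linfunD -gf; exact: (gp _ (Xe _ d0)).
Qed.
End TensorEmbedding.

(** The Archimedean closure with respect to [e], which is how the cones of the maximal tensor
    product arise from [Dmax]. *)
Definition closed_cone (R : realType) (V : lmodType R[i]) (D : set V) (e : V) : set V :=
  [set x | forall d : R, 0 < d -> D (x + d%:C *: e)].

Lemma sub_closed_cone (R : realType) (V : lmodType R[i]) (D : set V) (e : V) :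
  convex_cone D -> D e -> D `<=` closed_cone D e.
Proof. by move=> cD De x Dx d d0; apply: (coneD cD) => //; apply: (coneZ cD) => //; exact: ltW. Qed.

Lemma unit_space_closure (R : realType) (V : lmodType R[i]) (D : set V) (e : V) st :
  unit_space D e st -> unit_space (closed_cone D e) e st.
Proof.
move=> us; have cD := us_cone us; have De := us_unit us.
have sD := sub_closed_cone cD De.
split.
- exact: us_linear us.
- exact: us_starK us.
- split; first exact: (sD _ (cone0 cD)).
  + move=> x y Dx Dy d d0; have d2 : 0 < d / 2 by rewrite divr_gt0.
    have := coneD cD (Dx _ d2) (Dy _ d2); rewrite addrACA -scalerDl -realcD.
    by rewrite -splitr.
  + move=> a x a0 Dx d d0; have [->|a1] := eqVneq a 0.
      by rewrite scale0r add0r; apply: (coneZ cD) => //; exact: ltW.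
    have a_gt0 : 0 < a by rewrite lt_def a1.
    have := coneZ cD a0 (Dx (d / a) (divr_gt0 d0 a_gt0)).
    by rewrite scalerDr scalerA -realcM mulrCA divff// mulr1.
- move=> x /(_ 1 ltr01) Dx; have := us_herm us Dx.
  by rewrite (us_starD us) (us_starZ us) conjR (us_herm us De); exact: addIr.
- exact: (sD _ De).
- move=> y; have [t [a [b [c [Da Db Dc E]]]]] := us_dom us y; exists t.
  by exists a, b, c; split=> //; exact: (sD).
Qed.

(** * Local extensions from tensor embeddings *)

Section TensorToLocal.
Variables (R : realType) (H : hilbertType R) (S1 S2 : opsys H).
Hypothesis S12 : forall T : BH H, os_space S1 T -> os_space S2 T.
Let j : {linear S1 -> S2} := os_incl S12.
Let k2 := @os_compressible _ _ S2.
Let mo1 := os_matrix_ordered S1.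
Let mo2 := os_matrix_ordered S2.

(* The bilinear form [b] extends [F] along the matrix units [e]; it extends to
   a positive functional on the larger tensor product, whose values at
   [s (x) e k l] are the required extensions. *)
Lemma tensor_local_extension n (F : 'M[bdual S1]_n) (T : umconeType R) (sT : T -> T)
    (e : 'M[T]_n) (b : bilin S1 T) :
  matrix_ordered sT ->
  order_embedding (tmax_map j : tmax S1 T -> tmax S2 T) ->
  mpos n e ->
  (forall c : 'M[R[i]]_n, \sum_k \sum_l c k l *: F k l = 0 -> \sum_k \sum_l c k l *: e k l = 0) ->
  (forall s k l, b s (e k l) = F k l s) ->
  (forall (I : finType) (A : I -> I -> S1) (B : I -> I -> T), posI A -> posI B ->
     0 <= \sum_a \sum_a' (b (A a a') (B a a') : R[i])) ->
  local_extension S12 F.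
Proof.
move=> moT [inj emb] ep erel be bp; have cT := mo_compr moT.
pose us1 := unit_space_closure (schur_unit_space mo1 moT 1).
pose us2 := unit_space_closure (schur_unit_space mo2 moT 1).
have [i iE] : exists i : {linear ('I_1 -> 'I_1 -> tens S1 T) -> ('I_1 -> 'I_1 -> tens S2 T)},
    forall X, i X = tmx_map S12 X.
  apply: mk_linear_map => a x y; apply/funext => k; apply/funext => l.
  exact: (tens_map_linear j a (x k l) (y k l)).
have [f fE] : exists f : {linear ('I_1 -> 'I_1 -> tens S1 T) -> R[i]^o},
    forall X, f X = tens_ev b (X ord0 ord0).
  by apply: mk_linear => a x y; exact: (tens_ev_linear b a (x ord0 ord0) (y ord0 ord0)).
have i1 : i (schur_unit S1 T (n := 1)) = schur_unit S2 T (n := 1).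
  rewrite iE; apply/funext => k; apply/funext => l; rewrite /tmx_map /schur_unit !ord1.
  exact: (etrans (tens_map_tensor j munit munit) (congr1 (fun s => tpure s munit) (os_incl_unit S12))).
have ist X : i (schur_st mo1 moT X) = schur_st mo2 moT (i X).
  by rewrite !iE; apply/funext => k; apply/funext => l; exact: tens_map_star.
have iD X : closed_cone (@schur_mx R S2 T 1) (schur_unit S2 T (n := 1)) (i X) ->
    closed_cone (@schur_mx R S1 T 1) (schur_unit S1 T (n := 1)) X.
  move=> Xp; pose x : tmax S1 T := X ord0 ord0.
  have E (S : opsys H) (Y : 'I_1 -> 'I_1 -> tens S T) : pos1 (Y ord0 ord0 : tmax S T) <->
      closed_cone (@schur_mx R S T 1) (schur_unit S T (n := 1)) Y.
    have YE : (fun k l : 'I_1 => const_mx (m := 1) (n := 1) (Y ord0 ord0) k l : tens S T) = Y.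
      by apply/funext => k; apply/funext => l; rewrite mxE !ord1.
    rewrite /pos1 (tmax_mposP (os_matrix_ordered S) moT) YE.
    by [].
  by apply/E/emb; have /E := Xp; rewrite iE.
have fpos X : schur_mx X -> 0 <= f X.
  move=> [I [A [B [Ap Bp ->]]]]; rewrite fE.
  have := bp _ _ _ Ap (posI_reindex cT (fun a => (a, ord0)) Bp).
  congr (_ <= _); rewrite linfun_sum; apply: eq_bigr => a _.
  by rewrite linfun_sum.
have fpos' X : closed_cone (@schur_mx R S1 T 1) (schur_unit S1 T (n := 1)) X -> 0 <= f X.
  move=> Xp; apply: (@ge0_shift _ _ (f (schur_unit S1 T (n := 1)))).
    by apply: fpos; exact: us_unit (schur_unit_space mo1 moT 1).
  by move=> d d0; rewrite -linfunZ -linfunD; apply: fpos; exact: (Xp _ d0).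
have [g gi gp] := us_extension us1 us2 i1 ist iD fpos'.
have us2' := schur_unit_space mo2 moT 1.
have gpos X : schur_mx X -> 0 <= g X.
  by move=> /(sub_closed_cone (us_cone us2') (us_unit us2')); exact: gp.
pose h k l (s : S2) : R[i]^o := g (fun _ _ => tpure s (e k l)).
have hlin k l : linear (h k l).
  move=> a x y; rewrite /h -[RHS]linearP; congr (g _).
  by apply/funext => u; apply/funext => v; exact: tpure_linl.
pose h1 k l := projT1 (cid (mk_linear (hlin k l))).
have h1E k l s : h1 k l s = h k l s by rewrite /h1; case: cid.
have hpos A : posI A -> 0 <= \sum_k \sum_l (h1 k l (A k l) : R[i]).
  move=> Ap.
  have ep' : posI (fun u v : 'I_n * 'I_1 => e u.1 v.1).
    exact: (posI_reindex cT fst ((posI_ord cT e).2 ep)).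
  have := gpos _ (schur_mx_I Ap ep').
  rewrite (@linfun_sum2 _ _ g _ (fun k l _ _ => tpure (A k l) (e k l))); last first.
    apply/funext => u; apply/funext => v; rewrite /schur_elt !fct_sumE; apply: eq_bigr => k _.
    by rewrite !fct_sumE.
  by congr (_ <= _); apply: eq_bigr => k _; apply: eq_bigr => l _; rewrite h1E.
have hb := pos_bilinear_bounded hpos.
pose G : 'M[bdual S2]_n := \matrix_(k, l) mkbop (hb k l).
have GE k l s : (G k l : bdual S2) s = h k l s by rewrite mxE -h1E.
exists G; split.
- apply/(dual_mposP k2) => A /(posI_ord k2)/hpos; congr (_ <= _).
  by apply: eq_bigr => k _; apply: eq_bigr => l _; rewrite GE h1E.
- move=> k l s; rewrite GE -be -tens_ev_pure.
  rewrite -(fE (fun _ _ => tpure s (e k l))) -gi iE /h; congr (g _).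
  by apply/funext => u; apply/funext => v; exact: (esym (tens_map_tensor j _ _)).
move=> c c0; apply: bop_ext => s; rewrite bdual_sum2E.
transitivity (g (fun _ _ => tpure s (\sum_k \sum_l c k l *: e k l))); last first.
  rewrite (erel c c0); transitivity (g 0 : R[i]); last exact: linear0.
  by congr (g _); apply/funext => u; apply/funext => v; exact: tpure0r.
rewrite (@linfun_sum2 _ _ g _ (fun k l => c k l *: (fun _ _ => tpure s (e k l)))).
  by apply: eq_bigr => k _; apply: eq_bigr => l _; rewrite linfunZ GE.
apply/funext => u; apply/funext => v; rewrite !fct_sumE tpure_sumr; apply: eq_bigr => k _.
by rewrite !fct_sumE tpure_sumr; apply: eq_bigr => l _; rewrite tpureZr.
Qed.
End TensorToLocal.

(** * Quotients of matrix algebras *)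

Definition psd (R : realType) (I : finType) (a : I -> I -> R[i]) :=
  forall v : I -> R[i], 0 <= \sum_i \sum_j Num.conj (v i) * v j * a i j.

Lemma sum_delta (R : realType) (I : finType) (F : I -> R[i]) i :
  \sum_j F j * (i == j)%:R = F i.
Proof.
rewrite (bigD1 i)//= eqxx mulr1 big1 ?addr0// => j.
by rewrite eq_sym => /negbTE ->; rewrite mulr0.
Qed.

Lemma psd_outer (R : realType) (I : finType) (x : I -> R[i]) :
  psd (fun i j => Num.conj (x i) * x j).
Proof.
move=> v; pose z := \sum_i v i * x i.
rewrite (_ : \sum_i _ = Num.conj z * z); first by rewrite mulrC conjE mulcJ_ge0.
rewrite conj_sum mulr_suml; apply: eq_bigr => i _; rewrite mulr_sumr.
by apply: eq_bigr => j _; rewrite conjM mulrACA.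
Qed.

Lemma psd_diag (R : realType) (I : finType) (t : R) : 0 <= t ->
  psd (fun i j : I => t%:C * (i == j)%:R).
Proof.
move=> t0 v; apply: sumr_ge0 => i _; under eq_bigr do rewrite mulrA.
by rewrite sum_delta mulr_ge0 ?lecR// mulrC conjE mulcJ_ge0.
Qed.

(** This is Cauchy-Schwarz, with [t] the squared length of [x]. *)
Lemma psd_outer_le (R : realType) (I : finType) (x : I -> R[i]) :
  exists2 t : R, 0 <= t & psd (fun i j => t%:C * (i == j)%:R - Num.conj (x i) * x j).
Proof.
have [t tE t0] : exists2 t : R, \sum_i x i * Num.conj (x i) = t%:C & 0 <= t.
  by apply: ge0_realc; apply: sumr_ge0 => i _; rewrite conjE mulcJ_ge0.
exists t => // v.
pose B (f g : I -> R[i]) : R[i] := \sum_i f i * Num.conj (g i).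
have Bl a f g h : B (a *: f + g) h = a * B f h + B g h.
  rewrite mulr_sumr -big_split; apply: eq_bigr => i _ /=.
  by rewrite -[(a *: f + g) i]/(a * f i + g i) mulrDl mulrA.
have Br a f g h : B h (a *: f + g) = Num.conj a * B h f + B h g.
  rewrite mulr_sumr -big_split; apply: eq_bigr => i _ /=.
  by rewrite -[(a *: f + g) i]/(a * f i + g i) conjD conjM mulrDr mulrCA.
have Bp f : 0 <= B f f by apply: sumr_ge0 => i _; rewrite conjE mulcJ_ge0.
have := psd_CauchySchwarz Bl Br Bp v (fun i => Num.conj (x i)).
rewrite sqr_normc -conjE -subr_ge0; congr (_ <= _).
have -> : B v (fun i => Num.conj (x i)) = \sum_i v i * x i.
  by apply: eq_bigr => i _; rewrite conjCK.
have -> : B (fun i => Num.conj (x i)) (fun i => Num.conj (x i)) = t%:C.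
  by rewrite -tE; apply: eq_bigr => i _; rewrite conjCK mulrC.
rewrite conj_sum [X in _ - X]mulrC !mulr_suml -sumrB; apply: eq_bigr => i _.
under [RHS]eq_bigr do rewrite mulrBr mulrA.
rewrite [RHS]sumrB sum_delta; congr (_ - _); first by rewrite [v i * _]mulrC.
rewrite mulr_sumr; apply: eq_bigr => j _.
by rewrite conjM mulrACA.
Qed.

Section MatrixSpaces.
Variables (R : realType) (n : nat).

Lemma mnq_unit (v w : 'cV[R[i]]_n) : mnq (munit : Mn R n) v w = \sum_k Num.conj (w k 0) * v k 0.
Proof.
rewrite mnqE; apply: eq_bigr => k _.
rewrite -[RHS](sum_delta (fun l => Num.conj (w k 0) * v l 0)); apply: eq_bigr => l _.
by rewrite mxE mulrAC.
Qed.

Lemma mn_posI_scalar (I : finType) (a : I -> I -> R[i]) : psd a ->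
  posI (fun i j => a i j *: (munit : Mn R n)).
Proof.
move=> ap; apply/mn_mposE => v.
rewrite [X in _ <= X](_ : _ = \sum_k \sum_i \sum_j
   Num.conj (v i k 0) * v j k 0 * a (enum_val i) (enum_val j)).
  apply: sumr_ge0 => k _; have := ap (fun i => v (enum_rank i) k 0).
  rewrite reindex_enum_val; congr (_ <= _); apply: eq_bigr => i _.
  by rewrite reindex_enum_val; apply: eq_bigr => j _; rewrite !enum_valK.
rewrite [RHS]exchange_big; apply: eq_bigr => i _; rewrite [RHS]exchange_big; apply: eq_bigr => j _.
have E : mnq (a (enum_val i) (enum_val j) *: (munit : Mn R n)) (v j) (v i) =
    a (enum_val i) (enum_val j) * mnq munit (v j) (v i).
  have := mnq_V (a (enum_val i) (enum_val j)) munit 0 (v j) (v i); rewrite addr0 => ->.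
  by rewrite [mnq 0 _ _]mnqE big1 ?addr0// => k _; rewrite big1// => l _; rewrite mxE mulr0 mul0r.
by rewrite mxE E mnq_unit mulr_sumr; apply: eq_bigr => k _; rewrite mulrC.
Qed.

Lemma mn_pos1P (c : Mn R n) : pos1 c <-> psd (fun k l => c k l).
Proof.
rewrite /pos1 mn_mposE; split=> cp v.
  have := cp (fun _ => \col_k v k); rewrite !big_ord1 mxE mnqE; congr (_ <= _).
  by apply: eq_bigr => k _; apply: eq_bigr => l _; rewrite !mxE mulrAC.
rewrite !big_ord1 mxE mnqE; have := cp (fun k => v ord0 k 0); congr (_ <= _).
by apply: eq_bigr => k _; apply: eq_bigr => l _; rewrite mulrAC.
Qed.

(** The quadratic form of the matrix units at [v] is the squared modulus of [sum_i v i i 0]. *)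
Lemma mn_units_pos : mpos n (\matrix_(k, l) (delta_mx k l : Mn R n)).
Proof.
apply/mn_mposE => v; pose z := \sum_i v i i 0.
rewrite (_ : \sum_i _ = Num.conj z * z); first by rewrite mulrC conjE mulcJ_ge0.
rewrite conj_sum mulr_suml; apply: eq_bigr => i _; rewrite mulr_sumr; apply: eq_bigr => j _.
rewrite mxE mnqE (bigD1 i)//= [X in _ + X]big1 ?addr0; last first.
  move=> k /negbTE ki; rewrite big1// => l _.
  by rewrite [X in _ * X * _]mxE ki mulr0 mul0r.
rewrite (bigD1 j)//= [X in _ + X]big1 ?addr0; last first.
  by move=> l /negbTE lj; rewrite [X in _ * X * _]mxE lj andbF mulr0 mul0r.
by rewrite [X in _ * X * _]mxE !eqxx mulr1.
Qed.

Lemma mx_units_sum (c : Mn R n) : c = \sum_k \sum_l c k l *: (delta_mx k l : Mn R n).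
Proof. exact: matrix_sum_delta. Qed.
End MatrixSpaces.

Section PsdOps.
Variables (R : realType) (I : finType).
Implicit Types a b : I -> I -> R[i].

Lemma psdD a b : psd a -> psd b -> psd (fun i j => a i j + b i j).
Proof.
move=> ap bp v; have := addr_ge0 (ap v) (bp v); rewrite -big_split; congr (_ <= _).
by apply: eq_bigr => i _; rewrite -big_split; apply: eq_bigr => j _; rewrite /= mulrDr.
Qed.

Lemma psdZ (t : R) a : 0 <= t -> psd a -> psd (fun i j => t%:C * a i j).
Proof.
move=> t0 ap v; have t0' : 0 <= t%:C :> R[i] by rewrite lecR.
have := mulr_ge0 t0' (ap v); rewrite mulr_sumr; congr (_ <= _).
by apply: eq_bigr => i _; rewrite mulr_sumr; apply: eq_bigr => j _; rewrite mulrCA.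
Qed.

Lemma psd_gram_le m (X : 'I_m -> I -> R[i]) : exists2 t : R, 0 <= t &
  psd (fun i j => t%:C * (i == j)%:R - \sum_k Num.conj (X k i) * X k j).
Proof.
elim: m X => [|m IHm] X.
  exists 0 => //; move=> v; have := @psd_diag R I 0 (lexx 0) v.
  congr (_ <= _); apply: eq_bigr => i _; apply: eq_bigr => j _.
  by rewrite big_ord0 subr0.
have [t t0 tp] := IHm (fun k => X (lift ord0 k)); have [u u0 up] := psd_outer_le (X ord0).
exists (u + t); first exact: addr_ge0.
move=> v; have := psdD up tp v; congr (_ <= _); apply: eq_bigr => i _; apply: eq_bigr => j _.
by rewrite big_ord_recl realcD mulrDl opprD addrACA.
Qed.
End PsdOps.

Lemma mn_psd_ind (R : realType) n (Q : set (Mn R n)) : Q 0 ->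
  (forall a x y, Q x -> Q y -> Q (a *: x + y)) ->
  (forall c : Mn R n, psd (fun k l => c k l) ->
     (exists2 t : R, 0 <= t & psd (fun k l => t%:C * (k == l)%:R - c k l)) -> Q c) ->
  forall c, Q c.
Proof.
move=> Q0 QL QG c.
have QD u v : Q u -> Q v -> Q (u + v) by move=> Qu Qv; rewrite -[u]scale1r; apply: (QL).
have Qkl k l : Q (delta_mx k l).
  apply: (@polarization R (Mn R n) 'I_n (fun k l => delta_mx k l) Q QL) => v.
  pose w : Mn R n := \matrix_(k, l) (Num.conj (v k) * v l).
  have -> : \sum_k \sum_l (Num.conj (v k) * v l) *: (delta_mx k l : Mn R n) = w.
    by rewrite [RHS]mx_units_sum; apply: eq_bigr => a _; apply: eq_bigr => b _; rewrite mxE.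
  have [t t0 tp] := psd_outer_le v; apply: QG.
    move=> z; have := psd_outer v z; congr (_ <= _).
    by apply: eq_bigr => a _; apply: eq_bigr => b _; rewrite mxE.
  exists t => // z; have := tp z; congr (_ <= _).
  by apply: eq_bigr => a _; apply: eq_bigr => b _; rewrite mxE.
rewrite (mx_units_sum c).
elim/big_rec: _ => // k y _ Qy; apply: (QD) => //.
by elim/big_rec: _ => // l z _ Qz; apply: (QL) => //; exact: Qkl.
Qed.

Section QuotientOrder.
Variables (R : realType) (n : nat) (J : linsub (Mn R n)).
Hypothesis Jst : star_closed J.
Local Notation Q := (quo J).
Local Notation pi := (quo_pi J).

Definition quo_st (x : Q) : Q := pi (adjmx (quo_repr x)).

Lemma adjmx_lin m p a (x y : 'M[R[i]]_(m, p)) : adjmx (a *: x + y) = Num.conj a *: adjmx x + adjmx y.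
Proof. by apply/matrixP => i j; rewrite !mxE conjD conjM. Qed.

Lemma adjmxK m p (x : 'M[R[i]]_(m, p)) : adjmx (adjmx x) = x.
Proof. by apply/matrixP => i j; rewrite !mxE conjCK. Qed.

Lemma quo_st_pi (c : Mn R n) : quo_st (pi c) = pi (adjmx c).
Proof.
apply/quo_piP.
have := Jst ((quo_piP J (quo_repr (pi c)) c).1 (quo_reprK _)).
by rewrite -scaleN1r addrC adjmx_lin conjN conj1 scaleN1r addrC.
Qed.

Lemma quo_mposE k (x : 'M[Q]_k) : mpos k x <->
  forall e : R, 0 < e -> exists2 s : 'I_k -> 'I_k -> Mn R n, posI s &
    forall i j, x i j + (e%:C * (i == j)%:R) *: pi munit = pi (s i j).
Proof.
have cM := @mn_compressible R n.
have E (e : R) i j : (x + (e%:C *: pi munit)%:M) i j = x i j + (e%:C * (i == j)%:R) *: pi munit.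
  by rewrite !mxE; case: (i == j); rewrite ?mulr1 ?mulr0 ?scale0r ?mulr1n ?mulr0n.
split=> xp e e0; have [s sp sE] := xp e e0.
  exists (fun i j => s i j); first exact/posI_ord.
  by move=> i j; rewrite -E sE mxE.
exists (\matrix_(i, j) s i j); first exact/posI_mx.
by apply/matrixP => i j; rewrite E sE !mxE.
Qed.

Lemma quo_mpos_pi k (s : 'I_k -> 'I_k -> Mn R n) : posI s -> mpos k (\matrix_(i, j) pi (s i j)).
Proof.
move=> sp; apply/quo_mposE => e e0.
exists (fun i j => s i j + (e%:C * (i == j)%:R) *: (munit : Mn R n)); last first.
  by move=> i j; rewrite mxE linearD linearZ.
apply: (posI_add (@mn_compressible R n) (@mn_dsummable R n)); first exact: sp.
exact: (@mn_posI_scalar R n _ _ (psd_diag (ltW e0))).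
Qed.

Lemma quo_pos1_pi (c : Mn R n) : psd (fun k l => c k l) -> pos1 (pi c).
Proof.
move=> /mn_pos1P/(pos1_posI (@mn_compressible R n))/quo_mpos_pi; congr (mpos _ _).
by apply/matrixP => k l; rewrite !mxE.
Qed.

(** The slack [d I] of the quotient cone is compressed to [d X^* X], not to a multiple of the
    identity. With [X^* X <= t] and [d = e / (t + 1)], the missing part [e I - d X^* X] is positive
    and is added to the lift. *)
Lemma quo_compressible : compressible Q.
Proof.
have cM := @mn_compressible R n; have dM := @mn_dsummable R n.
move=> m p X Y /quo_mposE Yp; apply/quo_mposE => e e0.
have [t t0 tp] := psd_gram_le (fun k i => X k i).
have t1 : 0 < t + 1 by rewrite ltr_wpDl.
pose d := e / (t + 1).
have d0 : 0 < d by rewrite divr_gt0.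
have dt : 0 <= e - d * t.
  by rewrite subr_ge0 /d mulrAC ler_pdivrMr// mulrDr mulr1 lerDl ltW.
have [s sp sE] := Yp d d0.
have ap := psdD (psdZ (ltW d0) tp) (psd_diag dt).
exists (fun i j => comprI (fun k i => X k i) s i j + (d%:C *
    (t%:C * (i == j)%:R - \sum_k Num.conj (X k i) * X k j) + (e - d * t)%:C * (i == j)%:R) *: (munit : Mn R n)).
  by apply: (posI_add cM dM); [exact: (posI_compr cM)|exact: (@mn_posI_scalar R n _ _ ap)].
move=> i j; rewrite linearD linearZ /comprI linear_sum.
rewrite [X in _ = X + _](_ : _ = mxcompress X Y i j +
    (d%:C * \sum_k Num.conj (X k i) * X k j) *: pi munit).
  rewrite -addrA -scalerDl; congr (_ + _ *: _); rewrite realcB [(d * t)%:C]realcM; ring.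
rewrite mxcompressE mulr_sumr scaler_suml -big_split; apply: eq_bigr => k _.
rewrite linear_sum (bigD1 k)//= [X in _ = X + _](bigD1 k)//= addrAC; congr (_ + _).
  by rewrite linearZ /= -sE eqxx mulr1 scalerDr scalerA [d%:C * _]mulrC.
apply: eq_bigr => l; rewrite eq_sym => /negbTE kl.
by rewrite linearZ /= -sE kl mulr0 scale0r addr0.
Qed.

Lemma quo_dsummable : dsummable Q.
Proof.
have cM := @mn_compressible R n; have dM := @mn_dsummable R n.
move=> p q A B Ap Bp e e0; have [s sp sE] := Ap e e0; have [s' sp' sE'] := Bp e e0.
exists (block_mx s 0 0 s'); first exact: dM.
rewrite map_block_mx -sE -sE' !map_mx0 scalar_mx_block.
by rewrite [LHS]add_block_mx !addr0.
Qed.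

Lemma quo_matrix_ordered : matrix_ordered quo_st.
Proof.
split.
- move=> a x y; rewrite -[x]quo_reprK -[y]quo_reprK -linearP !quo_st_pi.
  by rewrite adjmx_lin linearP.
- move=> x; have : quo_st (quo_st (pi (quo_repr x))) = pi (quo_repr x) by rewrite !quo_st_pi adjmxK.
  by rewrite quo_reprK.
- move=> k X /quo_mposE/(_ 1 ltr01)[s sp sE] i j.
  have XE i' j' : X i' j' = pi (- (1%:C * (i' == j')%:R) *: munit + s i' j').
    by rewrite linearP /= -sE scaleNr addrC addrK.
  rewrite !XE quo_st_pi adjmx_lin; congr (pi (_ + _)).
    rewrite conjN conjM conjR [j == i]eq_sym; congr (_ *: _); last first.
      by apply/matrixP => a b; rewrite !mxE rmorph_nat eq_sym.
    by rewrite rmorph_nat.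
  have := mn_herm (enum_rank i) (enum_rank j) sp; rewrite !mxE !enum_rankK.
  by [].
- exact: quo_compressible.
- exact: quo_dsummable.
- apply: quo_pos1_pi => v; have := @psd_diag R _ 1 ler01 v; congr (_ <= _).
  by apply: eq_bigr => k _; apply: eq_bigr => l _; rewrite !mxE realc1 mul1r.
move=> P P0 PL PG x.
rewrite -[x]quo_reprK.
apply: (mn_psd_ind (Q := fun c => P (pi c))) (quo_repr x) => [|a c c' Pc Pc'|c cp [t t0 tc]].
- by rewrite linear0.
- by rewrite linearP; apply: (PL).
apply: PG; first exact: quo_pos1_pi.
exists t => //; rewrite -[munit]/(pi munit) -linearZ -linearB; apply: quo_pos1_pi => w.
have := tc w; congr (_ <= _); apply: eq_bigr => a _; apply: eq_bigr => b _.
by rewrite !mxE.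
Qed.
End QuotientOrder.

Lemma exchange_big12 (V : nmodType) (I J K : finType) (f : I -> J -> K -> V) :
  \sum_i \sum_j \sum_k f i j k = \sum_j \sum_k \sum_i f i j k.
Proof. by rewrite exchange_big; apply: eq_bigr => j _; rewrite exchange_big. Qed.

Lemma exchange_big22 (V : nmodType) (I J K L : finType) (f : I -> J -> K -> L -> V) :
  \sum_i \sum_j \sum_k \sum_l f i j k l = \sum_k \sum_l \sum_i \sum_j f i j k l.
Proof.
under eq_bigr do rewrite exchange_big12.
by rewrite exchange_big12.
Qed.

(** From a spectral decomposition [a = U^* d U], the matrix [y] is [U] with its rows scaled by the
    square roots of [d]. *)
Lemma psd_gram (R : realType) n (a : 'M[R[i]]_n) : psd (fun i j => a i j) ->
  exists y : 'M[R[i]]_n, forall i j, a i j = \sum_m Num.conj (y m i) * y m j.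
Proof.
move=> ap.
have ah : a \is hermsymmx.
  apply/is_hermitianmxP; rewrite expr0 scale1r; apply/matrixP => k l.
  transitivity (Num.conj (a l k)); first exact: psd_mx_herm.
  by rewrite [RHS]mxE; congr Num.conj; rewrite [RHS]mxE.
have /orthomx_spectralP := hermitian_normalmx ah.
set U := spectralmx a; set d := spectral_diag a => aE.
have Uu : U \in unitmx by exact: spectral_unit.
have UE : invmx U = adjmx U by apply: invmx_unitary; exact: spectral_unitarymx.
have aE' i j : a i j = \sum_m Num.conj (U m i) * d 0 m * U m j.
  rewrite aE UE mxE; apply: eq_bigr => m _; rewrite mul_mx_diag; congr (_ * _).
  by rewrite !mxE.
have dE m : d 0 m = (U *m a *m adjmx U) m m.
  by rewrite aE UE -UE !mulmxA mulmxV// mul1mx -mulmxA mulmxV// mulmx1 !mxE eqxx mulr1n.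
have dp m : exists c : R[i], Num.conj c * c = d 0 m.
  have [|t tE t0] := @ge0_realc R (d 0 m).
    rewrite dE mxE; have := ap (fun i => Num.conj (U m i)); rewrite exchange_big; congr (_ <= _).
    apply: eq_bigr => j _; rewrite mxE mulr_suml; apply: eq_bigr => i _.
    by rewrite !mxE conjCK mulrAC.
  by have [c cE] := sqrt_conj t0; exists c; rewrite cE.
have [c cE] := choice dp.
exists (\matrix_(m, i) (c m * U m i)) => i j; rewrite aE'; apply: eq_bigr => m _.
by rewrite !mxE conjM -cE; ring.
Qed.

Lemma psd_gramI (R : realType) (I : finType) (a : I -> I -> R[i]) : psd a ->
  exists m (y : 'I_m -> I -> R[i]), forall i j, a i j = \sum_k Num.conj (y k i) * y k j.
Proof.
move=> ap; have [|y yE] := @psd_gram R #|I| (\matrix_(i, j) a (enum_val i) (enum_val j)).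
  move=> v; have := ap (fun i => v (enum_rank i)); rewrite reindex_enum_val; congr (_ <= _).
  by apply: eq_bigr => i _; rewrite reindex_enum_val; apply: eq_bigr => j _; rewrite !enum_valK mxE.
exists #|I|, (fun k i => y k (enum_rank i)) => i j.
by rewrite -yE mxE !enum_rankK.
Qed.

(** A Gram decomposition of [s] writes the sum as a sum of pairings of [F] with compressions of
    [A]. *)
Lemma dual_schur_ge0 (R : realType) (H : hilbertType R) (S : opsys H) n (F : 'M[bdual S]_n)
    (I : finType) (A : I -> I -> S) (s : I * 'I_n -> I * 'I_n -> R[i]) :
  mpos n F -> posI A -> psd s ->
  0 <= \sum_a \sum_a' \sum_k \sum_l s (a, k) (a', l) * (F k l (A a a') : R[i]).
Proof.
have cS := @os_compressible _ _ S.
move=> /(dual_mposP cS) Fp Ap /psd_gramI[m [y yE]].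
rewrite [X in _ <= X](_ : _ = \sum_(d < m) \sum_k \sum_l
    (F k l (comprI (fun a k => y d (a, k)) A k l) : R[i])).
  apply: sumr_ge0 => d _; have /(posI_mx cS)/Fp := posI_compr cS (fun a k => y d (a, k)) Ap.
  by congr (_ <= _); apply: eq_bigr => k _; apply: eq_bigr => l _; rewrite mxE.
rewrite [RHS](_ : _ = \sum_(d < m) \sum_k \sum_l \sum_a \sum_a'
    Num.conj (y d (a, k)) * y d (a', l) * (F k l (A a a') : R[i])); last first.
  apply: eq_bigr => d _; apply: eq_bigr => k _; apply: eq_bigr => l _.
  rewrite /comprI linfun_sum; apply: eq_bigr => a _; rewrite linfun_sum.
  by apply: eq_bigr => a' _; rewrite linfunZ.
rewrite [RHS](_ : _ = \sum_a \sum_a' \sum_k \sum_l \sum_(d < m)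
    Num.conj (y d (a, k)) * y d (a', l) * (F k l (A a a') : R[i])); last first.
  under eq_bigr do rewrite exchange_big22.
  rewrite exchange_big12; apply: eq_bigr => a _; apply: eq_bigr => a' _.
  by rewrite exchange_big12.
apply: eq_bigr => a _; apply: eq_bigr => a' _; apply: eq_bigr => k _; apply: eq_bigr => l _.
by rewrite yE mulr_suml.
Qed.

(** * Quotients by the relations of a matrix of functionals *)

Section QuotientToLocal.
Variables (R : realType) (H : hilbertType R) (S1 S2 : opsys H).
Hypothesis S12 : forall T : BH H, os_space S1 T -> os_space S2 T.
Let j : {linear S1 -> S2} := os_incl S12.
Let k1 := @os_compressible _ _ S1.

Definition entry_comb n (F : 'M[bdual S1]_n) (c : 'M[R[i]]_n) : bdual S1 :=
  \sum_k \sum_l c k l *: F k l.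

Lemma entry_comb_linear n (F : 'M[bdual S1]_n) : linear (entry_comb F).
Proof.
move=> a x y; rewrite /entry_comb scaler_sumr -big_split; apply: eq_bigr => k _.
rewrite scaler_sumr -big_split; apply: eq_bigr => l _ /=.
by rewrite !mxE scalerDl scalerA.
Qed.

Definition relations n (F : 'M[bdual S1]_n) : linsub (Mn R n).
Proof.
pose P : set (Mn R n) := [set c | entry_comb F c = 0].
apply: (@LinSub _ (Mn R n) P).
- have := entry_comb_linear F (-1) 0 0; rewrite scaler0 addr0 scaleN1r addNr; exact.
- move=> x y Px Py; have := entry_comb_linear F 1 x y; rewrite !scale1r /P /= => ->.
  by rewrite Px Py addr0.
- move=> a x Px; have := entry_comb_linear F a x 0; rewrite addr0 /P /= => ->.
  have F0 : entry_comb F 0 = 0.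
    by have := entry_comb_linear F (-1) 0 0; rewrite scaler0 addr0 scaleN1r addNr.
  by rewrite Px scaler0 add0r F0.
Defined.

Lemma relationsE n (F : 'M[bdual S1]_n) c : relations F c = (entry_comb F c = 0).
Proof. by []. Qed.

Lemma entry_combE n (F : 'M[bdual S1]_n) (c : 'M[R[i]]_n) s :
  entry_comb F c s = \sum_k \sum_l c k l * (F k l s : R[i]).
Proof. exact: bdual_sum2E. Qed.

(** For unital [F], evaluating a relation at 1 shows that its coefficient matrix has trace 0, and a
    positive matrix of trace 0 vanishes. *)
Lemma relations_null n (F : 'M[bdual S1]_n) : mpos n F -> unital F ->
  null_subspace (relations F).
Proof.
move=> Fp F1; split=> [c|c]; rewrite relationsE; first exact: relation_star.
move=> c0 /mn_pos1P cp.
have tr0 : \sum_k c k k = 0.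
  have h : entry_comb F c munit = 0 by rewrite c0.
  rewrite entry_combE in h; rewrite -[RHS]h.
  apply: eq_bigr => k _; under eq_bigr do rewrite F1.
  by rewrite sum_delta.
have cd k : 0 <= c k k.
  have := cp (fun m => (m == k)%:R); congr (_ <= _).
  have := @sum_delta2 R R[i]^o 'I_n (fun k l => c k l) k k; exact.
have ckk k : c k k = 0 by exact: (psumr_eq0P (fun i _ => cd i) tr0).
apply/matrixP => k l; rewrite mxE; apply/eqP; rewrite -normr_eq0 -sqrf_eq0 eq_le exprn_ge0// andbT.
by rewrite (le_trans (psd_mx_CauchySchwarz k l cp))// !ckk mul0r.
Qed.

Lemma quotient_local n (F : 'M[bdual S1]_n) : mpos n F -> unital F ->
  (forall (n : nat) (J : linsub (Mn R n)), null_subspace J ->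
     order_embedding (tmax_map j : tmax S1 (quo J) -> tmax S2 (quo J))) ->
  local_extension S12 F.
Proof.
move=> Fp F1 emb; pose J := relations F; have Jn : null_subspace J := relations_null Fp F1.
pose e : 'M[quo J]_n := \matrix_(k, l) quo_pi J (delta_mx k l).
pose u (x : quo J) : Mn R n := quo_repr x.
have uE c : entry_comb F (u (quo_pi J c)) = entry_comb F c.
  have : J (u (quo_pi J c) - c) by apply/quo_piP; exact: quo_reprK.
  rewrite /J relationsE => h; have := entry_comb_linear F 1 (u (quo_pi J c) - c) c.
  by rewrite h !scale1r subrK add0r.
have ulin : linear (fun x => entry_comb F (u x)).
  move=> a x y; rewrite -[x in LHS]quo_reprK -[y in LHS]quo_reprK -linearP uE.
  exact: entry_comb_linear.
have [||b bE] := @mk_bilin R S1 (quo J) (fun s x => entry_comb F (u x) s).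
- by move=> x a s t; rewrite linearP.
- by move=> s a x y; rewrite ulin.
have Jst := proj1 Jn.
apply: (@tensor_local_extension _ _ _ _ S12 n F (quo J) _ e b (quo_matrix_ordered Jst) (emb _ _ Jn)).
- have := quo_mpos_pi J ((posI_ord (@mn_compressible R n) _).2 (@mn_units_pos R n)).
  by congr (mpos _ _); apply/matrixP => k l; rewrite !mxE.
- move=> c c0; have E : \sum_k \sum_l c k l *: e k l = quo_pi J c.
    rewrite [in RHS](mx_units_sum c) linear_sum; apply: eq_bigr => k _.
    by rewrite linear_sum; apply: eq_bigr => l _; rewrite linearZ /= mxE.
  by rewrite E -[RHS](linear0 (quo_pi J)); apply/quo_piP; rewrite subr0.
- move=> s k l; rewrite bE mxE uE entry_combE (bigD1 k)//= [X in _ + X]big1 ?addr0.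
    rewrite (bigD1 l)//= [X in _ + X]big1 ?addr0; first by rewrite mxE !eqxx mul1r.
    by move=> l' /negbTE ll; rewrite mxE ll andbF mul0r.
  by move=> k' /negbTE kk; rewrite big1// => l' _; rewrite mxE kk mul0r.
move=> I A B Ap /quo_mposE Bp.
have trp : 0 <= \sum_a \sum_k (F k k (A a a) : R[i]).
  apply: sumr_ge0 => a _; apply: sumr_ge0 => k _; apply: mpos_diag => //.
  exact: posI_unit.
(* A positive matrix over the quotient is known to lift only after adding [d] times the unit, which
   changes the value by [d] times the nonnegative number of [trp]. *)
apply: (ge0_shift trp) => d d0; have [s sp sE] := Bp d d0.
pose s' (v w : I * 'I_n) : R[i] := s (enum_rank v.1) (enum_rank w.1) v.2 w.2.
have s'p : psd s'.
  move=> v; have /(posI_mx (@mn_compressible R n))/mn_mposE/(_ (fun a => \col_k v (enum_val a, k))) := sp.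
  congr (_ <= _).
  rewrite [RHS](_ : _ = \sum_a \sum_k \sum_a' \sum_l
      Num.conj (v (a, k)) * v (a', l) * s' (a, k) (a', l)); last first.
    by rewrite [RHS]pair_bigA; apply: eq_bigr => -[a k] _; rewrite [RHS]pair_bigA; apply: eq_bigr => -[].
  rewrite [RHS]reindex_enum_val; apply: eq_bigr => a _.
  rewrite [RHS]exchange_big [RHS]reindex_enum_val; apply: eq_bigr => a' _.
  rewrite mxE mnqE; apply: eq_bigr => k _; apply: eq_bigr => l _.
  by rewrite !mxE /s' !enum_valK mulrAC.
have := dual_schur_ge0 Fp Ap s'p; congr (_ <= _).
rewrite mulr_sumr -big_split; apply: eq_bigr => a _.
rewrite -[X in _ = _ + X](sum_delta (fun a' => d%:C * \sum_k (F k k (A a a') : R[i]))) -big_split.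
apply: eq_bigr => a' _ /=.
rewrite bE; have := sE (enum_rank a) (enum_rank a'); rewrite mxE !enum_rankK => E.
transitivity (entry_comb F (s (enum_rank a) (enum_rank a')) (A a a')); first by rewrite entry_combE.
rewrite -uE -E [B _ _ + _]addrC ulin bdualDE bdualZE uE [RHS]addrC; congr (_ + _).
have -> : (enum_rank a == enum_rank a') = (a == a') by rewrite (inj_eq enum_rank_inj).
rewrite mulrAC entry_combE; congr (_ * _ * _); apply: eq_bigr => k _.
rewrite -[RHS](sum_delta (fun l => (F k l (A a a') : R[i]))).
by apply: eq_bigr => l _; rewrite mxE mulrC.
Qed.
End QuotientToLocal.

(** * Hilbert sums of finite-dimensional spaces *)

Lemma normc_ge_Im (R : realType) (z : R[i]) : `|complex.Im z|%:C <= `|z|.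
Proof.
have := normc_ge_Re ('i%C * z); rewrite cnormM norm_ic mul1r => /(le_trans _); apply.
by case: z => x y; simpc; rewrite /= normrN.
Qed.

Section UnconditionalSums.
Variables (R : realType) (I : eqType).
Implicit Types (a b : I -> R[i]) (l m : R[i]).

(** The blocks of the Hilbert sum will be indexed by all matrices over [S1], so sums are limits
    along the finite subsets of an arbitrary index set, represented by duplicate-free lists. *)
Definition has_sum a l := forall e : R, 0 < e -> exists s0 : seq I,
  forall s, uniq s -> {subset s0 <= s} -> `|\sum_(i <- s) a i - l| <= e%:C.

Lemma has_sum_unique a l m : has_sum a l -> has_sum a m -> l = m.
Proof.
move=> al am; apply/eqP; rewrite -subr_eq0 -normr_le0.
have [r rE r0] : exists2 r : R, `|l - m| = r%:C & 0 <= r by apply: ge0_realc.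
rewrite rE lecR; apply/ler_addgt0Pr => e e0; rewrite add0r.
have e2 : 0 < e / 2 by rewrite divr_gt0.
have [s0 s0P] := al _ e2; have [s1 s1P] := am _ e2.
pose s := undup (s0 ++ s1).
have h0 : {subset s0 <= s} by move=> i is0; rewrite mem_undup mem_cat is0.
have h1 : {subset s1 <= s} by move=> i is1; rewrite mem_undup mem_cat is1 orbT.
have := lerD (s0P s (undup_uniq _) h0) (s1P s (undup_uniq _) h1).
have -> : (e / 2)%:C + (e / 2)%:C = e%:C :> R[i] by rewrite -realcD -splitr.
rewrite -lecR -rE => /(le_trans _); apply.
rewrite [`|_ - l|]distrC; apply: le_trans (cnormD _ _).
by rewrite addrA subrK.
Qed.

Lemma has_sum_lin c a b l m : has_sum a l -> has_sum b m ->
  has_sum (fun i => c * a i + b i) (c * l + m).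
Proof.
move=> al bm e e0.
have [r rE r0] : exists2 r : R, `|c| = r%:C & 0 <= r by apply: ge0_realc.
have r1 : 0 < r + 1 by rewrite ltr_wpDl.
have e2 : 0 < e / 2 by rewrite divr_gt0.
have [s0 s0P] := al _ (divr_gt0 e2 r1); have [s1 s1P] := bm _ e2.
exists (s0 ++ s1) => s us ss.
have h0 : {subset s0 <= s} by move=> i is0; rewrite ss// mem_cat is0.
have h1 : {subset s1 <= s} by move=> i is1; rewrite ss// mem_cat is1 orbT.
rewrite big_split -mulr_sumr opprD addrACA -mulrBr.
apply: le_trans (cnormD _ _) _; rewrite cnormM rE.
have -> : e%:C = (e / 2)%:C + (e / 2)%:C :> R[i] by rewrite -realcD -splitr.
apply: lerD; last exact: s1P.
have rc : 0 <= r%:C :> R[i] by rewrite lecR.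
apply: le_trans (ler_wpM2l rc (s0P s us h0)) _.
by rewrite -realcM lecR mulrA ler_pdivrMr// mulrC ler_wpM2l ?lerDl ?ler01// ltW.
Qed.

Lemma eq_has_sum a b l : (forall i, a i = b i) -> has_sum a l -> has_sum b l.
Proof. by move=> ab; have -> : b = a by apply/funext. Qed.

Lemma has_sum0 : has_sum (fun _ => 0) 0.
Proof. by move=> e e0; exists [::] => s _ _; rewrite big1// subrr normr0 lecR ltW. Qed.

Lemma has_sum_conj a l : has_sum a l -> has_sum (fun i => Num.conj (a i)) (Num.conj l).
Proof.
move=> al e /al[s0 s0P]; exists s0 => s us ss.
by rewrite -conj_sum -conjB norm_conjC; exact: s0P.
Qed.

Lemma ge0_approx (z : R[i]) :
  (forall e : R, 0 < e -> exists2 w : R[i], 0 <= w & `|w - z| <= e%:C) -> 0 <= z.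
Proof.
move=> zw.
have h (e : R) : 0 < e -> - e <= complex.Re z /\ `|complex.Im z| <= e.
  move=> /zw[w /ge0_realc[r -> r0]] wz.
  move: (le_trans (normc_ge_Re _) wz) (le_trans (normc_ge_Im _) wz); case: z {zw wz} => x y.
  rewrite !raddfB /= !lecR sub0r normrN => hx hy; split=> //.
  rewrite lerNl; apply: le_trans (_ : r - x <= e); first by rewrite lerBrDr addrC subrr.
  exact: le_trans (ler_norm _) hx.
rewrite lecE; apply/andP; split.
  rewrite -normr_eq0 eq_le normr_ge0 andbT; apply/ler_addgt0Pr => e /h[_].
  by rewrite add0r.
apply/ler_addgt0Pr => e /h[+ _].
by rewrite /= -lerBlDr sub0r.
Qed.

Lemma has_sum_ge0 a l : (forall s, uniq s -> exists s', [/\ uniq s', {subset s <= s'} & 0 <= \sum_(i <- s') a i]) ->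
  has_sum a l -> 0 <= l.
Proof.
move=> ap al; apply: ge0_approx => e /al[s0 s0P].
have [s [us ss sp]] := ap (undup s0) (undup_uniq s0).
exists (\sum_(i <- s) a i) => //; apply: s0P => // i is0.
by apply: ss; rewrite mem_undup.
Qed.

Lemma big_uniq_subset (s t : seq I) a : uniq s -> uniq t -> {subset s <= t} ->
  (forall i, 0 <= a i) -> \sum_(i <- s) a i <= \sum_(i <- t) a i.
Proof.
move=> us ut st a0.
have -> : \sum_(i <- t) a i = \sum_(i <- s) a i + \sum_(i <- t | i \notin s) a i.
  rewrite (bigID (mem s))/=; congr (_ + _); rewrite -big_filter; apply: perm_big.
  apply: uniq_perm => //; first exact: filter_uniq.
  by move=> i; rewrite mem_filter; case: (boolP (i \in s)) => //= /st ->.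
by rewrite lerDl sumr_ge0.
Qed.

Lemma has_sum_partial a l s : (forall i, 0 <= a i) -> has_sum a l -> uniq s ->
  \sum_(i <- s) a i <= l.
Proof.
move=> a0 al us; rewrite -subr_ge0; apply: ge0_approx => e /al[s0 s0P].
pose t := undup (s ++ s0).
have ts0 : {subset s0 <= t} by move=> i is0; rewrite mem_undup mem_cat is0 orbT.
have ts : {subset s <= t} by move=> i is0; rewrite mem_undup mem_cat is0.
exists (\sum_(i <- t) a i - \sum_(i <- s) a i).
  by rewrite subr_ge0 big_uniq_subset// undup_uniq.
rewrite opprB addrA subrK; exact: (s0P t (undup_uniq _) ts0).
Qed.

Lemma has_sum_exists a (M : R) : (forall i, 0 <= a i) ->
  (forall s, uniq s -> \sum_(i <- s) a i <= M%:C) -> exists2 l : R, has_sum a l%:C & l <= M.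
Proof.
move=> a0 aM; pose E : set R := [set r | exists2 s, uniq s & \sum_(i <- s) a i = r%:C].
have E0 : E 0 by exists [::] => //; rewrite big_nil.
have EM : ubound E M by move=> r [s us E']; have := aM s us; rewrite E' lecR.
have supE : has_sup E by split; [exists 0|exists M].
exists (sup E); last by apply: ge_sup => //; exists 0.
move=> e e0; have [u [s0 us0 uE] s0E] := sup_adherent e0 supE.
exists s0 => s us ss.
have [t tE t0] : exists2 t : R, \sum_(i <- s) a i = t%:C & 0 <= t by apply/ge0_realc/sumr_ge0.
have tle : t <= sup E by apply: ub_le_sup; [exists M|exists s].
have := big_uniq_subset us0 us ss a0; rewrite tE uE lecR => ut.
rewrite -realcB norm_realc lecR distrC ger0_norm ?subr_ge0//.
by rewrite lerBlDr addrC -lerBlDr; apply: le_trans ut; exact: ltW.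
Qed.
End UnconditionalSums.

Section BlockSpace.
Variables (R : realType) (IA : eqType) (d : IA -> nat).
Local Notation J := {A : IA & 'I_(d A)}.
Implicit Types x y : J -> R[i].

Definition bdot x y (A : IA) : R[i] :=
  \sum_(a < d A) x (existT _ A a) * Num.conj (y (existT _ A a)).

Lemma bdot_lin c x y z A : bdot (c *: x + y) z A = c * bdot x z A + bdot y z A.
Proof.
rewrite mulr_sumr -big_split; apply: eq_bigr => a _ /=.
by rewrite -[(c *: x + y) _]/(c * x _ + y _) mulrDl mulrA.
Qed.

Lemma bdotC x y A : bdot x y A = Num.conj (bdot y x A).
Proof. by rewrite conj_sum; apply: eq_bigr => a _; rewrite conjM conjCK mulrC. Qed.

Lemma bdot_linr c x y z A : bdot z (c *: x + y) A = Num.conj c * bdot z x A + bdot z y A.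
Proof. by rewrite bdotC bdot_lin conjD conjM -!bdotC. Qed.

Lemma bdot_ge0 x A : 0 <= bdot x x A.
Proof. by apply: sumr_ge0 => a _; rewrite conjE mulcJ_ge0. Qed.

Lemma bdotD_le x y A : bdot (x + y) (x + y) A <= 2 * bdot x x A + 2 * bdot y y A.
Proof.
rewrite -subr_ge0; have := bdot_ge0 (-1 *: y + x) A; congr (_ <= _).
have -> : x + y = 1 *: y + x by rewrite scale1r addrC.
rewrite !(bdot_lin, bdot_linr) !conjN conj1; ring.
Qed.

Definition sq_summable x := exists M : R, forall s : seq IA, uniq s ->
  \sum_(A <- s) bdot x x A <= M%:C.

Fact sq_summable0 : sq_summable 0.
Proof.
exists 0 => s _; rewrite big1 // => A _; rewrite /bdot big1// => a _.
by rewrite -[(0 : J -> R[i]) _]/(0 : R[i]) mul0r.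
Qed.

Fact sq_summableD x y : sq_summable x -> sq_summable y -> sq_summable (x + y).
Proof.
move=> [M xM] [N yN]; exists (2 * M + 2 * N) => s us.
have two : (2 : R)%:C = 2 :> R[i] by rewrite rmorph_nat.
apply: le_trans (ler_sum _ (fun A _ => bdotD_le x y A)) _.
rewrite big_split -!mulr_sumr realcD !realcM two; apply: lerD; apply: ler_wpM2l => //.
  exact: xM.
exact: yN.
Qed.

Fact sq_summableZ c x : sq_summable x -> sq_summable (c *: x).
Proof.
move=> [M xM].
have [t tE t0] : exists2 t : R, Num.conj c * c = t%:C & 0 <= t.
  by apply: ge0_realc; rewrite mulrC conjE mulcJ_ge0.
exists (t * M) => s us.
have E A : bdot (c *: x) (c *: x) A = t%:C * bdot x x A.
  rewrite -tE mulr_sumr; apply: eq_bigr => a _.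
  by rewrite -[(c *: x) _]/(c * x _) conjM; ring.
under eq_bigr do rewrite E.
by rewrite -mulr_sumr realcM ler_wpM2l ?lecR ?xM.
Qed.

Definition ell2_space : linsub (J -> R[i]) := LinSub sq_summable0 sq_summableD sq_summableZ.

Definition ell2 := sub ell2_space.
HB.instance Definition _ := GRing.Lmodule.copy ell2 (sub ell2_space).

Definition coords (x : ell2) : J -> R[i] := sub_val x.

Lemma coords_lin c (x y : ell2) : coords (c *: x + y) = c *: coords x + coords y.
Proof. by []. Qed.

Lemma coords_inj : injective coords.
Proof. by move=> x y xy; apply: val_inj. Qed.

(** Summability of the mixed products follows by polarization from that of the squares at the
    vectors [conj c y + x]. *)
Lemma ell2_has_sum_exists (x y : ell2) : exists l, has_sum (bdot (coords x) (coords y)) l.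
Proof.
pose Q (a : IA -> R[i]) := exists l, has_sum a l.
have Qsq (z : ell2) : Q (bdot (coords z) (coords z)).
  have [M zM] := subP z; have [l zl _] := has_sum_exists (bdot_ge0 (coords z)) zM.
  by exists l%:C.
apply: (@polarization2 R (IA -> R[i]) (bdot (coords x) (coords x)) (bdot (coords y) (coords y)) _
  (bdot (coords y) (coords x)) Q) => [c a b [l al] [m bm]|c cc].
  by exists (c * l + m); exact: has_sum_lin.
have := Qsq (Num.conj c *: y + x); congr (Q _); apply/funext => A.
rewrite coords_lin bdot_lin !bdot_linr conjCK.
rewrite -[RHS]/(bdot (coords x) (coords x) A + bdot (coords y) (coords y) A +
  (c * bdot (coords x) (coords y) A + Num.conj c * bdot (coords y) (coords x) A)).
rewrite mulrDr mulrA cc mul1r; ring.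
Qed.

Definition ell2_dot (x y : ell2) : R[i] := projT1 (cid (ell2_has_sum_exists x y)).

Lemma ell2_dotP (x y : ell2) : has_sum (bdot (coords x) (coords y)) (ell2_dot x y).
Proof. by rewrite /ell2_dot; case: cid. Qed.

Lemma ell2_dotE (x y : ell2) l : has_sum (bdot (coords x) (coords y)) l -> ell2_dot x y = l.
Proof. exact: has_sum_unique (ell2_dotP x y). Qed.

Lemma ell2_dot_linl c (x y z : ell2) : ell2_dot (c *: x + y) z = c * ell2_dot x z + ell2_dot y z.
Proof.
apply: ell2_dotE; apply: eq_has_sum (has_sum_lin c (ell2_dotP x z) (ell2_dotP y z)) => A.
by rewrite coords_lin bdot_lin.
Qed.

Lemma ell2_dotC (x y : ell2) : ell2_dot x y = Num.conj (ell2_dot y x).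
Proof.
by apply: ell2_dotE; apply: eq_has_sum (has_sum_conj (ell2_dotP y x)) => A; rewrite -bdotC.
Qed.

Lemma ell2_dot_linr c (x y z : ell2) : ell2_dot z (c *: x + y) = Num.conj c * ell2_dot z x + ell2_dot z y.
Proof. by rewrite ell2_dotC ell2_dot_linl conjD conjM -!ell2_dotC. Qed.

Lemma ell2_partial (x : ell2) (s : seq IA) : uniq s -> \sum_(A <- s) bdot (coords x) (coords x) A <= ell2_dot x x.
Proof. exact: has_sum_partial (bdot_ge0 _) (ell2_dotP x x). Qed.

Lemma ell2_dot_ge0 (x : ell2) : 0 <= ell2_dot x x.
Proof. by have := @ell2_partial x [::] isT; rewrite big_nil. Qed.

Lemma ell2_coord_le (x : ell2) A a : `|coords x (existT _ A a)| ^+ 2 <= ell2_dot x x.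
Proof.
apply: le_trans (ell2_partial x (erefl : uniq [:: A])); rewrite big_seq1 /bdot.
by rewrite (bigD1 a)//= sqr_normc -conjE lerDl sumr_ge0// => b _; rewrite conjE mulcJ_ge0.
Qed.

Lemma ell2_dot_le (x : ell2) (M : R) :
  (forall s, uniq s -> \sum_(A <- s) bdot (coords x) (coords x) A <= M%:C) -> ell2_dot x x <= M%:C.
Proof.
move=> xM; have [l xl lM] := has_sum_exists (bdot_ge0 (coords x)) xM.
by rewrite (ell2_dotE xl) lecR.
Qed.

Definition ell2_norm (x : ell2) : R := Num.sqrt (complex.Re (ell2_dot x x)).
Definition ell2_normC (x : ell2) : R[i] := (ell2_norm x)%:C.

Lemma ell2_norm_ge0 (x : ell2) : 0 <= ell2_norm x. Proof. exact: sqrtr_ge0. Qed.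

Lemma ell2_normE (x : ell2) : ell2_dot x x = ell2_normC x ^+ 2.
Proof.
have [r rE r0] := ge0_realc (ell2_dot_ge0 x).
by rewrite /ell2_normC /ell2_norm rE /= -rmorphXn sqr_sqrtr.
Qed.

Lemma ell2_CauchySchwarz (x y : ell2) : `|ell2_dot x y| <= ell2_normC x * ell2_normC y.
Proof.
have n0 z : 0 <= ell2_normC z by rewrite lecR ell2_norm_ge0.
rewrite -ler_sqr ?nnegrE ?mulr_ge0// exprMn -!ell2_normE.
exact: (psd_CauchySchwarz ell2_dot_linl ell2_dot_linr ell2_dot_ge0).
Qed.

Fact ell2_normD (x y : ell2) : ell2_normC (x + y) <= ell2_normC x + ell2_normC y.
Proof.
have n0 z : 0 <= ell2_normC z by rewrite lecR ell2_norm_ge0.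
rewrite -ler_sqr ?nnegrE ?addr_ge0// -ell2_normE.
rewrite -{1 2}[x]scale1r ell2_dot_linl !ell2_dot_linr conj1 !mul1r !ell2_normE.
rewrite sqrrD addrA lerD2r -addrA lerD2l.
have CS := ell2_CauchySchwarz x y.
apply: le_trans (_ : `|ell2_dot x y + ell2_dot y x| <= _).
  rewrite real_ler_norm// CrealE rmorphD /= -!ell2_dotC addrC.
  by [].
apply: le_trans (cnormD _ _) _; rewrite mulr2n; apply: lerD => //.
by rewrite [ell2_dot y x]ell2_dotC norm_conjC.
Qed.

Fact ell2_normZ c (x : ell2) : ell2_normC (c *: x) = `|c| * ell2_normC x.
Proof.
apply/eqP; rewrite -(@eqrXn2 _ 2)// ?mulr_ge0// ?lecR ?ell2_norm_ge0//.
have z0 : ell2_dot 0 (c *: x) = 0 /\ ell2_dot x 0 = 0.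
  split; first by have := ell2_dot_linl (-1) 0 0 (c *: x); rewrite scaler0 addr0 mulN1r addNr.
  by have := ell2_dot_linr (-1) 0 0 x; rewrite scaler0 addr0 conjN conj1 mulN1r addNr.
rewrite -ell2_normE -{1 2}[c *: x]addr0 ell2_dot_linl addr0 z0.1 addr0.
by rewrite -[c *: x]addr0 ell2_dot_linr z0.2 addr0 ell2_normE exprMn sqr_normc -conjE mulrA.
Qed.

Fact ell2_norm_eq0 (x : ell2) : ell2_normC x = 0 -> x = 0.
Proof.
move=> x0; apply: coords_inj; apply/funext => -[A a].
rewrite -[RHS]/(0 : R[i]); apply/eqP; rewrite -normr_eq0 -sqrf_eq0 eq_le exprn_ge0// andbT.
by have := ell2_coord_le x a; rewrite ell2_normE x0 expr0n.
Qed.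

HB.instance Definition _ := Lmodule_isNormed.Build R[i] ell2 ell2_normD ell2_normZ ell2_norm_eq0.

Lemma ell2_normrE (x : ell2) : `|x| = ell2_normC x. Proof. by []. Qed.
End BlockSpace.

Lemma cvg_sqrB (R : realType) (T : Type) (F : set_system T) (FF : Filter F) (f : T -> R) (l c : R) :
  f @ F --> l -> (fun y => (f y - c) ^+ 2) @ F --> (l - c) ^+ 2.
Proof.
move=> fl; have h : (fun y => f y - c) @ F --> l - c by apply: cvgB => //; exact: cvg_cst.
by rewrite expr2; exact: (cvgM h h).
Qed.

Section BlockHilbert.
Variables (R : realType) (IA : eqType) (d : IA -> nat).
Local Notation E := (@ell2 R IA d).

Lemma bdot_re (x : {A : IA & 'I_(d A)} -> R[i]) A :
  bdot x x A = (\sum_(a < d A) (complex.Re (x (existT _ A a)) ^+ 2 + complex.Im (x (existT _ A a)) ^+ 2))%:C.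
Proof.
rewrite rmorph_sum; apply: eq_bigr => a _ /=; rewrite -sqr_normc.
by case: (x _) => u v; rewrite normc_def /= -rmorphXn sqr_sqrtr// addr_ge0 ?sqr_ge0.
Qed.

(** A Cauchy filter converges in each coordinate, the real and imaginary parts separately since the
    limits are taken in [R]. The distance to the limit is bounded first over finitely many blocks,
    where the limit is taken termwise; the bound is uniform and passes to the whole sum. *)
Lemma ell2_complete (F : set_system E) : ProperFilter F -> cauchy F -> cvg F.
Proof.
move=> FF /cauchyP Fc.
have coord_cvg (p : R[i] -> R) (i : {A : IA & 'I_(d A)}) :
    (forall z w, p (z - w) = p z - p w) -> (forall z, `|p z|%:C <= `|z|) ->
    cvg ((fun x : E => p (coords x i)) @ F).
  move=> pB ple; apply/cauchy_cvgP/cauchyP => e e0.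
  have e0' : (0 : R[i]) < e%:C by rewrite ltcR.
  have [x Fx] := Fc _ e0'; exists (p (coords x i)).
  suff h : F (fun y : E => `|p (coords x i) - p (coords y i)| < e) by exact: h.
  apply: filterS Fx => y xy0; have xy : `|x - y| < e%:C := xy0.
  rewrite -ltcR; apply: le_lt_trans xy.
  rewrite -pB; apply: le_trans (ple _) _.
  rewrite -ler_sqr ?nnegrE// ell2_normrE -ell2_normE.
  by case: i => A a; have := ell2_coord_le (x - y) a.
pose re i := lim ((fun x : E => complex.Re (coords x i)) @ F).
pose im i := lim ((fun x : E => complex.Im (coords x i)) @ F).
have re_cvg i : (fun x : E => complex.Re (coords x i)) @ F --> re i.
  by apply: coord_cvg => [z w|z]; [rewrite raddfB|exact: normc_ge_Re].
have im_cvg i : (fun x : E => complex.Im (coords x i)) @ F --> im i.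
  by apply: coord_cvg => [z w|z]; [rewrite raddfB|exact: normc_ge_Im].
pose z i : R[i] := re i +i* im i.
have zx (x : E) (e : R) : 0 <= e -> F (ball x e%:C) -> forall s, uniq s ->
    \sum_(A <- s) bdot (z - coords x) (z - coords x) A <= (e ^+ 2)%:C.
  move=> e0 Fx s us; pose f (y : E) := \sum_(A <- s) \sum_(a < d A)
    ((complex.Re (coords y (existT _ A a)) - complex.Re (coords x (existT _ A a))) ^+ 2 +
     (complex.Im (coords y (existT _ A a)) - complex.Im (coords x (existT _ A a))) ^+ 2).
  pose l := \sum_(A <- s) \sum_(a < d A)
    ((re (existT _ A a) - complex.Re (coords x (existT _ A a))) ^+ 2 +
     (im (existT _ A a) - complex.Im (coords x (existT _ A a))) ^+ 2).
  have fl : f @ F --> l.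
    apply: cvg_big => [|A _]; first exact: add_continuous.
    apply: cvg_big => [|a _]; first exact: add_continuous.
    by apply: cvgD; apply: cvg_sqrB.
  have -> : \sum_(A <- s) bdot (z - coords x) (z - coords x) A = l%:C.
    rewrite rmorph_sum; apply: eq_bigr => A _; rewrite bdot_re; congr (_%:C).
    apply: eq_bigr => a _; rewrite -[(z - coords x) _]/(z _ - coords x _) !raddfB /=.
    by [].
  rewrite lecR; apply: (cvgr_to_le fl).
  suff h : F (fun y : E => f y <= e ^+ 2) by exact: h.
  apply: filterS Fx => y xy0; have xy := xy0 : `|x - y| < e%:C.
  rewrite -lecR; apply: le_trans (_ : ell2_dot (y - x) (y - x) <= _).
    apply: le_trans (ell2_partial (y - x) us); rewrite rmorph_sum; apply: ler_sum => A _.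
    rewrite bdot_re lecR; apply: ler_sum => a _.
    by rewrite -[coords (y - x) _]/(coords y _ - coords x _) !raddfB.
  rewrite ell2_normE -ell2_normrE distrC rmorphXn.
  have e0' : 0 <= e%:C :> R[i] by rewrite lecR.
  apply: lerXn2r; [exact: normr_ge0|exact: e0'|exact: ltW xy].
have ballx (e : R) : 0 < e -> exists x, F (ball x e%:C).
  by move=> e0; apply: Fc; rewrite ltcR.
have zE : sq_summable z.
  have [x /(zx _ _ ler01) h] := ballx _ ltr01.
  have h' : sq_summable (z - coords x) by exists (1 ^+ 2).
  by have := sq_summableD h' (subP x); rewrite subrK.
pose Z : E := mksub (A := ell2_space R d) zE.
apply/cvg_ex; exists Z; apply/cvg_ballP => e e_gt0.
have [t tE t_gt0] : exists2 t : R, e = t%:C & 0 < t.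
  have [t tE t0] := ge0_realc (ltW e_gt0); exists t => //.
  by move: e_gt0; rewrite tE ltcR.
have t2 : 0 < t / 2 by rewrite divr_gt0.
have [x Fx] := ballx _ t2.
suff h : F (fun y : E => `|Z - y| < e) by exact: h.
apply: filterS (Fx) => y xy0; have xy : `|x - y| < (t / 2)%:C := xy0.
have Zx : `|Z - x| <= (t / 2)%:C.
  rewrite -ler_sqr ?nnegrE// ?lecR ?(ltW t2)// ell2_normrE -ell2_normE -rmorphXn.
  by apply: ell2_dot_le => s us; exact: (zx x _ (ltW t2) Fx).
rewrite -(subrKA x) tE [t]splitr realcD; apply: le_lt_trans (ler_normD _ _) _.
exact: ler_ltD.
Qed.

HB.instance Definition _ := Uniform_isComplete.Build E ell2_complete.

Fact ell2_bilinear : bilinear_for (GRing.Scale.Law.clone _ _ *%R _)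
  (GRing.Scale.Law.clone _ _ (@Num.conj R[i] \; *%R) _) (@ell2_dot R IA d).
Proof.
by split=> [z c x y|z c x y]; [exact: ell2_dot_linl|exact: ell2_dot_linr].
Qed.

HB.instance Definition _ := bilinear_isBilinear.Build R[i] E E R[i] _ _ (@ell2_dot R IA d) ell2_bilinear.

Fact ell2_hermitian (x y : E) : ell2_dot x y = (-1) ^+ false * Num.conj (ell2_dot y x) :> R[i].
Proof. by rewrite expr0 mul1r; exact: ell2_dotC. Qed.

HB.instance Definition _ := isHermitianSesquilinear.Build R[i] E false (@Num.conj R[i])
  (@ell2_dot R IA d) ell2_hermitian.

Fact ell2_definite (u : E) : u != 0 -> 0 < ell2_dot u u.
Proof.
move=> u0; rewrite lt_def ell2_dot_ge0 andbT; apply: contra_neq u0 => u1.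
apply: ell2_norm_eq0; apply/eqP; rewrite -sqrf_eq0 -ell2_normE u1.
by [].
Qed.

HB.instance Definition _ := isDotProduct.Build R[i] E (@ell2_dot R IA d) ell2_definite.

Definition ell2_hilbert : hilbertType R :=
  @Hilbert R E (@ell2_dot R IA d) (@ell2_normE R IA d).
End BlockHilbert.

(** * The operator system dual to a positive matrix of functionals *)

Lemma ge0_limit (R : realType) (z u : R[i]) :
  (forall e : R, 0 < e -> 0 <= z + e%:C * u) -> 0 <= z.
Proof.
move=> zp; apply: ge0_approx => e e0.
have [r rE r0] : exists2 r : R, `|u| = r%:C & 0 <= r by apply: ge0_realc.
have r1 : 0 < r + 1 by rewrite ltr_wpDl.
exists (z + (e / (r + 1))%:C * u); first by apply: zp; rewrite divr_gt0.
rewrite addrAC subrr add0r cnormM rE norm_realc -realcM lecR ger0_norm; last first.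
  by rewrite divr_ge0 ?ltW.
by rewrite mulrAC ler_pdivrMr// ler_wpM2l ?lerDl ?ler01// ltW.
Qed.

Lemma has_sum_single (R : realType) (I : eqType) (a : I -> R[i]) i0 :
  (forall i, i != i0 -> a i = 0) -> has_sum a (a i0).
Proof.
move=> a0 e e0; exists [:: i0] => s us /(_ i0); rewrite mem_head => /(_ isT) si.
rewrite (bigD1_seq i0)//= big1 => [|i /a0//].
by rewrite addr0 subrr normr0 lecR ltW.
Qed.

Section Normalisation.
Variables (R : realType) (H : hilbertType R) (S : opsys H) (n : nat) (F : 'M[bdual S]_n).
Hypotheses (Fp : mpos n F) (F1 : unital F) (n0 : (0 < n)%N).
Let cS := @os_compressible _ _ S.
Let moS := os_matrix_ordered S.

(** Applied entrywise to [A], the trace functional of [F] gives [n] times the identity; [n] is its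
    value at 1 when [F] is unital. On such blocks the scalar matrix 1 acts as the identity, see
    [coefs1]. *)
Definition trace_normal p (A : 'M[S]_p) := mpos p A /\
  forall a a', \sum_k (F k k (A a a') : R[i]) = n%:R * (a == a')%:R.

Lemma sum_diag1 : \sum_k (F k k munit : R[i]) = n%:R.
Proof.
rewrite (eq_bigr (fun _ => 1)); last by move=> k _; rewrite F1 eqxx.
by rewrite sumr_const card_ord.
Qed.

Lemma trace_normal_unit p : trace_normal (\matrix_(a < p, a' < p) if a == a' then munit else 0).
Proof.
split; first by apply/(posI_mx cS)/(posI_diag moS) => _; exact: os_unit_pos.
move=> a a'; rewrite !mxE; case: eqVneq => _; rewrite ?mulr1 ?mulr0; first exact: sum_diag1.
by rewrite big1// => k _; rewrite linear0.
Qed.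

(* Congruence by a square root of the (invertible) trace matrix of
   [A + e]. *)
Lemma trace_normalise p (A : 'M[S]_p) (e : R) : mpos p A -> 0 < e ->
  exists (B : 'M[S]_p) (Y : 'M[R[i]]_p), trace_normal B /\
    forall a a', A a a' + (e%:C * (a == a')%:R) *: munit = mxcompress Y B a a'.
Proof.
move=> Ap e0; have dS := @os_dsummable _ _ S.
pose C : 'M[S]_p := \matrix_(a, a') (A a a' + e%:C *: (if a == a' then munit else 0)).
have CE a a' : C a a' = A a a' + (e%:C * (a == a')%:R) *: munit.
  by rewrite mxE; case: eqVneq; rewrite ?mulr1 ?mulr0 ?scale0r ?scaler0.
have Cp : mpos p C.
  apply/(posI_mx cS)/(posI_add cS dS); first exact/posI_ord.
  by apply: (posI_scale cS (ltW e0)); apply: (posI_diag moS) => _; exact: os_unit_pos.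
pose tr (X : 'M[S]_p) : 'M[R[i]]_p := \matrix_(a, a') \sum_k (F k k (X a a') : R[i]).
have trE X a a' : tr X a a' = \sum_k (F k k (X a a') : R[i]) by rewrite mxE.
have trp (X : 'M[S]_p) v : mpos p X -> 0 <= \sum_a \sum_a' Num.conj (v a) * v a' * tr X a a'.
  move=> /(posI_ord cS)/(pos1_compr cS v) Xp.
  have : 0 <= \sum_k (F k k (\sum_a \sum_a' (Num.conj (v a) * v a') *: X a a') : R[i]).
    by apply: sumr_ge0 => k _; exact: mpos_diag.
  congr (_ <= _); under eq_bigr do rewrite linfun_sum.
  under eq_bigr do under eq_bigr do rewrite linfun_sum.
  rewrite exchange_big12; apply: eq_bigr => a _; apply: eq_bigr => a' _.
  by rewrite mxE mulr_sumr; apply: eq_bigr => k _; rewrite linfunZ.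
have trC a a' : tr C a a' = tr A a a' + e%:C * n%:R * (a == a')%:R.
  rewrite !trE -sum_diag1 [e%:C * _]mulr_sumr mulr_suml -big_split; apply: eq_bigr => k _.
  by rewrite CE linfunD linfunZ mulrAC.
have [y yE] := psd_gram (fun v => trp C v Cp).
have yC : tr C = adjmx y *m y.
  by apply/matrixP => a a'; rewrite yE mxE; apply: eq_bigr => m _; rewrite !mxE.
have nR : (0 : R) < n%:R by rewrite ltr0n.
(* A kernel vector [v] of [y] annihilates the form of [tr C], which is at least [e n |v|^2] because
   [tr A] is positive. *)
have yu : y \in unitmx.
  rewrite -unitmx_tr -row_free_unit; apply: inj_row_free => v vy.
  have yv m : \sum_a y m a * v 0 a = 0.
    have := congr1 (fun X : 'rV_p => X 0 m) vy; rewrite !mxE => h; rewrite -[RHS]h.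
    by apply: eq_bigr => a _; rewrite mxE mulrC.
  have z0 : \sum_a \sum_a' Num.conj (v 0 a) * v 0 a' * tr C a a' = 0.
    transitivity (\sum_m Num.conj (\sum_a y m a * v 0 a) * \sum_a y m a * v 0 a).
      under eq_bigr do under eq_bigr do rewrite yE mulr_sumr.
      rewrite -exchange_big12; apply: eq_bigr => m _; rewrite conj_sum mulr_suml.
      apply: eq_bigr => a _; rewrite mulr_sumr; apply: eq_bigr => a' _.
      by rewrite conjM; ring.
    by rewrite big1// => m _; rewrite yv mulr0.
  have : e%:C * n%:R * \sum_a Num.conj (v 0 a) * v 0 a <= 0.
    apply: (le_trans _ (_ : \sum_a \sum_a' Num.conj (v 0 a) * v 0 a' * tr C a a' <= 0)); last by rewrite z0.
    rewrite -subr_ge0; have := trp A (fun a => v 0 a) Ap; congr (_ <= _).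
    rewrite mulr_sumr -sumrB; apply: eq_bigr => a _.
    rewrite -[X in _ - X](sum_delta (fun a' => e%:C * n%:R * (Num.conj (v 0 a) * v 0 a'))) -sumrB.
    by apply: eq_bigr => a' _; rewrite trC; ring.
  have en : 0 < e%:C * n%:R :> R[i] by rewrite mulr_gt0 ?ltr0n// ltcR.
  rewrite pmulr_rle0// => v0.
  have vp a : 0 <= Num.conj (v 0 a) * v 0 a by rewrite mulrC conjE mulcJ_ge0.
  have v00 : \sum_a Num.conj (v 0 a) * v 0 a = 0.
    by apply/eqP; rewrite eq_le v0 sumr_ge0.
  apply/rowP => a; rewrite mxE; apply/eqP; rewrite -normr_eq0 -sqrf_eq0 sqr_normc mulrC -conjE.
  by rewrite (psumr_eq0P (fun i _ => vp i) v00).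
pose r : R[i] := (Num.sqrt n%:R)%:C.
have rr : r * r = n%:R by rewrite /r -realcM -expr2 sqr_sqrtr ?ltW// rmorph_nat.
have r_neq0 : r != 0.
  apply/eqP => r0; move: rr; rewrite r0 mul0r => /esym/eqP; by rewrite pnatr_eq0 eqn0Ngt n0.
have rc : Num.conj r = r by exact: conjR.
(* Congruence by [sqrt n y^-1] turns [tr C = y^* y] into [n] times the identity. *)
pose Z := r *: invmx y; exists (mxcompress Z C), (r^-1 *: y); split; last first.
  move=> a a'; rewrite -CE mxcompress_comp -scalemxAl -scalemxAr scalerA divff// scale1r.
  by rewrite mulVmx// mxcompress1.
split; first exact: cS.
move=> b b'; transitivity ((adjmx Z *m tr C *m Z) b b').
  rewrite mxcompressE; under eq_bigr do rewrite linfun_sum.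
  under eq_bigr do under eq_bigr do rewrite linfun_sum.
  rewrite exchange_big12 exchange_big mxE; apply: eq_bigr => a' _.
  rewrite [X in _ = X * _]mxE mulr_suml; apply: eq_bigr => a _.
  rewrite trE mulr_sumr mulr_suml; apply: eq_bigr => k _; rewrite linfunZ mulrAC; congr (_ * _ * _).
  by rewrite !mxE.
have aZ : adjmx Z = r *: adjmx (invmx y).
  by apply/matrixP => a a'; rewrite !mxE conjM rc.
rewrite aZ yC -!scalemxAl -scalemxAr scalerA rr !mulmxA.
have -> : adjmx (invmx y) *m adjmx y = 1%:M.
  apply/matrixP => a a'; transitivity (Num.conj ((y *m invmx y) a' a)).
    by rewrite !mxE conj_sum; apply: eq_bigr => m _; rewrite !mxE conjM mulrC.
  by rewrite mulmxV// !mxE rmorph_nat eq_sym.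
by rewrite mul1mx mulmxV// !mxE.
Qed.
End Normalisation.

Section DualSystem.
Variables (R : realType) (H : hilbertType R) (S : opsys H) (n : nat) (F : 'M[bdual S]_n).
Hypotheses (Fp : mpos n F) (F1 : unital F) (n0 : (0 < n)%N).
Let cS := @os_compressible _ _ S.
Let moS := os_matrix_ordered S.

Definition block_index : eqType := {p : nat & 'M[S]_p}.
Definition block_dim (A : block_index) : nat := tag A.
Local Notation IA := block_index.
Local Notation J := {A : IA & 'I_(block_dim A)}.

(** Indexing by all matrices, with the identity substituted for those that are not normalised,
    avoids a subtype of indices. *)
Definition norm_mx (A : IA) : 'M[S]_(block_dim A) :=
  if pselect (trace_normal F (tagged A)) then tagged A
  else \matrix_(a, a') if a == a' then munit else 0.

Lemma norm_mxP A : trace_normal F (norm_mx A).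
Proof.
rewrite /norm_mx; case: (pselect (trace_normal F (tagged A))) => [h|_] /=.
  exact: h.
exact (trace_normal_unit F1 (block_dim A)).
Qed.

Lemma norm_mx_id p (A : 'M[S]_p) : trace_normal F A -> norm_mx (existT _ p A) = A.
Proof. by move=> h; rewrite /norm_mx; case: pselect => // nh; case: (nh h). Qed.

(** The block of [c] at [A] is the pairing of [c] with [A] through [F], divided by [n] so that
    [c = 1] gives the identity. *)
Definition coefs (c : Mn R n) (A : IA) (a a' : 'I_(block_dim A)) : R[i] :=
  n%:R^-1 * entry_comb F c (norm_mx A a a').
Arguments coefs : clear implicits.

Lemma coefs_lin c e c' A a a' : coefs (e *: c + c') A a a' = e * coefs c A a a' + coefs c' A a a'.
Proof.
rewrite /coefs entry_comb_linear bdualDE bdualZE; ring.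
Qed.

Lemma coefs1 A a a' : coefs 1%:M A a a' = (a == a')%:R.
Proof.
rewrite /coefs entry_combE (eq_bigr (fun k => F k k (norm_mx A a a') : R[i])).
  by rewrite (norm_mxP A).2 mulrA mulVf ?mul1r// pnatr_eq0 -lt0n.
move=> k _; rewrite -[RHS](sum_delta (fun l => F k l (norm_mx A a a') : R[i])).
by apply: eq_bigr => l _; rewrite mxE mulrC.
Qed.

Lemma entry_comb_ge0 (c : Mn R n) s : psd (fun k l => c k l) -> pos1 s -> (0 : R[i]) <= entry_comb F c s.
Proof.
move=> /psd_gram[y yE] sp; rewrite entry_combE.
rewrite [X in _ <= X](_ : _ = \sum_m \sum_k \sum_l Num.conj (y m k) * y m l * (F k l s : R[i])).
  apply: sumr_ge0 => m _; have := mpos_quad (y m) Fp sp; rewrite bdual_sumE; congr (_ <= _).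
  apply: eq_bigr => k _; rewrite bdual_sumE; apply: eq_bigr => l _; exact: bdualZE.
rewrite exchange_big12; apply: eq_bigr => k _; apply: eq_bigr => l _.
by rewrite yE mulr_suml.
Qed.

Lemma coefs_psd (c : Mn R n) A : psd (fun k l => c k l) -> psd (coefs c A).
Proof.
move=> cp v; have /(posI_ord cS)/(pos1_compr cS v) Xp := (norm_mxP A).1.
have nR : 0 <= n%:R^-1 :> R[i] by rewrite invr_ge0.
have := mulr_ge0 nR (entry_comb_ge0 cp Xp); congr (_ <= _).
rewrite linfun_sum mulr_sumr; apply: eq_bigr => a _; rewrite linfun_sum mulr_sumr.
by apply: eq_bigr => a' _; rewrite linfunZ mulrCA.
Qed.

Lemma coefs_star (c : Mn R n) A a a' : coefs (adjmx c) A a a' = Num.conj (coefs c A a' a).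
Proof.
rewrite /coefs conjM fmorphV rmorph_nat; congr (_ * _).
rewrite !entry_combE conj_sum; under [RHS]eq_bigr do rewrite conj_sum.
rewrite [RHS]exchange_big; apply: eq_bigr => k _; apply: eq_bigr => l _.
have /(posI_ord cS)/(posI_star moS) Xst := (norm_mxP A).1.
by rewrite conjM -dual_mpos_star// Xst !mxE.
Qed.

Definition mult (c : Mn R n) (x : J -> R[i]) : J -> R[i] :=
  fun i => \sum_a' coefs c (tag i) (tagged i) a' * x (existT _ (tag i) a').

Lemma mult_lin c e x y : mult c (e *: x + y) = e *: mult c x + mult c y.
Proof.
apply/funext => i; rewrite -[RHS]/(e * mult c x i + mult c y i) mulr_sumr -big_split.
apply: eq_bigr => a _ /=.
by rewrite -[(e *: x + y) _]/(e * x _ + y _); ring.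
Qed.

Lemma mult_linl c e c' x : mult (e *: c + c') x = e *: mult c x + mult c' x.
Proof.
apply/funext => i; rewrite -[RHS]/(e * mult c x i + mult c' x i) mulr_sumr -big_split.
by apply: eq_bigr => a _ /=; rewrite coefs_lin; ring.
Qed.

Lemma mult1 x : mult 1%:M x = x.
Proof.
apply/funext => -[A a]; rewrite -[RHS](@sum_delta R 'I_(block_dim A) (fun a' => x (existT _ A a'))).
by apply: eq_bigr => a' _; rewrite coefs1 mulrC.
Qed.

Lemma bdot_mult c x y A : bdot (d := block_dim) (mult c x) y A =
  \sum_(a < block_dim A) \sum_(a' < block_dim A) Num.conj (y (existT _ A a)) * x (existT _ A a') * coefs c A a a'.
Proof.
apply: eq_bigr => a _; rewrite mulr_suml; apply: eq_bigr => a' _ /=; ring.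
Qed.

Lemma bdot_mult_star (c : Mn R n) x y A : bdot (d := block_dim) (mult c x) y A = bdot x (mult (adjmx c) y) A.
Proof.
rewrite [RHS]bdotC !bdot_mult conj_sum; under [RHS]eq_bigr do rewrite conj_sum.
rewrite [RHS]exchange_big; apply: eq_bigr => a _; apply: eq_bigr => a' _.
by rewrite coefs_star (conjM (_ * _)) (conjM (Num.conj _)) !conjCK [x _ * _]mulrC.
Qed.

Lemma bdot_mult_ge0 (c : Mn R n) x A : psd (fun k l => c k l) -> 0 <= bdot (d := block_dim) (mult c x) x A.
Proof. by move=> /coefs_psd; rewrite bdot_mult; exact. Qed.

(** The bound has to be uniform over the blocks. For [0 <= c <= t] every block lies between 0 and
    [t], so its square is at most [t^2] by Cauchy-Schwarz, and such [c] span [M_n]. *)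
Lemma mult_bounded (c : Mn R n) : exists2 M : R, 0 <= M & forall x A,
  bdot (d := block_dim) (mult c x) (mult c x) A <= M%:C * bdot x x A.
Proof.
move: c; apply: mn_psd_ind => [|e c c' [M M0 cM] [N N0 cN]|c cp [t t0 tc]].
- exists 0 => // x A; rewrite (_ : mult 0 x = 0).
    by rewrite /bdot big1 ?mul0r// => a _; rewrite -[(0 : J -> R[i]) _]/(0 : R[i]) mul0r.
  apply/funext => i; rewrite /mult big1// => a _.
  have := coefs_lin 0 (-1) 0 (tagged i) a; rewrite scaler0 addr0 mulN1r addNr => ->.
  by rewrite mul0r.
- have [s sE s0] : exists2 s : R, Num.conj e * e = s%:C & 0 <= s.
    by apply: ge0_realc; rewrite mulrC conjE mulcJ_ge0.
  exists (2 * (s * M) + 2 * N); first by rewrite addr_ge0 ?mulr_ge0.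
  move=> x A; rewrite mult_linl; apply: le_trans (bdotD_le _ _ _) _.
  have two : (2 : R)%:C = 2 :> R[i] by rewrite rmorph_nat.
  have -> : (2 * (s * M) + 2 * N)%:C * bdot x x A = 2 * (s%:C * (M%:C * bdot x x A)) + 2 * (N%:C * bdot x x A) :> R[i].
    by rewrite realcD !realcM two; ring.
  apply: lerD; apply: ler_wpM2l => //.
  rewrite (_ : bdot _ _ _ = s%:C * bdot (mult c x) (mult c x) A).
    by apply: ler_wpM2l; rewrite ?lecR.
  rewrite -sE mulr_sumr; apply: eq_bigr => a _.
  by rewrite -[(e *: mult c x) _]/(e * mult c x _) conjM; ring.
exists (t * t) => [|x A]; first exact: mulr_ge0.
have le y : bdot (d := block_dim) (mult c y) y A <= t%:C * bdot y y A.
  rewrite -subr_ge0; have tp : psd (fun k l => (t%:C *: 1%:M - c) k l).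
    move=> v; have := tc v; congr (_ <= _); apply: eq_bigr => k _; apply: eq_bigr => l _.
    by rewrite !mxE.
  have := bdot_mult_ge0 y A tp; congr (_ <= _).
  rewrite addrC -scaleN1r mult_linl bdot_lin mulN1r addrC -[t%:C *: _]addr0.
  have m0 : mult 0 y = 0.
    have := mult_linl 0 (-1) 0 y; rewrite scaler0 addr0 scaleN1r addNr; exact.
  have bZ k z w : bdot (d := block_dim) (k *: z) w A = k * bdot z w A.
    by rewrite mulr_sumr; apply: eq_bigr => a _; rewrite -[(k *: z) _]/(k * z _) mulrA.
  by rewrite mult_linl mult1 m0 addr0 bZ.
pose B x y := bdot (d := block_dim) (mult c x) y A.
have := psd_CauchySchwarz (B := B) _ _ _ x (mult c x).
rewrite /B => /(_ _ _ _) CS.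
have {CS} : `|bdot (d := block_dim) (mult c x) (mult c x) A| ^+ 2 <= bdot (mult c x) x A * bdot (mult c (mult c x)) (mult c x) A.
  apply: CS => [a u v z|a u v z|u].
  - by rewrite mult_lin bdot_lin.
  - by rewrite bdot_linr.
  - exact: bdot_mult_ge0.
have := le x; have := le (mult c x).
have := bdot_mult_ge0 (mult c x) A cp; have := bdot_mult_ge0 x A cp.
have [N -> N0] := ge0_realc (bdot_ge0 (d := block_dim) (mult c x) A).
have [X -> X0] := ge0_realc (bdot_ge0 (d := block_dim) x A).
move=> /ge0_realc[P -> P0] /ge0_realc[Q -> Q0].
rewrite norm_realc -!realcM -rmorphXn !lecR /= ger0_norm// => QN PX NPQ.
have [->|N1] := eqVneq N 0; first by rewrite !mulr_ge0.
have N_gt0 : 0 < N by rewrite lt_def N1.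
rewrite -(ler_pM2r N_gt0) -expr2; apply: le_trans NPQ _.
apply: le_trans (_ : (t * X) * (t * N) <= _); first exact: ler_pM.
by rewrite le_eqVlt; apply/orP; left; apply/eqP; ring.
Qed.
End DualSystem.

Section TensorSystem.
Variables (R : realType) (H : hilbertType R) (S1 : opsys H).
Variables (n : nat) (F : 'M[bdual S1]_n).
Hypotheses (Fp : mpos n F) (F1 : unital F) (n0 : (0 < n)%N).
Let cS := @os_compressible _ _ S1.

Local Notation IA := (block_index S1).
Local Notation dm := (@block_dim _ _ S1).
Local Notation J := {A : IA & 'I_(dm A)}.
Local Notation K := (@ell2_hilbert R IA dm).
Local Notation E := (@ell2 R IA dm).
Local Notation mu := (@mult _ _ S1 n F).

Lemma mult_partial c (x : E) (M : R) : 0 <= M ->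
  (forall x A, bdot (d := dm) (mu c x) (mu c x) A <= M%:C * bdot x x A) ->
  forall s, uniq s -> \sum_(A <- s) bdot (mu c (coords x)) (mu c (coords x)) A <= M%:C * ell2_dot x x.
Proof.
move=> M0 cM s us; apply: le_trans (ler_sum _ (fun A _ => cM (coords x) A)) _.
by rewrite -mulr_sumr ler_wpM2l ?lecR ?ell2_partial.
Qed.

Lemma mult_summable c (x : E) : sq_summable (mu c (coords x)).
Proof.
have [M M0 cM] := mult_bounded Fp F1 n0 c.
have [r rE r0] := ge0_realc (ell2_dot_ge0 x).
by exists (M * r) => s us; rewrite realcM -rE; exact: mult_partial.
Qed.

Definition mult_fun c (x : K) : K := mksub (A := ell2_space R dm) (mult_summable c x).

Lemma coords_mult c (x : K) : coords (mult_fun c x) = mu c (coords x).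
Proof. by []. Qed.

Fact mult_fun_bounded c : bounded_linear (mult_fun c).
Proof.
have [M M0 cM] := mult_bounded Fp F1 n0 c; split.
  move=> a x y; apply: coords_inj; rewrite coords_mult !coords_lin mult_lin.
  by [].
exists (M + 1); split=> [|x]; first by rewrite addr_ge0.
have [r rE r0] := ge0_realc (ell2_dot_ge0 x).
have h : ell2_dot (mult_fun c x) (mult_fun c x) <= (M * r)%:C.
  by apply: ell2_dot_le => s us; rewrite realcM -rE; exact: mult_partial.
have M1 : 0 <= (M + 1)%:C :> R[i] by rewrite lecR addr_ge0.
rewrite -ler_sqr ?nnegrE ?mulr_ge0// exprMn.
have nE (z : E) : `|z| ^+ 2 = ell2_dot z z by rewrite ell2_normE.
rewrite (nE (mult_fun c x)) (nE x); apply: le_trans h _.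
rewrite rE -rmorphXn -realcM lecR ler_wpM2r//.
by rewrite expr2 mulrDl mul1r mulrDr mulr1 addrC -!addrA lerDl addrA !addr_ge0 ?mulr_ge0.
Qed.

Definition mult_op c : BH K := mkbop (mult_fun_bounded c).

Lemma mult_op_lin a c c' : mult_op (a *: c + c') = a *: mult_op c + mult_op c'.
Proof.
apply: bop_ext => x; rewrite bopDE bopZE; apply: coords_inj.
rewrite [in RHS]coords_lin !coords_mult mult_linl.
by [].
Qed.

Lemma mult_op0 : mult_op 0 = 0.
Proof. by have := mult_op_lin (-1) 0 0; rewrite scaler0 addr0 scaleN1r addNr. Qed.

Lemma mult_op1 : mult_op 1%:M = munit.
Proof.
by apply: bop_ext => x; apply: coords_inj; rewrite coords_mult mult1.
Qed.

Definition mult_set : set (BH K) := [set X | exists c, X = mult_op c].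

Fact mult_set0 : mult_set 0. Proof. by exists 0; rewrite mult_op0. Qed.

Fact mult_setD x y : mult_set x -> mult_set y -> mult_set (x + y).
Proof.
move=> [c ->] [c' ->]; exists (1 *: c + c').
by rewrite mult_op_lin scale1r.
Qed.

Fact mult_setZ a x : mult_set x -> mult_set (a *: x).
Proof. by move=> [c ->]; exists (a *: c + 0); rewrite mult_op_lin mult_op0 addr0. Qed.

Definition mult_space : linsub (BH K) := LinSub mult_set0 mult_setD mult_setZ.

Fact mult_unit : mult_space munit. Proof. by exists 1%:M; rewrite mult_op1. Qed.

Fact mult_star T : mult_space T -> exists2 T', mult_space T' & adjoint T T'.
Proof.
move=> [c ->]; exists (mult_op (adjmx c)); first by exists (adjmx c).
move=> x y.
suff h : ell2_dot (mult_fun c x : E) y = ell2_dot (x : E) (mult_fun (adjmx c) y) by exact: h.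
apply: ell2_dotE.
apply: eq_has_sum (ell2_dotP (x : E) (mult_fun (adjmx c) y)) => A.
by rewrite !coords_mult (bdot_mult_star Fp F1).
Qed.

Definition mult_sys : opsys K := OpSys mult_unit mult_star.

Definition mult_rho c : mult_sys := mksub (A := mult_space) (ex_intro _ c erefl : mult_space (mult_op c)).

Lemma mult_rho_lin a c c' : mult_rho (a *: c + c') = a *: mult_rho c + mult_rho c'.
Proof. by apply: val_inj; exact: mult_op_lin. Qed.

Lemma osq_rho c x y : has_sum (fun A => bdot (mu c (coords (x : E))) (coords (y : E)) A) (osq (mult_rho c) x y).
Proof. exact: (ell2_dotP (mult_fun c x) y). Qed.

Lemma has_sum_sum (T : eqType) (I : finType) (a : I -> T -> R[i]) (l : I -> R[i]) :
  (forall i, has_sum (a i) (l i)) -> has_sum (fun t => \sum_i a i t) (\sum_i l i).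
Proof.
move=> al; elim: (index_enum I) => [|i r IHr].
  rewrite big_nil (_ : (fun t => _) = (fun _ => 0)); first exact: has_sum0.
  by apply/funext => t; rewrite big_nil.
rewrite big_cons -[l i]mul1r; apply: eq_has_sum (has_sum_lin 1 (al i) IHr) => t.
by rewrite big_cons mul1r.
Qed.

(** Block by block this is [dual_schur_ge0], for the rank-one scalar matrix formed from the
    coordinates of [v]. *)
Lemma rho_units_pos : mpos n (\matrix_(k, l) mult_rho (delta_mx k l)).
Proof.
apply/os_mposE => v; pose V k : J -> R[i] := coords (v k : E).
have h := has_sum_sum (fun k => has_sum_sum (fun l => osq_rho (delta_mx k l) (v l) (v k))).
have h' : 0 <= \sum_k \sum_l osq (mult_rho (delta_mx k l)) (v l) (v k).
  apply: has_sum_ge0 h => s us; exists s; split=> //; apply: sumr_ge0 => A _.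
  have /(posI_ord cS) Ap := (norm_mxP F1 A).1.
  have := dual_schur_ge0 Fp Ap (psd_outer (fun u : 'I_(dm A) * 'I_n => V u.2 (existT _ A u.1))).
  have nR : 0 <= n%:R^-1 :> R[i] by rewrite invr_ge0.
  move=> /(mulr_ge0 nR); congr (_ <= _).
  rewrite mulr_sumr; under eq_bigr do rewrite mulr_sumr.
  under eq_bigr do under eq_bigr do rewrite mulr_sumr.
  under eq_bigr do under eq_bigr do under eq_bigr do rewrite mulr_sumr.
  rewrite exchange_big22; apply: eq_bigr => k _; apply: eq_bigr => l _.
  rewrite bdot_mult; apply: eq_bigr => a _; apply: eq_bigr => a' _.
  have E0 : coefs F (delta_mx k l) (A := A) a a' = n%:R^-1 * (F k l (norm_mx F A a a') : R[i]).
    rewrite /coefs entry_combE; congr (_ * _).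
    rewrite (bigD1 k)//= [X in _ + X]big1 ?addr0.
      rewrite (bigD1 l)//= [X in _ + X]big1 ?addr0; first by rewrite mxE !eqxx mul1r.
      by move=> l' /negbTE ll; rewrite mxE ll andbF mul0r.
    by move=> k' /negbTE kk; rewrite big1// => l' _; rewrite mxE kk mul0r.
  by rewrite E0 /V /=; ring.
move: h'; congr (_ <= _); apply: eq_bigr => k _; apply: eq_bigr => l _.
by rewrite mxE.
Qed.
End TensorSystem.

Lemma complete_order_embedding_order (R : realType) (V W : mconeType R) (f : V -> W) :
  complete_order_embedding f -> order_embedding f.
Proof.
move=> [inj emb]; split=> // x; rewrite /pos1 emb.
by rewrite (_ : map_mx f (const_mx x) = const_mx (f x))//; apply/matrixP => k l; rewrite !mxE.
Qed.

Section SystemToLocal.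
Variables (R : realType) (H : hilbertType R) (S1 S2 : opsys H).
Hypothesis S12 : forall T : BH H, os_space S1 T -> os_space S2 T.
Let j : {linear S1 -> S2} := os_incl S12.
Variables (n : nat) (F : 'M[bdual S1]_n).
Hypotheses (Fp : mpos n F) (F1 : unital F) (n0 : (0 < n)%N).
Let moS := os_matrix_ordered S1.

Local Notation IA := (block_index S1).
Local Notation dm := (@block_dim _ _ S1).
Local Notation J := {A : IA & 'I_(dm A)}.
Local Notation E := (@ell2 R IA dm).
Local Notation T := (mult_sys Fp F1 n0).
Local Notation rho := (mult_rho Fp F1 n0).

Lemma block_vector (A : IA) (y : 'I_(dm A) -> R[i]) : exists x : E,
  (forall a, coords x (existT _ A a) = y a) /\
  forall A' a, A' != A -> coords x (existT _ A' a) = 0.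
Proof.
(* [insub] recovers an index of ['I_(dm A)] from its value without a cast along [tag i = A]; within
   block [A] the default 0 never occurs. *)
pose w : J -> R[i] := fun i => if tag i == A then
  oapp y 0 (insub (nat_of_ord (tagged i)) : option 'I_(dm A)) else 0.
have wA a : w (existT _ A a) = y a by rewrite /w eqxx /= valK.
have w0 A' a : A' != A -> w (existT _ A' a) = 0 by rewrite /w /= => /negbTE ->.
have wsum : sq_summable w.
  have [M ME M0] := ge0_realc (bdot_ge0 w A); exists M => s us; rewrite -ME.
  apply: (has_sum_partial (bdot_ge0 w) _ us); apply: has_sum_single => A' A'A.
  by rewrite /bdot big1// => a _; rewrite w0 ?mul0r.
by exists (mksub (A := ell2_space R dm) wsum).
Qed.

(** The columns of [Y], placed in the block of [B], realise the pairing of [c] with a congruence of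
    [B] as matrix coefficients of the operator of [c]. Operator positivity thereby yields positivity
    of the pairing with matrices over [S1]. *)
Lemma normal_vectors p (B : 'M[S1]_p) q (Y : 'M[R[i]]_(p, q)) : trace_normal F B ->
  exists v : 'I_q -> E, forall c a a',
    entry_comb F c (mxcompress Y B a a') = n%:R * osq (rho c) (v a') (v a).
Proof.
move=> Bn; pose A : IA := existT _ p B.
have /choice[v vE] : forall a, exists x : E, (forall b, coords x (existT _ A b) = Y b a) /\
    forall A' b, A' != A -> coords x (existT _ A' b) = 0.
  by move=> a; exact: (@block_vector A (fun b => Y b a)).
exists v => c a a'.
have oE : osq (rho c) (v a') (v a) = bdot (mult F c (coords (v a'))) (coords (v a)) A.
  apply: has_sum_unique (osq_rho Fp F1 n0 c (v a') (v a)) _.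
  apply: has_sum_single => A' A'A; rewrite /bdot big1// => b _.
  by rewrite (vE a).2// conj0 mulr0.
have nR : n%:R != 0 :> R[i] by rewrite pnatr_eq0 -lt0n.
rewrite oE bdot_mult mxcompressE linfun_sum mulr_sumr; apply: eq_bigr => b _.
rewrite linfun_sum mulr_sumr; apply: eq_bigr => b' _.
rewrite linfunZ (vE a).1 (vE a').1 /coefs norm_mx_id// mulrCA; congr (_ * _).
by rewrite mulrA divff// mul1r.
Qed.

Lemma mult_rho_ker c : rho c = 0 -> entry_comb F c = 0.
Proof.
move=> c0; apply: bop_ext => s.
pose f : {linear S1 -> R[i]^o} := entry_comb F c.
suff : f s = 0 by [].
move: s; apply: (mo_gen moS) => [|a x y fx fy|s sp _].
- exact: linear0.
- by rewrite linfunD linfunZ fx fy mulr0 addr0.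
(* After adding [e], the positive [s] is a congruence of a normalised matrix, so [f] vanishes at
   [s + e 1]; two values of [e] then give [f s = 0]. *)
have fe (e : R) : 0 < e -> f s + e%:C * (f munit : R[i]) = 0.
  move=> e0; have [B [Y [Bn AE]]] := trace_normalise Fp F1 n0 (sp : mpos 1 (const_mx s)) e0.
  have [v vE] := normal_vectors Y Bn.
  have := vE c ord0 ord0; rewrite -AE c0 osq0 mulr0 mxE mulr1 => h.
  by rewrite -linfunZ -linfunD.
have h1 := fe 1 ltr01; have h2 := fe 2 (ltr0n _ 2).
have two : (2 : R)%:C = 2 :> R[i] by rewrite rmorph_nat.
move: h1 h2; rewrite realc1 mul1r two; set x : R[i] := f s; set y : R[i] := f munit.
move=> h1 h2; transitivity (2 * (x + y) - (x + 2 * y) : R[i]); first by ring.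
by rewrite h1 h2 mulr0 subr0.
Qed.

Lemma tensor_system_local :
  complete_order_embedding (tmax_map j : tmax S1 T -> tmax S2 T) -> local_extension S12 F.
Proof.
move=> /complete_order_embedding_order emb.
pose e : 'M[T]_n := \matrix_(k, l) rho (delta_mx k l).
have uP (t : T) : exists c, t = rho c.
  have [c cE] := subP t; exists c; exact: val_inj.
have [u uE] := choice uP.
have ru c : entry_comb F (u (rho c)) = entry_comb F c.
  have : rho (-1 *: u (rho c) + c) = 0 by rewrite mult_rho_lin -uE scaleN1r addNr.
  by move=> /mult_rho_ker; rewrite entry_comb_linear scaleN1r addrC => /subr0_eq ->.
have ulin : linear (fun t => entry_comb F (u t)).
  by move=> a x y; rewrite [in LHS](uE x) [in LHS](uE y) -mult_rho_lin ru entry_comb_linear.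
have [||b bE] := @mk_bilin R S1 T (fun s t => entry_comb F (u t) s).
- by move=> t a x y; rewrite linearP.
- by move=> s a x y; rewrite ulin.
have rho0 : rho 0 = 0.
  by have := mult_rho_lin Fp F1 n0 (-1) 0 0; rewrite scaler0 addr0 scaleN1r addNr.
apply: (@tensor_local_extension _ _ _ _ S12 n F T _ e b (os_matrix_ordered T) emb).
- exact: rho_units_pos.
- move=> c c0; have [r rE] := mk_linear_map (mult_rho_lin Fp F1 n0).
  have E0 : \sum_k \sum_l c k l *: e k l = rho c.
    rewrite -rE [in RHS](mx_units_sum c) linear_sum; apply: eq_bigr => k _.
    by rewrite linear_sum; apply: eq_bigr => l _; rewrite linearZ rE mxE.
  rewrite E0; apply: osq_ext => v w; rewrite osq0.
  apply: has_sum_unique (osq_rho Fp F1 n0 c v w) _.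
  rewrite (_ : (fun A => _) = (fun _ => 0)); first exact: has_sum0.
  apply/funext => A; rewrite bdot_mult big1// => a _; rewrite big1// => a' _.
  by rewrite /coefs /entry_comb c0 mulr0 mulr0.
- move=> s k l; rewrite bE mxE ru entry_combE (bigD1 k)//= [X in _ + X]big1 ?addr0.
    rewrite (bigD1 l)//= [X in _ + X]big1 ?addr0; first by rewrite mxE !eqxx mul1r.
    by move=> l' /negbTE ll; rewrite mxE ll andbF mul0r.
  by move=> k' /negbTE kk; rewrite big1// => l' _; rewrite mxE kk mul0r.
move=> I A B Ap Bp.
(* [A] has to be shifted by [d] before it can be normalised. The sign of the resulting correction is
   not controlled, so [ge0_limit] lets it tend to 0. *)
apply: (@ge0_limit _ _ (\sum_a (entry_comb F (u (B a a)) munit : R[i]))) => d d0.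
have [C [Y [Cn AE]]] := trace_normalise Fp F1 n0 Ap d0.
have [v vE] := normal_vectors Y Cn.
have /os_mposE/(_ v) := Bp.
have nR : 0 <= n%:R :> R[i] by exact: ler0n.
move=> /(mulr_ge0 nR); congr (_ <= _).
rewrite mulr_sumr [X in _ = X + _]reindex_enum_val [X in _ = _ + _ * X]reindex_enum_val.
rewrite mulr_sumr -big_split; apply: eq_bigr => a _.
rewrite mulr_sumr [X in _ = X + _]reindex_enum_val.
rewrite -[X in _ = _ + X](@sum_delta R 'I_#|I| (fun a' => d%:C *
  (entry_comb F (u (B (enum_val a) (enum_val a'))) munit : R[i]))) -big_split.
apply: eq_bigr => a' _ /=; rewrite bE mxE.
have -> : osq (B (enum_val a) (enum_val a')) (v a') (v a) =
    osq (rho (u (B (enum_val a) (enum_val a')))) (v a') (v a) by rewrite -uE.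
rewrite -vE -AE mxE linfunD linfunZ mulrAC.
by [].
Qed.
End SystemToLocal.

(** * The theorem *)

Section Criteria.
Variables (R : realType) (H : hilbertType R) (S1 S2 : opsys H).
Hypothesis S12 : forall T : BH H, os_space S1 T -> os_space S2 T.
Let j : {linear S1 -> S2} := os_incl S12.

Lemma unital_dual_extension :
  (forall n (F : 'M[bdual S1]_n), mpos n F -> unital F -> local_extension S12 F) ->
  dual_extension S12.
Proof. by move=> LE; apply: local_extension_dual => n F; apply: local_extension_unital => m G; exact: LE. Qed.

Lemma matrix_system_dual_extension :
  (forall n (Q : msys R n) (phi : {linear S1 -> Q}), ucp phi ->
     exists2 phi' : {linear S2 -> Q}, ucp phi' & forall s, phi' (j s) = phi s) ->
  dual_extension S12.
Proof. by move=> ext; apply: unital_dual_extension => n F Fp F1; exact: matrix_system_local. Qed.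

Lemma bidual_dual_extension :
  (forall (K : hilbertType R) (T : opsys K) (phi : {linear S1 -> bidual T}), ucp phi ->
     exists2 phi' : {linear S2 -> bidual T}, ucp phi' & forall s, phi' (j s) = phi s) ->
  dual_extension S12.
Proof.
(* The canonical inclusion is itself a ucp map into a bidual, and an extension of it is what w.r.i.
   asks for. *)
move=> ext; have [phi phiE] := mk_linear_map (@bidual_in_linear R S1).
have phiucp : ucp phi.
  split=> [n A Ap|]; last exact: phiE.
  rewrite (_ : map_mx phi A = map_mx (@bidual_in R S1) A).
    exact: (bidual_in_cp (@os_compressible _ _ S1)).
  by apply/matrixP => k l; rewrite !mxE phiE.
have [Phi Phiucp PhiE] := ext _ _ _ phiucp.
apply/wri_dual_extension; exists Phi => // s.
by rewrite -phiE -PhiE.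
Qed.

Lemma quotient_dual_extension :
  (forall n (J : linsub (Mn R n)), null_subspace J ->
     order_embedding (tmax_map j : tmax S1 (quo J) -> tmax S2 (quo J))) ->
  dual_extension S12.
Proof. by move=> emb; apply: unital_dual_extension => n F Fp F1; exact: quotient_local. Qed.

Lemma tensor_dual_extension :
  (forall (K : hilbertType R) (T : opsys K),
     complete_order_embedding (tmax_map j : tmax S1 T -> tmax S2 T)) ->
  dual_extension S12.
Proof.
(* The Hilbert sum involves division by [n]; for [n = 0] the empty matrix is a local extension. *)
move=> emb; apply: unital_dual_extension => -[|n] F Fp F1; last first.
  exact: (@tensor_system_local _ _ _ _ S12 _ _ Fp F1 isT (emb _ _)).
exists 0; split=> [|[]//|c _]; last by rewrite big_ord0.
by apply/(dual_mposP (@os_compressible _ _ S2)) => A _; rewrite big_ord0.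
Qed.

Lemma state_dual_extension : (forall phi, state_extension_at S12 phi) -> dual_extension S12.
Proof. by move=> ext; apply: local_extension_dual => n F Fp; exact: state_local_extension. Qed.

(** Restricted to the canonical copy of [S2] in its bidual, [E] is the map that w.r.i. asks for. *)
Lemma retraction_dual_extension (E : {linear bidual S2 -> bidual S1}) : ucp E ->
  (forall x, E (bidual_map (os_incl S12) x) = x) -> dual_extension S12.
Proof.
move=> [Ecp E1] Ej.
have lin : linear (fun s : S2 => E (bidual_in s)).
  by move=> a x y; rewrite bidual_in_linear linearP.
have [Phi PhiE] := mk_linear_map lin.
apply/wri_dual_extension; exists Phi => [|s]; last first.
  rewrite PhiE -[RHS]Ej; congr (E _).
  by apply: bop_ext => f.
split=> [n A Ap|]; last by rewrite PhiE -E1.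
have := Ecp _ _ (bidual_in_cp (@os_compressible _ _ S2) Ap); congr (mpos _ _).
by apply/matrixP => k l; rewrite !mxE PhiE.
Qed.

Lemma quotient_order_embedding n (J : linsub (Mn R n)) : dual_extension S12 -> null_subspace J ->
  let i : tmax S1 (quo J) -> tmax S2 (quo J) := tmax_map j in
  i munit = munit /\ order_embedding i.
Proof.
move=> de [Jst _]; split.
  exact: (etrans (tens_map_tensor j munit munit) (congr1 (fun s => tpure s munit) (os_incl_unit S12))).
apply: complete_order_embedding_order.
exact: (dual_extension_tensor (quo_matrix_ordered Jst)).
Qed.
End Criteria.

Theorem theorem2p1 (R : realType) (H : hilbertType R) (S1 S2 : opsys H)
    (S12 : forall T : BH H, os_space S1 T -> os_space S2 T) :
  let j : bop S1 S2 := os_incl S12 in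
  [<->
   (* 1 *)
   wri j;
   (* 2 *)
   forall (n : nat) (Q : msys R n) (phi : {linear S1 -> Q}), ucp phi ->
     exists2 phi' : {linear S2 -> Q}, ucp phi' & forall s, phi' (j s) = phi s;
   (* 3 *)
   forall (K : hilbertType R) (T : opsys K) (phi : {linear S1 -> bidual T}),
     ucp phi ->
     exists2 phi' : {linear S2 -> bidual T},
       ucp phi' & forall s, phi' (j s) = phi s;
   (* 4 *)
   forall (n : nat) (J : linsub (Mn R n)), null_subspace J ->
     let i : tmax S1 (quo J) -> tmax S2 (quo J) := tmax_map j in
     i munit = munit /\ order_embedding i;
   (* 5 *)
   forall (K : hilbertType R) (T : opsys K),
     complete_order_embedding (tmax_map j : tmax S1 T -> tmax S2 T);
   (* 6 *)
   forall phi : state S1, exists phi' : state S2,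
     [/\ forall s, phi' (j s) = phi s,
         forall psi : bdual S1, dual_pos psi -> dual_le psi phi ->
           exists psi' : bdual S2,
             [/\ forall s, psi' (j s) = psi s, dual_pos psi' & dual_le psi' phi']
       & exists2 Theta : {linear effros phi -> effros phi'}, cp Theta &
           forall psi : effros phi,
             dual_pos (effros_val psi) -> dual_le (effros_val psi) phi ->
             [/\ forall s, effros_val (Theta psi) (j s) = effros_val psi s,
                 dual_pos (effros_val (Theta psi))
               & dual_le (effros_val (Theta psi)) phi']];
   (* 7 *)
   wri (bidual_map j) /\
   exists2 E : {linear bidual S2 -> bidual S1}, ucp E &
     forall x, E (bidual_map j x) = x].
Proof.
move=> j; tfae.
- by move=> /(wri_dual_extension S12) de n Q phi; exact: extend_matrix_system.
- by move=> /matrix_system_dual_extension de K T phi; exact: extend_into_bidual.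
- by move=> /bidual_dual_extension de n J; exact: quotient_order_embedding.
- move=> emb; have de : dual_extension S12.
    by apply: quotient_dual_extension => n J Jn; have [] := emb n J Jn.
  by move=> K T; exact: dual_extension_tensor (os_matrix_ordered T) de.
- by move=> /tensor_dual_extension de; exact: dual_extension_state.
- by move=> /state_dual_extension de; exact: bidual_retraction.
- move=> [_ [E Eucp Ej]]; apply/(wri_dual_extension S12).
  exact: retraction_dual_extension Ej.
Qed.
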